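(* Let $K_m$ be the Bernoulli-Euler numbers, and let $p_{k,d}(x)$ ($k\ge1$, $0\le d\le k-1$) be the real polynomials, of degree $k-d-1$, such that for all integers $n\ge0$, $l\ge0$ with $(n,l)\neq(0,0)$ $$K_n^l=\sum_{k=1}^{[l/2]+1}\left(\frac{(-1)^{k-1}}{2^{k-1}(k-1)!}\,\frac{l!}{(l-2k+2)!}\sum_{d=0}^{k-1}p_{k,d}(l)\,n^d\right)K_{n+2(l-k)+1}.$$ (i) Let $n\le0$ and $l>\max(1,-n)$ be integers. Then $$0=K_n^l=K_{n+2l-1}+\sum_{k=2}^{[l/2]+1}\left(\frac{(-1)^{k-1}}{2^{k-1}(k-1)!}\,\frac{l!}{(l-2k+2)!}\sum_{d=0}^{k-1}p_{k,d}(l)\,n^d\right)K_{n+2(l-k)+1}.$$ (ii) If $l=-n\ge1$, then $$(l-1)!=K_n^{-n}=K_{l-1}+\sum_{k=2}^{[l/2]+1}\left(\frac{(-1)^{k-1}}{2^{k-1}(k-1)!}\,\frac{l!}{(l-2k+2)!}\sum_{d=0}^{k-1}p_{k,d}(l)\,(-l)^d\right)K_{l-2k+1}.$$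
   Context: The Bernoulli-Euler numbers $K_m$ (one index), $m\ge0$, are defined by $\sec t+\tan t=\sum_{m\ge0}K_m t^m/m!$ (so $1,1,1,2,5,16,61,\dots$). Conventions: $n^0=1$ (also for $n=0$); an empty sum is $0$; a term $c\cdot K_m$ with $c=0$ is $0$ even if $m<0$; $[\,\cdot\,]$ is the integer part. For an integer $n\ge 1$ let $P_n$ be the space of real polynomials of the form $x^n+\lambda_2x^{n-2}+\cdots+\lambda_{n-1}x$, with the topology of the coefficients $\lambda_i\in\mathbb R$ (so $P_1=\{x\}$, $P_2=\{x^2\}$). For $l\ge 0$ consider pairs $(f;b_1,\dots,b_l)\in P_n\times\mathbb R^l$; the $b_i$ are the (labelled) boundary points and the numbers $f(b_i)$ are the boundary values. Such a pair is a very nice M-morsification of $B_n^l$ if all $n-1$ critical points of $f$ (counted with multiplicity) are real and the $n-1$ critical values together with the $l$ boundary values are all pairwise distinct. For $n\ge1$, $K_n^l$ (two indices) is the number of connected components of the set of very nice M-morsifications of $B_n^l$, as a subspace of $P_n\times\mathbb R^l$. It is known (Arnold) that $K_n^0=K_{n-1}$ and $K_n^1=K_{n+1}$ for $n\ge1$, and one has $K_{n-2}^{l+1}=K_n^l-nlK_n^{l-1}$ for $n\ge3$, $l\ge1$. For $n\le0$ and $l\ge\max(1,-n)$ the numbers $K_n^l$ are defined by extending these rules: $K_0^1=K_1=1$, $K_{-1}^1=K_0=1$, and for $l\ge2$ $$K_n^l=K_{n+2}^{l-1}-(n+2)(l-1)K_{n+2}^{l-2},$$ where for $n=-2$ the second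 term is omitted (its coefficient is $0$). *)

(* Defs.v *)
From HB Require Import structures.
From mathcomp Require Export all_boot all_order all_algebra.
From mathcomp Require Export finmap.
From mathcomp Require Export all_classical all_reals all_analysis.

Set Implicit Arguments.
Unset Strict Implicit.
Unset Printing Implicit Defensive.

Import Order.TTheory GRing.Theory Num.Theory.
Import numFieldNormedType.Exports.

Local Open Scope classical_set_scope.
Local Open Scope ring_scope.

(* sec t + tan t = sum_m K_m t^m / m! near t = 0, which determines K_m for
   m >= 0. The values of K at negative indices are left arbitrary: an identity
   proved for every such K can involve K_m with m < 0 only with coefficient 0,
   which is the convention "c * K_m = 0 if c = 0, even for m < 0". *)
Definition bernoulli_euler (R : realType) (K : int -> R) : Prop :=
  \forall t \near (0 : R),
    [series K m%:Z * t ^+ m / m`!%:R]_m @ \oo --> (cos t)^-1 + tan t.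

(* x^n + lambda_2 x^(n-2) + ... + lambda_(n-1) x, where entry i of v is
   lambda_(i+2); the truncated n - 2 makes P_1 = {x} and P_2 = {x^2}. *)
Definition Ppoly (R : realType) (n : nat) (v : 'rV[R]_(n - 2)) : {poly R} :=
  'X^n + \sum_(i < n - 2) v 0 i *: 'X^(n - 2 - i).

(* The pairs (f; b_1, ..., b_l); c lists the n - 1 critical points of f with
   multiplicity, i.e. f' = n (x - c_1) ... (x - c_(n-1)). *)
Definition very_nice_M (R : realType) (n l : nat) :
    set ('rV[R]_(n - 2) * 'rV[R]_l) :=
  [set fb : 'rV[R]_(n - 2) * 'rV[R]_l | exists c : n.-1.-tuple R,
     (Ppoly fb.1)^`() = n%:R *: \prod_(x <- c) ('X - x%:P) /\
     uniq ([seq (Ppoly fb.1).[x] | x <- c] ++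
           [seq (Ppoly fb.1).[fb.2 0 j] | j <- enum 'I_l])].

Arguments very_nice_M : clear implicits.

Definition components (T : topologicalType) (A : set T) : set (set T) :=
  [set connected_component A x | x in A].

(* fset_set sends infinite sets to the empty one, but the set of components
   here is finite: very_nice_M is semialgebraic. *)
Definition ncomponents (T : topologicalType) (A : set T) : nat :=
  #|` fset_set (components A)|%fset.

(* K_n^l. For n <= 0 it is only meant for l >= max(1, -n); on that domain
   the recursion stays in the domain, except that K_0^0 (a junk value) occurs
   with coefficient 0 when n = -2 and l = 2. *)
Fixpoint Knl (R : realType) (n : int) (l : nat) {struct l} : int :=
  if 0 < n then (ncomponents (very_nice_M R `|n|%N l))%:Z
  else match l with
       | 0 => 0
       | 1 => 1
       | (l2.+1 as l1).+1 =>
           Knl R (n + 2) l1 - (n + 2) * l1%:Z * Knl R (n + 2) l2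
       end.

Definition coef (R : realType) (p : nat -> nat -> {poly R})
    (k l : nat) (n : int) : R :=
  (-1) ^+ (k - 1) / (2 ^+ (k - 1) * (k - 1)`!%:R)
  * (l`!%:R / (l + 2 - 2 * k)`!%:R)
  * \sum_(0 <= d < k) (p k d).[l%:R] * n%:~R ^+ d.

(* Main.v *)
(**
Write (d/dt)^N (sec t + tan t) = sum_l U_N(l) sec(t)^(N+1-l) tan(t)^l, so that
K_N = U_N(0); the theorem follows from K_n^l = l! U_(n-1+l)(l), evaluated by
means of the recursion in l. For even n >= 2 this formula is a count of
components. Record of a morsification the order of its critical and boundary
values, read along the line, and the labels of the boundary points met on the
way. This type is locally constant and takes l! U_(n-1+l)(l) values, since U
counts permutations by peaks (insert the maximum) and since every alternating
sequence of critical values occurs: a polynomial with prescribed gaps between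
successive critical values is a stationary point of an energy on the space of
root gaps. Morsifications of a given type form a connected set. For l = 0 this
is forced, the hypothesis giving as many components as there are types; for
l > 0, the boundary points over a fixed polynomial are parametrised by their
values, which range over a convex set, and local constancy passes to the base.
Finally, at even n the geometric recursion turns into a relation between
K_(n+1), K_(n+3), ... with coefficients polynomial in n. Up to signs these are
the derivatives of tanh at 0, which satisfy no such relation, so the polynomial
coefficients satisfy the recursion identically, hence for all integers n.
*)

(* Even n has two advantages. The polynomial then tends to plus infinity on both sides, and the
   indices n+1, n+3, ... are odd, so that only derivatives of tan occur. Odd n is reached through
   the polynomial identity alone, and it is really used: the recursion at n = -1 passes through n =
   1. As the coefficients satisfy the recursion one by one, the arbitrary values of K at negative
   indices do no harm. The tangent numbers obey no recurrence because tanh is transcendental over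
   R(t): the operator t d/dt turns a recurrence into a polynomial relation between t and tanh t, and
   such a relation is refuted at Y = 1 and Y = -1, the zeros of 1 - Y^2 in Y' = 1 - Y^2. The energy
   is a sum of terms x + d^2 / x, one for each gap x between successive critical values, d being the
   wanted gap. Each term blows up at 0 and at infinity and is stationary only at x = d. Since the
   gaps x can be given any first variation by moving the critical points, a minimum of the energy
   has all x = d. *)
Require Import Defs.
From mathcomp Require Import zify ring lra polyrcf.
Set Implicit Arguments.
Unset Strict Implicit.
Unset Printing Implicit Defensive.
Import Order.TTheory GRing.Theory Num.Theory.
Import numFieldNormedType.Exports.
Local Open Scope classical_set_scope.
Local Open Scope ring_scope.

(** * Counting permutations by peaks *)

Section Directions.
Context {d : Order.disp_t} {T : orderType d}.
Variable x0 : T.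
Implicit Types (s : seq T) (k : nat).

(* [dir s k]: does [s] increase from position [k - 1] to [k], once it is extended
   by infinitely large values at both ends? *)
Definition dir s k : bool :=
  if k == 0%N then false else if k == size s then true
  else (nth x0 s k.-1 < nth x0 s k)%O.

Definition turn s k : bool := dir s k (+) dir s k.+1.
Definition peak s k : bool := dir s k && ~~ dir s k.+1.
Definition turns s k : nat := (\sum_(i < k) turn s i)%N.
Definition peaks s : nat := (\sum_(i < size s) peak s i)%N.

(** The direction starts as [false] and flips exactly at the turns. *)
Lemma odd_turns s k : odd (turns s k) = dir s k.
Proof.
elim: k => [|k IH]; first by rewrite /turns big_ord0.
by rewrite /turns big_ord_recr /= oddD IH oddb /turn addKb.
Qed.

(** Extrema alternate, and the infinite ends make the first and the last of them valleys. *)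
Lemma turns_peaks s : (0 < size s)%N -> turns s (size s) = (peaks s).*2.+1.
Proof.
move=> s_gt0.
have H k : (turns s k = (\sum_(i < k) peak s i).*2 + dir s k)%N.
  elim: k => [|k IH]; first by rewrite /turns !big_ord0.
  rewrite /turns !big_ord_recr /= -/(turns s k) IH /turn /peak.
  by case: (dir s k) (dir s k.+1) => [] [] /=; lia.
rewrite H /dir eqxx /peaks; case: eqP => [e|_]; last by rewrite addn1.
by rewrite e in s_gt0.
Qed.

End Directions.

Definition insert (i m : nat) (s : seq nat) := take i s ++ m :: drop i s.

Lemma size_insert i m s : size (insert i m s) = (size s).+1.
Proof. by rewrite size_cat /= addnS -size_cat cat_take_drop. Qed.

Lemma nth_insert i m s k : (i <= size s)%N ->
  nth 0%N (insert i m s) k =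
  if (k < i)%N then nth 0%N s k else if k == i then m else nth 0%N s k.-1.
Proof.
move=> le_i; rewrite nth_cat size_takel //.
case: ltnP => [lt_k|le_k]; first by rewrite nth_take.
case: eqP => [->|ne]; first by rewrite subnn.
have -> : (k - i = (k.-1 - i).+1)%N by lia.
by rewrite /= nth_drop; congr nth; lia.
Qed.

(** A new maximum is entered by an ascent and left by a descent, except where the conventions at the
    two ends decide; all other directions are copied from [s]. *)
Lemma dir_insert i m s k : (i <= size s)%N -> (0 < size s)%N -> all (ltn^~ m) s ->
  dir 0%N (insert i m s) k =
  if k == 0%N then false else
  if (k < i)%N then dir 0%N s k else
  if k == i then true else
  if k == i.+1 then i == size s else
  dir 0%N s k.-1.
Proof.
move=> le_i s0 /allP ms; rewrite /dir size_insert.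
have nm j : (j < size s)%N -> (nth 0%N s j < m)%N.
  by move=> ?; apply: ms; rewrite mem_nth.
rewrite !nth_insert // !ltEnat.
case: (ltngtP k i) => [ki|ki|->].
- case: eqP => // k0.
  have -> : (k == (size s).+1) = false by lia.
  have -> : (k == size s) = false by lia.
  by have -> : (k.-1 < i)%N by lia.
- have -> : (k == 0%N) = false by lia.
  case: (k =P i.+1) => [->|ki1].
    rewrite eqSS; case: eqP => // ne /=.
    rewrite ltnn eqxx; apply/negbTE; rewrite -leqNgt ltnW //; apply: nm; lia.
  have -> : (k.-1 == 0%N) = false by lia.
  have -> : (k.-1 < i)%N = false by lia.
  have -> : (k.-1 == i)%N = false by lia.
  have -> : (k == (size s).+1) = (k.-1 == size s) by lia.
  done.
- case: eqP => // i0.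
  have -> : (i == (size s).+1) = false by lia.
  have -> : (i.-1 < i)%N by lia.
  by apply: nm; lia.
Qed.

(** At either end the new maximum merges into the infinite slope and is no peak. Elsewhere it is
    one, and it destroys a neighbouring peak; there is at most one such neighbour because peaks are
    never adjacent. *)
Lemma peaks_insert i m s : (i <= size s)%N -> (0 < size s)%N -> all (ltn^~ m) s ->
  peaks 0%N (insert i m s) =
  (peaks 0%N s + ~~ [|| i == 0%N, i == size s, peak 0%N s i | peak 0%N s i.-1])%N.
Proof.
move=> le_i s0 ms; have D := dir_insert _ le_i s0 ms.
have DM : dir 0%N s (size s) = true by rewrite /dir eqxx; case: eqP s0 => // ->.
case: (posnP i) => [i0|i_gt0].
  rewrite /= addn0 /peaks size_insert big_ord_recl {1}/peak D /= add0n.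
  apply: eq_bigr => j _; rewrite /peak /= /bump /= !D i0 /=.
  have -> : (0 == size s)%N = false by apply/eqP; lia.
  by rewrite !add1n eqSS; case: (nat_of_ord j).
case: (ltngtP i (size s)) le_i => // [lt_i|eq_i] _; last first.
  rewrite /= addn0 /peaks size_insert big_ord_recr /= {2}/peak !D -eq_i !eqxx.
  have -> : (i == 0%N) = false by apply/eqP; lia.
  rewrite ltnn ltnNge leqnSn /= (_ : (i.+1 == i) = false); last by apply/eqP; lia.
  rewrite addn0; apply: eq_bigr => j _; rewrite /peak /= !D /=.
  have lt_j := ltn_ord j; case: (posnP j) => [->|j0].
    by rewrite {1}/dir.
  rewrite lt_j; case: (ltngtP j.+1 i) => [//| |e]; first by lia.
  by rewrite (_ : dir 0%N s j.+1 = true) // -DM -eq_i e.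
rewrite /=.
have i_neq : (i == size s) = false by apply/eqP; lia.
have H1 j : (j < i)%N ->
    (\sum_(k < j) peak 0%N (insert i m s) k = \sum_(k < j) peak 0%N s k)%N.
  move=> lt_j; apply: eq_bigr => k _; have lt_k := ltn_ord k.
  have ki : (k < i)%N by lia.
  have k1i : (k.+1 < i)%N by lia.
  by rewrite /peak !D /= ki k1i; case: eqP => // ->.
have eP : ~~ (peak 0%N s i && peak 0%N s i.-1).
  by rewrite /peak prednK //; case: (dir 0%N s i); rewrite ?andbF.
(* To the right of the insertion the two sums run in parallel, shifted by one. The base case
   compares the three places around the maximum. *)
have H2 j : (\sum_(k < (i + j).+2) peak 0%N (insert i m s) k =
    \sum_(k < (i + j).+1) peak 0%N s k + ~~ (peak 0%N s i || peak 0%N s i.-1))%N.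
  elim: j => [|j IH]; last first.
    rewrite addnS [LHS]big_ord_recr /= IH [in RHS]big_ord_recr /= -!addnA.
    congr (_ + _)%N; rewrite addnC; congr (nat_of_bool _ + _)%N; rewrite /peak !D /= i_neq.
    have [h1 h2] : (((i + j).+2 < i)%N = false) /\ (((i + j).+3 < i)%N = false) by lia.
    have [h3 h4] : (((i + j).+2 == i) = false) /\ (((i + j).+3 == i) = false) by lia.
    have [h5 h6] : (((i + j).+2 == i.+1) = false) /\ (((i + j).+3 == i.+1) = false) by lia.
    by rewrite h1 h2 h3 h4 h5 h6.
  rewrite addn0 -[i in LHS]prednK // !big_ord_recr /= prednK //.
  rewrite H1; last by lia.
  rewrite -[in RHS](prednK i_gt0) big_ord_recr /= prednK //.
  have -> : peak 0%N (insert i m s) i.-1 = false.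
    by rewrite /peak !D prednK // ltnn eqxx [i == 0%N]gtn_eqF // andbF.
  have -> : peak 0%N (insert i m s) i = true.
    by rewrite /peak !D ltnn !eqxx [i == 0%N]gtn_eqF //= i_neq ltnNge leqnSn gtn_eqF.
  have -> : peak 0%N (insert i m s) i.+1 = false.
    by rewrite /peak !D eqxx i_neq /= ltnNge leqnSn gtn_eqF.
  case: (peak 0%N s i) (peak 0%N s i.-1) eP => [] [] //= _; lia.
have := H2 (size s - i.+1)%N; rewrite /peaks size_insert.
by rewrite (_ : (i + (size s - i.+1)).+1 = size s)%N //; lia.
Qed.

(** The places that keep the number of peaks are the two ends and both sides of each peak. They are
    distinct, as peaks are neither adjacent nor at an end, so there are twice [(peaks 0 s).+1] of
    them; every other place adds one peak. *)
Lemma count_insert_peaks m s p : (0 < size s)%N -> all (ltn^~ m) s ->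
  count (fun i => peaks 0%N (insert i m s) == p) (iota 0 (size s).+1) =
  ((peaks 0%N s == p) * p.+1.*2
   + (peaks 0%N s == p.-1) * (0 < p) * ((size s).+1 - p.*2))%N.
Proof.
move=> s0 ms; set f := fun i => [|| i == 0%N, i == size s, peak 0%N s i | peak 0%N s i.-1].
have DM : dir 0%N s (size s) = true by rewrite /dir eqxx; case: eqP s0 => // ->.
have H : count f (iota 0 (size s).+1) = (peaks 0%N s).+1.*2.
  rewrite -sum1_count big_mkcond.
  rewrite (_ : iota 0 (size s).+1 = index_iota 0 (size s).+1); last by rewrite /index_iota subn0.
  rewrite big_nat_recl //= /peaks -(big_mkord xpredT (fun i => nat_of_bool (peak 0%N s i))).
  case sM: (size s) s0 => [//|M] _; rewrite big_nat_recr //=.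
  rewrite [f M.+1](_ : _ = true) ?addnA; last by rewrite /f /= sM eqxx.
  rewrite (eq_big_nat _ _ (F2 := fun i => (peak 0%N s i.+1 + peak 0%N s i)%N)); last first.
    move=> i /andP[_ lt_i]; rewrite /f /= sM eqSS (ltn_eqF lt_i) /= /peak.
    by case: (dir 0%N s i.+1) => /=; rewrite ?andbF ?andbT ?addn0 ?orbF //; case: ifP.
  rewrite big_split /= -addnn.
  have pM : peak 0%N s M = false by rewrite /peak -sM DM andbF.
  have eqr : (\sum_(0 <= i < M.+1) peak 0%N s i = \sum_(0 <= i < M) peak 0%N s i)%N.
    by rewrite big_nat_recr //= pM addn0.
  have eql : (\sum_(0 <= i < M.+1) peak 0%N s i = \sum_(0 <= i < M) peak 0%N s i.+1)%N.
    by rewrite big_nat_recl.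
  rewrite -{1}eql -eqr; lia.
have E i : i \in iota 0 (size s).+1 ->
  (peaks 0%N (insert i m s) == p) = if f i then peaks 0%N s == p else (peaks 0%N s).+1 == p.
  rewrite mem_iota => /andP[_ lt_i]; rewrite peaks_insert //.
  by rewrite -/(f i); case: (f i); rewrite ?addn0 ?addn1.
rewrite (eq_in_count E) => {E}.
have -> : count (fun i => if f i then peaks 0%N s == p else (peaks 0%N s).+1 == p) (iota 0 (size
  s).+1) =
  ((peaks 0%N s == p) * count f (iota 0 (size s).+1) +
   ((peaks 0%N s).+1 == p) * count (predC f) (iota 0 (size s).+1))%N.
  elim: (iota _ _) => [|i t IH]; first by rewrite !muln0.
  rewrite /= IH; move: (count f t) (count _ t) (peaks 0%N s == p) (_ == p) => a b [] [];
    by case: (f i); rewrite /= ?mul1n ?mul0n; lia.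
have := count_predC f (iota 0 (size s).+1); rewrite size_iota H.
move: (count (predC f) _) (peaks 0%N s) => c q.
case: p => [|p] e; last rewrite eqSS.
  by rewrite /= muln0 mul0n addn0 mul0n addn0; case: eqP => [->|_] //; rewrite mul0n.
by case: (q =P p.+1) => ?; case: (q =P p) => ?; rewrite /= ?mul1n ?mul0n; lia.
Qed.

(* Coefficient of sec^(N+1-l) tan^l in the N-th derivative of sec + tan. *)
Fixpoint U N l : nat :=
  match N with
  | 0 => l <= 1
  | N'.+1 => (N'.+2 - l) * (if l is l'.+1 then U N' l' else 0) + l.+1 * U N' l.+1
  end%N.

Lemma U_rec N l :
  U N.+1 l = ((N.+2 - l) * (if l is l'.+1 then U N l' else 0) + l.+1 * U N l.+1)%N.
Proof. by []. Qed.

(** It fails for [N = 0], where tan itself gives [U 0 1 = 1]; one step later the factor [N.+2 - l]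
    of the recursion has removed this term. *)
Lemma U_gt N l : (0 < N)%N -> (N < l)%N -> U N l = 0%N.
Proof.
elim: N l => // -[|N] IH [|l] // _ lt_l.
  by case: l lt_l => [|[|l]] // _; rewrite /= !muln0.
have e : (N.+3 - l.+1 = 0 \/ l = N.+1)%N by lia.
have -> : U N.+2 l.+1 = ((N.+3 - l.+1) * U N.+1 l + l.+2 * U N.+1 l.+2)%N by [].
rewrite (IH l.+2) //; last by lia.
rewrite (IH l) //; lia.
Qed.

(** A permutation is recovered from the place of its largest entry and the word left after deleting
    it. *)
Lemma perm_insertions M :
  perm_eq (permutations (iota 0 M.+1))
    [seq insert i M w | w <- permutations (iota 0 M), i <- iota 0 M.+1].
Proof.
have Pw w : w \in permutations (iota 0 M) -> perm_eq w (iota 0 M) /\ M \notin w.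
  rewrite mem_permutations => pw; split=> //.
  by rewrite (perm_mem pw) mem_iota ltnn.
apply: uniq_perm.
- exact: permutations_uniq.
- apply: allpairs_uniq_dep => [|w _|]; first exact: permutations_uniq.
    exact: iota_uniq.
  move=> [w1 i1] [w2 i2] /allpairsPdep[w1' [i1' [/Pw[pw1 M1]]]] i1P [-> ->].
  move=> /allpairsPdep[w2' [i2' [/Pw[pw2 M2]]]] i2P [-> ->] /= eq12.
  have Mi i w : i \in iota 0 M.+1 -> perm_eq w (iota 0 M) -> M \notin w ->
      index M (insert i M w) = i /\ seq.filter (predC1 M) (insert i M w) = w.
    rewrite mem_iota => /andP[_ lt_i] pw Mw.
    have sw : size w = M by rewrite (perm_size pw) size_iota.
    have Mt : M \notin take i w by apply: contra Mw; apply: mem_take.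
    rewrite /insert index_cat (negbTE Mt) /= eqxx addn0 size_takel; last by rewrite sw -ltnS.
    split=> //; rewrite filter_cat /= eqxx /= -filter_cat cat_take_drop.
    by apply/all_filterP/allP => x xw /=; apply: contraNneq Mw => <-.
  have [e1 f1] := Mi _ _ i1P pw1 M1; have [e2 f2] := Mi _ _ i2P pw2 M2.
  have -> : w1' = w2' by rewrite -f1 eq12.
  by have -> : i1' = i2' by rewrite -e1 eq12.
move=> w; rewrite mem_permutations; apply/idP/allpairsPdep.
  move=> pw; have Mw : M \in w by rewrite (perm_mem pw) mem_iota ltnSn.
  have uw : uniq w by rewrite (perm_uniq pw) iota_uniq.
  exists (rem M w), (index M w); split.
  - rewrite mem_permutations -(perm_cons M) -(permPl (perm_to_rem Mw)).
    by rewrite (permPl pw) -[M.+1]addn1 iotaD perm_catC.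
  - by rewrite mem_iota /= add0n -[X in (_ < X)%N](size_iota 0 M.+1) -(perm_size pw) index_mem.
  - rewrite /insert remE take_cat size_take index_mem Mw ltnn subnn take0 cats0.
    rewrite drop_cat size_take index_mem Mw ltnn subnn drop0.
    by rewrite -{1}(cat_take_drop (index M w) w) (drop_nth M) ?index_mem // nth_index.
move=> [w' [i [/Pw[pw Mw] iP ->]]].
rewrite /insert -cat1s perm_catCA cat_take_drop cat1s.
by rewrite -[M.+1]addn1 iotaD perm_sym perm_catC /= perm_cons perm_sym.
Qed.

(** Inserting the maximum yields the recursion of [U] under the substitution [l = M - 2p - 1]. *)
Lemma count_permutations_peaks M p : (0 < M)%N ->
  count (fun w => peaks 0%N w == p) (permutations (iota 0 M)) =
  if (p.*2 < M)%N then U M (M - p.*2.+1) else 0%N.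
Proof.
elim: M p => // -[|M] IH p _.
  have -> : permutations (iota 0 1) = [:: [:: 0%N]] by [].
  by rewrite /= /peaks big_ord_recl big_ord0; case: p.
rewrite (permP (perm_insertions _)) count_flatten -map_comp.
have E : {in permutations (iota 0 M.+1), 
  (count (fun w => peaks 0%N w == p) \o (fun w => [seq insert i M.+1 w | i <- iota 0 M.+2])) =1
  fun w => ((peaks 0%N w == p) * p.+1.*2
   + (peaks 0%N w == p.-1) * ((0 < p) * (M.+2 - p.*2)))%N}.
  move=> w; rewrite mem_permutations => pw; rewrite /comp.
  have sw : size w = M.+1 by rewrite (perm_size pw) size_iota.
  rewrite count_map (_ : iota 0 M.+2 = iota 0 (size w).+1); last by rewrite sw.
  rewrite count_insert_peaks ?sw ?mulnA //.
  by apply/allP => x; rewrite (perm_mem pw) mem_iota.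
move/eq_in_map: E => ->.
have -> (s : seq (seq nat)) a b :
  sumn [seq ((peaks 0%N w == p) * a + (peaks 0%N w == p.-1) * b)%N | w <- s] =
   (count (fun w => peaks 0%N w == p) s * a + count (fun w => peaks 0%N w == p.-1) s * b)%N.
  by elim: s => //= w s ->; case: eqP; case: eqP; lia.
rewrite !IH //.
rewrite [U M.+2 _]U_rec; case: ifP => lt1; case: ifP => lt2; case: ifP => lt3; try lia.
- have -> : (M.+2 - p.*2.+1)%N = (M.+1 - p.*2.+1).+1 by lia.
  rewrite mulnC; congr (_ * _ + _)%N; first by lia.
  case: p lt1 lt2 lt3 => [|p] lt1 lt2 lt3.
    by rewrite mul0n muln0 U_gt ?muln0 //; lia.
  by rewrite mul1n mulnC; congr (_ * U _ _)%N; lia.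
- have -> : (M.+2 - p.*2.+1)%N = 0%N by lia.
  rewrite !mul0n muln0 mul1n !add0n; case: p lt1 lt2 lt3 => [|p] lt1 lt2 lt3; first by lia.
  rewrite mulnC; have -> : (M.+2 - p.+1.*2)%N = 1%N by lia.
  by rewrite !mul1n; congr (U _ _); lia.
Qed.

(** * The derivatives of tan at 0 satisfy no polynomial recurrence *)

Section CoefficientwiseDerivative.
Context {R : idomainType}.
Implicit Types (P Q : {poly {poly R}}) (a : {poly R}).

(** In R[t][Y] this is the partial derivative in the inner variable t. *)
Definition cderiv Q : {poly {poly R}} := map_poly deriv Q.

Lemma coef_cderiv Q i : (cderiv Q)`_i = (Q`_i)^`().
Proof. by rewrite coef_map. Qed.

Lemma cderivD P Q : cderiv (P + Q) = cderiv P + cderiv Q.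
Proof. exact: raddfD. Qed.

Lemma cderivM P Q : cderiv (P * Q) = cderiv P * Q + P * cderiv Q.
Proof.
apply/polyP => i; rewrite coefD coef_cderiv !coefM raddf_sum -big_split /=.
by apply: eq_bigr => j _; rewrite !coef_cderiv derivM.
Qed.

Lemma cderivX : cderiv 'X = 0.
Proof.
by apply/polyP => i; rewrite coef_cderiv coefX coef0; case: (i == 1)%N;
  rewrite ?deriv0 -?[1]/(1%:P) ?derivC.
Qed.

Lemma cderivC a : cderiv a%:P = (a^`())%:P.
Proof. by apply/polyP => i; rewrite coef_cderiv !coefC; case: eqP; rewrite ?deriv0. Qed.

Lemma deriv_horner Q a : (Q.[a])^`() = (cderiv Q).[a] + Q^`().[a] * a^`().
Proof.
elim/poly_ind: Q => [|Q c IH].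
  by rewrite /cderiv raddf0 deriv0 !horner0 deriv0 mul0r addr0.
rewrite cderivD cderivM cderivX mulr0 addr0 cderivC derivD derivM derivC derivX addr0 mulr1.
rewrite !hornerE derivD derivM IH; ring.
Qed.

End CoefficientwiseDerivative.

Section TanhRing.
Context {R : realFieldType}.
Implicit Types (P Q g a : {poly {poly R}}).

(* the derivation of R[t][Y] with t' = 1 and Y' = 1 - Y^2, as for Y = tanh t *)
Definition Dth Q : {poly {poly R}} := cderiv Q + (1 - 'X^2) * Q^`().
Definition ev0 Q : R := Q.[0].[0].

Lemma DthD P Q : Dth (P + Q) = Dth P + Dth Q.
Proof. by rewrite /Dth cderivD derivD; ring. Qed.

Lemma DthM P Q : Dth (P * Q) = Dth P * Q + P * Dth Q.
Proof. by rewrite /Dth cderivM derivM; ring. Qed.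

Lemma Dth0 : Dth 0 = 0.
Proof. by rewrite /Dth /cderiv raddf0 deriv0; ring. Qed.

Lemma DthC (c : {poly R}) : Dth c%:P = (c^`())%:P.
Proof. by rewrite /Dth cderivC derivC mulr0 addr0. Qed.

Lemma iter_DthD n P Q : iter n Dth (P + Q) = iter n Dth P + iter n Dth Q.
Proof. by elim: n P Q => // n IH P Q; rewrite !iterSr DthD IH. Qed.

Lemma iter_Dth0 n : iter n Dth 0 = 0.
Proof. by elim: n => // n IH; rewrite iterSr Dth0. Qed.

Lemma ev0D P Q : ev0 (P + Q) = ev0 P + ev0 Q.
Proof. by rewrite /ev0 !hornerD. Qed.

Lemma ev0M P Q : ev0 (P * Q) = ev0 P * ev0 Q.
Proof. by rewrite /ev0 !hornerM. Qed.

(** All Taylor coefficients of Q(t, tanh t) at 0 vanish. *)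
Definition flat Q := forall n, ev0 (iter n Dth Q) = 0.

Lemma flat_Dth Q : flat Q -> flat (Dth Q).
Proof. by move=> fQ n; rewrite -iterSr. Qed.

Lemma flatD P Q : flat P -> flat Q -> flat (P + Q).
Proof. by move=> fP fQ n; rewrite iter_DthD ev0D fP fQ addr0. Qed.

Lemma flatM P Q : flat Q -> flat (P * Q).
Proof.
move=> fQ n; elim: n P Q fQ => [|n IH] P Q fQ; first by rewrite /= ev0M (fQ 0%N) mulr0.
by rewrite iterSr DthM iter_DthD ev0D !IH ?addr0 //; exact: flat_Dth.
Qed.

Lemma ev0_iter_DthM n a g : (forall k, (k < n)%N -> ev0 (iter k Dth g) = 0) ->
  ev0 (iter n Dth (a * g)) = ev0 a * ev0 (iter n Dth g).
Proof.
elim: n a g => [|n IH] a g g0; first by rewrite ev0M.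
rewrite iterSr DthM iter_DthD ev0D IH; last by move=> k /ltnW; exact: g0.
rewrite g0 // mulr0 add0r IH ?iterSr // => k lt_k.
by rewrite -iterSr; apply: g0.
Qed.

(** A power series with nonzero constant term is no zero divisor: the first nonzero derivative of
    [g] at 0 would survive in [a * g]. *)
Lemma flat_cancel a g : ev0 a != 0 -> flat (a * g) -> flat g.
Proof.
move=> a0 fg n; elim/ltn_ind: n => n IH.
have := fg n; rewrite ev0_iter_DthM // => /eqP.
by rewrite mulf_eq0 (negbTE a0) => /eqP.
Qed.

Lemma flat_const (c : {poly R}) : flat c%:P -> c = 0.
Proof.
move=> fc; apply/polyP => i; rewrite coef0.
have iterC n : iter n Dth c%:P = (c^`(n))%:P.
  by elim: n => [|n IH]; rewrite ?derivn0 // iterS IH DthC -derivnS.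
have := fc i; rewrite iterC /ev0 hornerC horner_coef0 coef_derivn addn0 => /eqP.
by rewrite mulrn_eq0 ffactnn -leqn0 leqNgt fact_gt0 /= => /eqP.
Qed.

(** For Y-degree at most N, the term N Y Q cancels the top term that [- Y^2] creates in [Dth], so
    the bound on the degree is kept. The factor Y - 1 makes the value at Y = 1 a plain derivative in
    t. *)
Definition twist N Q : {poly {poly R}} := Dth Q + N%:R * ('X - 1) * Q.

Lemma flat_twist N Q : flat Q -> flat (twist N Q).
Proof. by move=> fQ; apply: flatD; [apply: flat_Dth|apply: flatM]. Qed.

Lemma size_twist N Q : (size Q <= N.+1)%N -> (size (twist N Q) <= N.+1)%N.
Proof.
move=> sQ; apply/leq_sizeP => j lt_j.
have Q0 k : (N < k)%N -> Q`_k = 0 by move=> ?; apply: nth_default; apply: leq_trans sQ _.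
have -> : twist N Q = cderiv Q + Q^`() - 'X^2 * Q^`() + ('X * Q) *+ N - Q *+ N.
  by rewrite /twist /Dth -mulr_natr -[Q *+ N]mulr_natr; ring.
rewrite coefB !coefD coefN !coefMn coef_cderiv coef_deriv coefXnM coefXM coef_deriv.
rewrite (Q0 j) // (Q0 j.+1); last exact: ltnW.
rewrite raddf0 !mul0rn subr0 !add0r.
case: j lt_j => [|[|j]] //; first by rewrite ltnS leqn0 => /eqP->; rewrite /= mulr0n oppr0 addr0.
move=> lt_j /=; have -> : (j.+2 - 2)%N = j by rewrite -addn2 addnK.
case: (ltngtP N j.+1) => [h||<-];
  [by rewrite Q0 // !mul0rn oppr0 addr0|by rewrite ltnNge -ltnS lt_j|].
by rewrite addNr.
Qed.

Lemma horner_twist1 N Q : (twist N Q).[1] = (Q.[1])^`().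
Proof.
rewrite deriv_horner -[1 in RHS]/(1%:P) derivC mulr0 addr0 /twist /Dth !hornerE.
by rewrite expr1n !subrr mul0r mulr0 mul0r !addr0.
Qed.

Lemma horner_twistN1 N Q : (twist N Q).[-1] = (Q.[-1])^`() - (N.*2)%:R * Q.[-1].
Proof.
have d0 : (-1 : {poly R})^`() = 0 by rewrite derivN -[1]/(1%:P) derivC oppr0.
rewrite deriv_horner d0 mulr0 addr0 /twist /Dth -polyC_natr !hornerE.
rewrite -mul2n natrM; ring.
Qed.

(** Transcendence of tanh, by induction on the Y-degree and, inside, on the t-degree of Q(t, 1). A
    root Y = 1 or Y = -1 can be divided out, since Y - 1 and Y + 1 do not vanish at the origin. If
    Q(t, 1) is not zero, twisting lowers its degree, so the twist is 0; at Y = -1 this reads q' =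
    2Nq, which no nonzero polynomial q satisfies when N > 0. *)
Lemma flat_eq0 Q : flat Q -> Q = 0.
Proof.
have [N] := ubnP (size Q); elim: N Q => // N IHN Q.
rewrite ltnS; case: N IHN => [|N] IHN sQ fQ.
  by apply/eqP; rewrite -size_poly_leq0.
have divide c Q' : flat Q' -> (size Q' <= N.+1)%N -> ev0 ('X - c%:P) != 0 -> Q'.[c] = 0 -> Q' = 0.
  move=> fQ' sQ' c0 /eqP /factor_theorem [Q1 eQ1]; have [Q10|Q10] := eqVneq Q1 0.
    by rewrite eQ1 Q10 mul0r.
  rewrite eQ1 (IHN Q1) ?mul0r //.
    by move: sQ'; rewrite eQ1 size_Mmonic ?monicXsubC // size_XsubC addn2.
  by apply: (flat_cancel c0); rewrite mulrC -eQ1.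
have [s] := ubnP (size Q.[1]); elim: s Q sQ fQ => // s IHs Q sQ fQ lt_s.
have [Q1|Q1] := eqVneq Q.[1] 0.
  by apply: (divide 1) => //; rewrite /ev0 !hornerE; rewrite oppr_eq0 oner_eq0.
have tw0 : twist N Q = 0.
  apply: IHs; rewrite ?size_twist //; first exact: flat_twist.
  by rewrite horner_twist1; apply: leq_trans (lt_size_deriv Q1) _.
have : (twist N Q).[-1] = 0 by rewrite tw0 horner0.
rewrite horner_twistN1; case: N IHN sQ {IHs} tw0 divide => [|N] IHN sQ _ divide.
  move=> _; have eQ := size1_polyC sQ.
  by move: fQ; rewrite eQ => /flat_const ->.
have [QN1 _|QN1 /eqP] := eqVneq Q.[-1] 0.
  by apply: (divide (-1)) => //; rewrite /ev0 !hornerE opprK oner_eq0.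
rewrite subr_eq0 => /eqP e.
by have := lt_size_deriv QN1; rewrite e -polyC_natr mul_polyC size_scale ?ltnn.
Qed.

(** The Euler operator t d/dt, which multiplies the n-th derivative at 0 by n. *)
Definition theta g : {poly {poly R}} := 'X%:P * Dth g.

Lemma ev0_theta n g : ev0 (iter n Dth (theta g)) = n%:R * ev0 (iter n Dth g).
Proof.
have H m h : ev0 (iter m Dth ('X%:P * h)) = m%:R * ev0 (iter m.-1 Dth h).
  elim: m h => [|m IH] h; first by rewrite /= ev0M /ev0 hornerC hornerX !mul0r.
  rewrite iterSr DthM DthC derivX mul1r iter_DthD ev0D IH /=.
  by case: m {IH} => [|m]; rewrite ?mul0r ?addr0 ?mul1r // -iterSr -[in RHS]natr1; ring.
by rewrite H; case: n => [|n]; rewrite ?mul0r // -iterSr.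
Qed.

Lemma ev0_iter_theta n d g :
  ev0 (iter n Dth (iter d theta g)) = n%:R ^+ d * ev0 (iter n Dth g).
Proof.
elim: d => [|d IH]; first by rewrite expr0 mul1r.
by rewrite iterS ev0_theta IH exprS mulrA.
Qed.

Lemma coef_Dth g k : (Dth g)`_k =
  (g`_k)^`() + g`_k.+1 *+ k.+1 - (if k is k'.+1 then g`_k' *+ k' else 0).
Proof.
rewrite /Dth mulrDl mul1r mulNr !coefD coefN coef_cderiv coef_deriv coefXnM coef_deriv addrA.
case: k => [|[|k]] //.
by rewrite -addn2 addnK addn2.
Qed.

Lemma coef_Dth_top m g k : (forall i, (m < i)%N -> g`_i = 0) -> (m < k)%N ->
  (Dth g)`_k = if k == m.+1 then - (g`_m *+ m) else 0.
Proof.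
move=> g0 lt_k; rewrite coef_Dth (g0 k) // (g0 k.+1); last exact: ltnW.
rewrite raddf0 mul0rn !add0r; case: k lt_k => // k lt_k.
by case: eqP => [[->]//|ne]; rewrite g0 ?mul0rn ?oppr0 //; lia.
Qed.

Lemma mulNrnE (p : {poly R}) m : p *- m = p * (- m%:R)%:P.
Proof. by rewrite polyCN polyC_natr mulrN mulr_natr. Qed.

(** Each [Dth] or [theta] raises the Y-degree by one, and each [theta] brings a factor t. This power
    of t later separates terms of equal Y-degree. *)
Lemma coef_theta_iter d i k : (d + i < k)%N ->
  (iter d theta (iter i Dth 'X))`_k =
  if k == (d + i).+1 then 'X^d * ((-1) ^+ (d + i) * (d + i)`!%:R)%:P else 0.
Proof.
elim: d k => [|d IH] k; last first.
  rewrite addSn iterS /theta coefCM => lt_k.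
  rewrite (@coef_Dth_top (d + i).+1) //; last first.
    move=> j lt_j; rewrite IH ?(gtn_eqF lt_j) //; exact: ltnW.
  case: eqP => _; last by rewrite mulr0.
  rewrite -/theta IH // eqxx mulNrnE factS natrM exprS [in RHS]exprS.
  by rewrite !polyCM !polyCN; ring.
rewrite add0n /= expr0 mul1r; elim: i k => [|i IH] k lt_k.
  by rewrite /= coefX expr0 mul1r fact0; case: eqP.
rewrite iterS (@coef_Dth_top i.+1) //; last first.
  move=> j lt_j; rewrite IH ?(gtn_eqF lt_j) //; exact: ltnW.
case: eqP => // _; rewrite IH // eqxx mulNrnE factS natrM exprS.
by rewrite !polyCM !polyCN; ring.
Qed.

(** By [ev0_iter_theta] the recurrence says that the polynomial [h] below is flat, hence zero; its
    coefficients then give those of the [q j]. *)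
Lemma tanh_not_P_recursive J (q : nat -> {poly R}) :
  (forall n, \sum_(j < J) (q j).[n%:R] * ev0 (iter (n + j) Dth 'X) = 0) ->
  forall j, (j < J)%N -> q j = 0.
Proof.
move=> rec; pose S := (\sum_(j < J) size (q j))%N.
have leS (j : 'I_J) : (size (q j) <= S)%N by rewrite /S (bigD1 j) //= leq_addr.
pose h := \sum_(j < J) \sum_(d < S) ((q j)`_d)%:P%:P * iter d theta (iter j Dth 'X).
have h0 : h = 0.
  apply: flat_eq0 => n; rewrite -[RHS](rec n) /h.
  have sumE (I : Type) (r : seq I) (F : I -> {poly {poly R}}) :
      ev0 (iter n Dth (\sum_(i <- r) F i)) = \sum_(i <- r) ev0 (iter n Dth (F i)).
    elim: r => [|x r IH]; first by rewrite !big_nil iter_Dth0 /ev0 !horner0.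
    by rewrite !big_cons iter_DthD ev0D IH.
  rewrite sumE; apply: eq_bigr => j _; rewrite sumE (horner_coef_wide _ (leS j)) mulr_suml.
  apply: eq_bigr => d _.
  have -> (c : R) g : iter n Dth (c%:P%:P * g) = c%:P%:P * iter n Dth g.
    elim: {sumE} n g => // m IH g; rewrite !iterSr -IH; congr iter.
    by rewrite DthM DthC derivC mul0r add0r.
  rewrite ev0M ev0_iter_theta {1}/ev0 !hornerC mulrA; congr (_ * ev0 _).
  by rewrite iterD.
(* Descending induction on [b]: pairs with larger [j + d] are already gone, and the coefficient of
   Y^(b+1) t^d in [h] isolates the pair [(j, d)] with [j + d = b]. *)
have vanish b : forall (j : 'I_J) d, (b <= j + d)%N -> (q j)`_d = 0.
  move=> j d; have [m] := ubnP (S + J - b)%N; elim: m b j d => // m IH b j d lt_m le_b.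
  have [ltSJ|geSJ] := ltnP b (S + J); last first.
    by apply: nth_default; apply: leq_trans (leS j) _; have := ltn_ord j; lia.
  have IHb (j' : 'I_J) d' : (b < j' + d')%N -> (q j')`_d' = 0 by apply: (IH b.+1); lia.
  have [|e] := ltnP b (j + d); first exact: IHb.
  have {le_b e} eb : (b = j + d)%N by lia.
  have := congr1 (fun P : {poly {poly R}} => P`_b.+1`_d) h0.
  rewrite !coef0 /h !coef_sum (bigD1 j) //= coef_sum.
  have [ltd|led] := ltnP d S; last by move=> _; apply: nth_default; exact: leq_trans (leS j) led.
  rewrite (bigD1 (Ordinal ltd)) //= !coefCM coef_theta_iter; last by rewrite eb addnC.
  rewrite [(d + j)%N]addnC -eb eqxx.
  rewrite coefD coefCM coefMC coefXn eqxx mul1r.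
  rewrite [\sum_(i < S | _) _]big1; last first.
    move=> d' ned; rewrite coefCM.
    have [lt_d|le_d] := ltnP d d'; first by rewrite IHb ?eb ?polyC0 ?mul0r // ltn_add2l.
    rewrite coef_theta_iter; last by lia.
    case: eqP => [|_]; last by rewrite mulr0.
    by move=> e; case/eqP: ned; apply: val_inj => /=; lia.
  rewrite coef0 addr0 big1 ?addr0; last first.
    move=> j' nej; rewrite !coef_sum big1 // => d' _; rewrite !coefCM.
    have [lt_d|le_d] := ltnP b (j' + d'); first by rewrite IHb ?mul0r.
    rewrite coef_theta_iter; last by lia.
    case: eqP => [e|_]; last by rewrite coef0 mulr0.
    rewrite coefMC coefXn; case: eqP => [dd|_]; last by rewrite mul0r mulr0.
    by case/eqP: nej; apply: val_inj => /=; lia.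
  move/eqP; rewrite !mulf_eq0 signr_eq0 pnatr_eq0 /= -[_ == 0%N]negbK -lt0n fact_gt0 orbF.
  by move/eqP.
by move=> j lt_j; apply/polyP => d; rewrite coef0 (vanish 0%N (Ordinal lt_j)).
Qed.

(** The n-th derivative of tan is this polynomial evaluated at tan. *)
Definition tanpoly n : {poly R} := iter n (fun Q : {poly R} => (1 + 'X^2) * Q^`()) 'X.

Definition tanh_sign m : R := if odd m then (-1) ^+ m./2 else 0.

(* [tanh t = - i tan (i t)]. *)
Lemma coef_iter_Dth n k :
  (iter n Dth 'X)`_k = (tanh_sign (n + k) * (tanpoly n)`_k)%:P.
Proof.
elim: n k => [|n IH] k.
  rewrite /= !coefX add0n; case: eqP => [->|_]; last by rewrite mulr0.
  by rewrite /tanh_sign expr0 mul1r.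
rewrite iterS coef_Dth !IH derivC add0r /tanpoly iterS -/(tanpoly n).
rewrite mulrDl mul1r coefD coefXnM !coef_deriv addSnnS mulrDr polyCD; congr (_ + _).
  by rewrite -polyCMn mulrnAr.
case: k => [|[|k]]; rewrite ?mulr0n ?mulr0 ?oppr0 //.
rewrite IH /= -[(k.+2 - 2)%N]/(k - 0)%N subn0 -polyCMn -polyCN !addnS /tanh_sign /= negbK.
case: odd => /=; first by rewrite !mul0r mul0rn oppr0.
by rewrite exprS; congr _%:P; rewrite mulrnAr mulN1r mulNr mulNrn.
Qed.

Lemma tan_not_P_recursive (K : nat -> R) J (q : nat -> {poly R}) :
  (forall n, odd n -> K n = (tanpoly n).[0]) ->
  (forall n, odd n -> \sum_(j < J) (q j).[n%:R] * K (n + j.*2)%N = 0) ->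
  forall j, (j < J)%N -> q j = 0.
Proof.
(* Zero coefficients at odd places turn a recurrence with step 2 into one with step 1; the sign
   changes derivatives of tan into those of tanh. *)
move=> KE rec; pose q' i := if odd i then 0 else (-1) ^+ i./2 *: q i./2.
have H := @tanh_not_P_recursive J.*2 q' _; move=> j lt_j.
suff : q' j.*2 = 0.
  by rewrite /q' odd_double doubleK => /eqP; rewrite scaler_eq0 signr_eq0 => /eqP.
apply: H; last by rewrite ltn_double.
move=> n.
have E m : ev0 (iter m Dth 'X) = tanh_sign m * (tanpoly m).[0].
  by rewrite /ev0 !horner_coef0 coef_iter_Dth coefC addn0.
case: (boolP (odd n)) => on; last first.
  rewrite big1 // => i _; rewrite E /q' /tanh_sign oddD (negbTE on) /=.
  by case: (odd i); rewrite ?horner0 mul0r ?mulr0.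
transitivity ((-1) ^+ n./2 * \sum_(j < J) (q j).[n%:R] * K (n + j.*2)%N);
  last by rewrite rec ?mulr0.
rewrite mulr_sumr; elim: J {lt_j rec} => [|m IH]; first by rewrite !big_ord0.
rewrite doubleS !big_ord_recr /= IH /q' /= odd_double /= horner0 mul0r addr0 doubleK.
congr (_ + _); rewrite hornerZ E /tanh_sign oddD odd_double on /=.
rewrite halfD on odd_double /= add0n doubleK exprD KE ?oddD ?on ?odd_double //.
have := signrMK m (1 : R); rewrite mulr1 => sm.
transitivity ((-1) ^+ m * (-1) ^+ m * ((-1) ^+ n./2 * ((q m).[n%:R] * (tanpoly (n + m.*2)).[0]))).
  by ring.
by rewrite sm mul1r.
Qed.

End TanhRing.

Lemma U_out N l : (N.+1 < l)%N -> U N l = 0%N.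
Proof. by case: N l => [|N] [|[|l]] // lt_l; rewrite U_gt // ltnW. Qed.

Lemma U_diag N : U N N = 1%N.
Proof.
elim: N => // N IH; rewrite U_rec IH subSn // subnn mul1n.
by case: N {IH} => [|N] //; rewrite U_gt ?muln0.
Qed.

Lemma U_gt0 N l : (l <= N)%N -> (0 < U N l)%N.
Proof.
elim: N l => [|N IH] [|l] // le_l; rewrite U_rec;
  last by rewrite addn_gt0 muln_gt0 subn_gt0 ltnS le_l IH.
by rewrite muln0 add0n mul1n; case: N IH {le_l} => // N ->.
Qed.

(** * From the count for even n to all integers *)

Section Assembly.
Variables (R : realType) (K : int -> R) (p : nat -> nat -> {poly R}).
Hypothesis hdeg : forall k d : nat, (d < k)%N -> size (p k d) = (k - d)%N.
Hypothesis hp : forall n l : nat, (n, l) <> (0%N, 0%N) ->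
    (Knl R n%:Z l)%:~R =
      \sum_(1 <= k < l./2 + 2)
        coef p k l n%:Z * K (n%:Z + 2 * (l%:Z - k%:Z) + 1).
Hypothesis KU : forall N : nat, K N%:Z = (U N 0)%:R.
Hypothesis Ktan : forall N : nat, odd N -> K N%:Z = (tanpoly N).[0].
Hypothesis KnlU : forall n l : nat, ~~ odd n -> (0 < n)%N ->
  Knl R n%:Z l = (l`! * U (n.-1 + l) l)%N%:Z.

(** The coefficient as a polynomial in n, extended by 0 so that sums with different upper bounds can
    be combined. *)
Let cpol k l : {poly R} :=
  if (0 < k < l./2 + 2)%N then
    ((-1) ^+ (k - 1) / (2 ^+ (k - 1) * (k - 1)`!%:R)
      * (l`!%:R / (l + 2 - 2 * k)`!%:R)) *: \sum_(0 <= d < k) (p k d).[l%:R] *: 'X^d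
  else 0.

Let cpolE k l n : (0 < k < l./2 + 2)%N -> (cpol k l).[n%:~R] = coef p k l n.
Proof.
rewrite /cpol => ->; rewrite hornerZ horner_sum; congr (_ * _).
by apply: eq_bigr => d _; rewrite hornerZ hornerXn.
Qed.

Let F (n : int) l := \sum_(1 <= k < l./2 + 2) (cpol k l).[n%:~R] * K (n + 2 * (l%:Z - k%:Z) + 1).

Let F_coef n l : F n l = \sum_(1 <= k < l./2 + 2) coef p k l n * K (n + 2 * (l%:Z - k%:Z) + 1).
Proof. by apply: eq_big_nat => k Hk; rewrite cpolE. Qed.

Let F_widen n l L : (l./2 + 2 <= L)%N ->
  F n l = \sum_(1 <= k < L) (cpol k l).[n%:~R] * K (n + 2 * (l%:Z - k%:Z) + 1).
Proof.
move=> leL; rewrite (big_cat_nat (n := l./2 + 2)) //=; last by lia.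
rewrite [X in _ + X]big_nat_cond [X in _ + X]big1 ?addr0 // => k /andP[/andP[le_k _] _].
by rewrite /cpol [(k < _)%N]ltnNge le_k andbF horner0 mul0r.
Qed.

(** The coefficient of [K (n + 2 * (l.+2 - k) + 1)] in the defect of the recursion for [F]. The last
    term carries [k.-1] because [F (n + 2) l] reaches the same index of [K] with [k] lowered by
    one. *)
Let G l k : {poly R} := cpol k l.+2 - (cpol k l.+1 \Po ('X + 2%:P))
   + l.+1%:R *: (('X + 2%:P) * (cpol k.-1 l \Po ('X + 2%:P))).

Let FG n l : \sum_(1 <= k < l.+3) (G l k).[n%:~R] * K (n + 2 * (l.+2%:Z - k%:Z) + 1)
  = F n l.+2 - F (n + 2) l.+1 + (n%:~R + 2) * l.+1%:R * F (n + 2) l.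
Proof.
have n2 : (n + 2)%:~R = n%:~R + 2 :> R by rewrite intrD.
rewrite (@F_widen n l.+2 l.+3); last by lia.
rewrite (@F_widen (n + 2) l.+1 l.+3); last by lia.
have -> : F (n + 2) l = \sum_(1 <= k < l.+3) (cpol k.-1 l).[(n + 2)%:~R] * K (n + 2 * (l.+2%:Z -
  k%:Z) + 1).
  rewrite (@F_widen (n + 2) l l.+2); last by lia.
  rewrite [RHS]big_add1 /= [RHS]big_ltn // {1}/cpol /= horner0 mul0r add0r.
  by apply: eq_big_nat => k _; congr (_ * K _); lia.
rewrite mulr_sumr -sumrB -big_split /=; apply: eq_big_nat => k _.
have -> : n + 2 + 2 * (l.+1%:Z - k%:Z) + 1 = n + 2 * (l.+2%:Z - k%:Z) + 1 by lia.
by rewrite n2 /G !(hornerD, hornerN, hornerZ, hornerM, horner_comp, hornerX, hornerC); ring.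
Qed.

(** At n = 0 this is the definition; for even n >= 2 it is the recursion of [U]. *)
Let Knl_rec n l : ~~ odd n -> Knl R n%:Z l.+2 =
   Knl R (n + 2)%N%:Z l.+1 - (n + 2)%N%:Z * l.+1%:Z * Knl R (n + 2)%N%:Z l.
Proof.
move=> en; case: (posnP n) => [->|n_gt0]; first by rewrite add0n.
have en2 : ~~ odd (n + 2) by rewrite oddD /= addbF.
have n2_gt0 : (0 < n + 2)%N by rewrite addn2.
rewrite (KnlU l.+2 en n_gt0) (KnlU l.+1 en2 n2_gt0) (KnlU l en2 n2_gt0).
have -> : ((n + 2).-1 + l.+1 = (n.-1 + l.+2).+1)%N by lia.
have -> : ((n + 2).-1 + l = n.-1 + l.+2)%N by lia.
rewrite U_rec; have -> : ((n.-1 + l.+2).+2 - l.+1 = n + 2)%N by lia.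
move: (U _ _) (U _ _) => a b; rewrite !factS; move: l`! => f; lia.
Qed.

(** At each even n the defect is 0, which is a recurrence with step 2 starting at the odd index N =
    n + 1. Hence the substitution of [X - 1], and the renumbering by [l.+2 - k]. *)
Let G0 l k : (0 < k < l.+3)%N -> G l k = 0.
Proof.
move=> Hk.
have H := @tan_not_P_recursive R (fun N => K N%:Z) l.+2
  (fun j => G l (l.+2 - j) \Po ('X - 1%:P)) Ktan.
suff : G l k \Po ('X - 1%:P) = 0.
  move/(congr1 (fun q => q \Po ('X + 1%:P))); rewrite comp_poly0 -comp_polyA.
  by rewrite comp_polyB comp_polyX comp_polyC addrK comp_polyXr.
have {1}-> : k = (l.+2 - (l.+2 - k))%N by lia.
apply: H; last by lia.
case=> // n /= en.
transitivity (\sum_(1 <= k < l.+3) (G l k).[n%:Z%:~R] * K (n%:Z + 2 * (l.+2%:Z - k%:Z) + 1)).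
  rewrite big_nat_rev /= big_add1 /= big_mkord; apply: eq_bigr => j _.
  have -> : (1 + l.+3 - j.+2)%N = (l.+2 - j)%N by lia.
  rewrite horner_comp !hornerE -natr1 addrK; congr (_ * K _).
  by have := ltn_ord j; lia.
rewrite FG -[n%:Z + 2]/((n + 2)%N%:Z) !F_coef -!hp ?Knl_rec //; try by case; lia.
rewrite intrB !intrM -[(n + 2)%N%:Z%:~R]/((n + 2)%:R) natrD.
rewrite -[n%:Z%:~R]/(n%:R) -[l.+1%:Z%:~R]/(l.+1%:R); ring.
Qed.

Let FR n l : F n l.+2 = F (n + 2) l.+1 - (n + 2)%:~R * l.+1%:R * F (n + 2) l.
Proof.
have := FG n l; rewrite big_nat_cond big1 => [|k /andP[Hk _]]; last by rewrite G0 // horner0 mul0r.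
by move/esym/eqP; rewrite addr_eq0 => /eqP e; rewrite intrD; apply/eqP;
  rewrite -subr_eq0 opprB addrA addrAC e; apply/eqP; ring.
Qed.

Let F_Knl_nat (n l : nat) : (n, l) <> (0%N, 0%N) -> (Knl R n%:Z l)%:~R = F n l.
Proof. by move=> nl0; rewrite F_coef -hp. Qed.

(** By its degree [p 1 0] is a constant, which K_0^1 = 1 = K_1 determines. *)
Lemma coef_p10 l n : coef p 1 l n = 1.
Proof.
have sp : size (p 1 0)%N = 1%N by rewrite hdeg.
have cE l' n' : coef p 1 l' n' = (p 1 0)%N`_0.
  rewrite /coef expr0 mul1r fact0 mul1r invr1 mul1r muln1 addnK divff ?pnatr_eq0 -?lt0n ?fact_gt0
    //.
  by rewrite mul1r big_nat1 expr0 mulr1 (size1_polyC (eq_leq sp)) hornerC coefC.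
have := @hp 0 1 ltac:(by case); rewrite /= big_nat1 !cE.
by rewrite (KU 1) /= mulr1.
Qed.

Let F_split n l : F n l = K (n + 2 * l%:Z - 1) +
  \sum_(2 <= k < l./2 + 2) coef p k l n * K (n + 2 * (l%:Z - k%:Z) + 1).
Proof.
rewrite F_coef big_ltn; last by lia.
by rewrite coef_p10 mul1r; congr (K _ + _); lia.
Qed.

(** The recursion now holds at odd n as well, so the value known for even n extends to all n; the
    value at n = 1 serves for n = -1. *)
Let F_U (n l : nat) : (n, l) <> (0%N, 0%N) -> F n l = (l`! * U (n + l).-1 l)%:R.
Proof.
move: n; elim/ltn_ind: l => -[|[|l]] IH n nl0.
- rewrite F_split big_geq // addr0 fact0 mul1n addn0 -KU.
  by case: n nl0 => // n _; congr K; lia.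
- rewrite F_split big_geq // addr0 mul1n addn1 /=.
  have -> : n%:Z + 2 * 1%:Z - 1 = n.+1%:Z by lia.
  by rewrite KU U_rec muln0 add0n mul1n.
rewrite FR -[n%:Z + 2]/((n + 2)%N%:Z) !IH //; try by case; lia.
have -> : ((n + 2) + l.+1).-1 = (n + l.+2).-1.+1 by lia.
have -> : ((n + 2) + l).-1 = (n + l.+2).-1 by lia.
rewrite U_rec; have -> : ((n + l.+2).-1.+2 - l.+1 = n + 2)%N by lia.
rewrite -[(n + 2)%N%:Z%:~R]/((n + 2)%:R) !factS !natrM natrD !natrM; ring.
Qed.

Let Knl0 l : (1 < l)%N -> Knl R 0 l = 0.
Proof.
move=> lt_l; apply: (@intr_inj R); rewrite (@F_Knl_nat 0 l); last by case; lia.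
rewrite F_U; last by case; lia.
by case: l lt_l => // l lt_l; rewrite add0n U_gt ?muln0.
Qed.

Let Knl1 l : Knl R 1 l = l`!%:Z.
Proof.
apply: (@intr_inj R); rewrite (@F_Knl_nat 1 l); last by case.
by rewrite F_U ?add1n ?U_diag ?muln1 //; case.
Qed.

Let KnlS n l : n <= 0 ->
  Knl R n l.+2 = Knl R (n + 2) l.+1 - (n + 2) * l.+1%:Z * Knl R (n + 2) l.
Proof. by move=> n_le0; rewrite /= ltNge n_le0. Qed.

(** Steps of 2 lead to n = 0, where [U l.-1 l] vanishes, or to n = -1, where the two terms are equal
    factorials. The case n = -2 is apart: its second term may contain [Knl R 0 1 = 1], and only the
    coefficient makes it vanish. *)
Lemma Knl_eq0 n l : n <= 0 -> Num.max 1 (- n) < l%:Z -> Knl R n l = 0.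
Proof.
rewrite gt_max => + /andP[+ +]; move: n; elim/ltn_ind: l => -[|[|l]] // IH n n_le0 _ lt_l.
have [->|n0] := eqVneq n 0; first by rewrite Knl0.
rewrite KnlS //; have [->|nN1] := eqVneq n (-1).
  by rewrite -[- 1 + 2]/1%:Z !Knl1 factS mul1r PoszM subrr.
have [->|nN2] := eqVneq n (-2).
  by rewrite -[- 2%:Z + 2]/0%:Z !mul0r subr0 Knl0 //; lia.
rewrite (IH l.+1) ?(IH l) ?mulr0 ?subr0 //; lia.
Qed.

(** For l >= 3 the first term of the recursion lies in the range where K_n^l is 0, and the second is
    (l-1)(l-2) times (l-3)!. *)
Lemma Knl_fact l : (1 <= l)%N -> Knl R (- l%:Z) l = (l - 1)`!%:Z.
Proof.
elim/ltn_ind: l => -[|[|[|l]]] // IH _.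
rewrite KnlS; last by lia.
have -> : - l.+3%:Z + 2 = - l.+1%:Z by lia.
rewrite (@Knl_eq0 _ l.+2) ?IH //; try by rewrite ?gt_max; lia.
by rewrite !subSS !subn0 !factS; move: l`! => f; lia.
Qed.

Lemma F_Knl n l : n <= 0 -> (0 < l)%N -> - n <= l%:Z -> (Knl R n l)%:~R = F n l.
Proof.
move: n; elim/ltn_ind: l => -[|l] // IH n n_le0 _ le_l.
have [->|n0] := eqVneq n 0; first by rewrite (@F_Knl_nat 0 l.+1).
case: l IH le_l => [|l] IH le_l.
  have -> : n = -1 by lia.
  by rewrite F_split big_geq // addr0 -[- 1 + _ - 1]/0%:Z KU.
rewrite KnlS // FR intrB !intrM.
have [->|nN1] := eqVneq n (-1).
  by rewrite -[- 1 + 2]/1%:Z !F_Knl_nat //; case.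
have [->|nN2] := eqVneq n (-2).
  by rewrite -[- 2%:Z + 2]/0%:Z !mul0r F_Knl_nat.
by rewrite !IH //; lia.
Qed.

Theorem corollary_of_even_counts :
  (forall (n : int) (l : nat), n <= 0 -> Num.max 1 (- n) < l%:Z ->
    0 = Knl R n l /\
    (Knl R n l)%:~R =
      K (n + 2 * l%:Z - 1)
      + \sum_(2 <= k < l./2 + 2)
          coef p k l n * K (n + 2 * (l%:Z - k%:Z) + 1))
  /\
  (forall l : nat, (1 <= l)%N ->
    ((l - 1)`!)%:Z = Knl R (- l%:Z) l /\
    (Knl R (- l%:Z) l)%:~R =
      K (l%:Z - 1)
      + \sum_(2 <= k < l./2 + 2)
          coef p k l (- l%:Z) * K (l%:Z - 2 * k%:Z + 1)).
Proof.
split=> [n l n_le0 lt_l|l l_gt0].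
  split; first by rewrite Knl_eq0.
  by rewrite -F_split F_Knl //; move: lt_l; rewrite gt_max; lia.
split; first by rewrite Knl_fact.
rewrite F_Knl // ?opprK ?oppr_le0 // F_split; congr (K _ + _); first by lia.
by apply: eq_bigr => k _; congr (_ * K _); lia.
Qed.

End Assembly.

(** * Derivatives of sec + tan *)

Section PowerSeries.
Context {R : realType}.
Implicit Types (f : R^nat) (g h : R -> R) (r t x y z : R).

(** Compares a term of the differentiated series at z with a term of the original series at y. *)
Lemma natr_exprn_le n z y : 0 <= z <= y -> n.+1%:R * z ^+ n * (y - z) <= y ^+ n.+1 - z ^+ n.+1.
Proof.
move=> /andP[z0 zy]; elim: n => [|n IH]; first by rewrite expr0 !mul1r !expr1.
have yn : 0 <= z ^+ n.+1 * (y - z) by rewrite mulr_ge0 ?exprn_ge0 ?subr_ge0.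
have y0 : 0 <= y by apply: le_trans zy.
have H : z * (n.+1%:R * z ^+ n * (y - z)) <= y * (y ^+ n.+1 - z ^+ n.+1).
  apply: ler_pM => //; rewrite !mulr_ge0 ?exprn_ge0 ?subr_ge0 //.
rewrite -[n.+2%:R]natr1 [y ^+ n.+2]exprS [z ^+ n.+2]exprS.
rewrite [z ^+ n.+1]exprS in H yn *.
lra.
Qed.

Lemma is_cvg_pseries_diffs f x z :
  cvgn (pseries f x) -> `|z| < `|x| -> cvgn (pseries (pseries_diffs f) z).
Proof.
move=> cf zx; pose y := (`|z| + `|x|) / 2.
have [zy yx] : `|z| < y /\ y < `|x| by rewrite /y; split; lra.
have y0 : 0 <= y by apply: le_trans (ltW zy).
have cy : cvgn (pseries (fun i => `|f i|) y).
  by apply: is_cvg_pseries_inside_norm cf _; rewrite (ger0_norm y0).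
apply: normed_cvg.
pose v n := `|f n.+1| * y ^+ n.+1 / (y - `|z|).
apply: (@series_le_cvg _ _ v) => [n|n|n|].
- by rewrite /=.
- by rewrite /v !mulr_ge0 ?exprn_ge0 // invr_ge0 subr_ge0 ltW.
- rewrite /v /pseries_diffs /= !normrM normrX normr_nat ler_pdivlMr ?subr_gt0 //.
  have := @natr_exprn_le n `|z| y; rewrite normr_ge0 (ltW zy) => /(_ isT).
  have : 0 <= `|z| ^+ n.+1 by rewrite exprn_ge0.
  move=> h1 h2; rewrite -!mulrA mulrCA; apply: ler_wpM2l => //.
  by rewrite mulrA; lra.
have -> : series v = (fun n => (y - `|z|)^-1 * (series (fun n => `|f n.+1| * y ^+ n.+1)) n).
  apply/funext => n; rewrite /series /= mulr_sumr; apply: eq_bigr => i _.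
  by rewrite /v mulrC.
suff cu : cvgn (series (fun n => `|f n.+1| * y ^+ n.+1)).
  by apply: cvgP; apply: cvgM; [exact: cvg_cst|exact: cu].
rewrite (_ : series _ = (fun n => (pseries (fun i => `|f i|) y) n.+1 - `|f 0%N|)).
  have c2 : (fun n => (pseries (fun i => `|f i|) y) n.+1) @ \oo --> limn (pseries (fun i =>
    `|f i|) y).
    by rewrite (cvg_shiftS (pseries (fun i => `|f i|) y)).
  have c3 : (fun=> `|f 0%N|) @ \oo --> `|f 0%N| by exact: cvg_cst.
  exact: cvgP (cvgB c2 c3).
apply/funext => n; rewrite /pseries /series /= big_nat_recl // expr0 mulr1 addrC addKr.
by [].
Qed.

Definition pseries_sum f g r := forall t, `|t| < r -> pseries f t @ \oo --> g t.

Lemma pseries_sum_diffs f g h r : pseries_sum f g r ->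
  (forall t, `|t| < r -> is_derive t (1 : R) g (h t)) ->
  pseries_sum (pseries_diffs f) h r.
Proof.
move=> fg gh t tr.
have r0 : 0 <= r by apply: le_trans (ltW tr).
have cf z : `|z| < r -> cvgn (pseries f z) by move=> /fg; apply: cvgP.
have mid z : `|z| < r -> `|z| < `|(`|z| + r) / 2| < r.
  move=> zr; have z0 := normr_ge0 z; rewrite (@ger0_norm _ ((`|z| + r) / 2)); last by lra.
  by apply/andP; split; lra.
have cdf z : `|z| < r -> cvgn (pseries (pseries_diffs f) z).
  by move=> /mid /andP[z1 z2]; apply: is_cvg_pseries_diffs (cf _ z2) z1.
have cddf z : `|z| < r -> cvgn (pseries (pseries_diffs (pseries_diffs f)) z).
  by move=> /mid /andP[z1 z2]; apply: is_cvg_pseries_diffs (cdf _ z2) z1.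
have /andP[t1 t2] := mid _ tr.
have D := pseries_snd_diffs (cf _ t2) (cdf _ t2) (cddf _ t2) t1.
suff -> : h t = limn (pseries (pseries_diffs f) t) by exact: cdf.
have gt := gh _ tr.
rewrite -(@derive_val _ _ _ _ _ _ _ gt) -(@derive_val _ _ _ _ _ _ _ D).
apply: near_eq_derive.
have : \forall z \near t, `|z| < r.
  have cn : `|z| @[z --> t] --> `|t| by exact: norm_continuous.
  exact: (cvgr_lt _ cn).
apply: filterS => z zr; apply/esym/cvg_lim => //; exact: fg.
Qed.

Lemma pseries_sum_coef f (g : nat -> R -> R) r : 0 < r ->
  pseries_sum f (g 0%N) r ->
  (forall n t, `|t| < r -> is_derive t (1 : R) (g n) (g n.+1 t)) ->
  forall n, f n * n`!%:R = g n 0.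
Proof.
move=> r0 fg gD n; elim: n f g fg gD => [|n IH] f g fg gD.
  have := fg 0; rewrite normr0 => /(_ r0).
  have -> : pseries f 0 = (fun n => if n is n'.+1 then f 0%N else 0).
    apply/funext => -[|n]; rewrite /pseries /series /= ?big_nil // big_nat_recl // expr0 mulr1.
    by rewrite big1 ?addr0 // => i _; rewrite exprS mul0r mulr0.
  move=> cg; rewrite mulr1; have : (fun=> f 0%N) @ \oo --> g 0%N 0 by rewrite -cvg_shiftS in cg.
  by move=> c2; apply: (cvg_unique _ (cvg_cst _) c2).
have := IH _ (fun k => g k.+1) (pseries_sum_diffs fg (gD 0%N)) (fun k => gD k.+1).
by move=> <-; rewrite /pseries_diffs factS natrM; ring.
Qed.

End PowerSeries.

Section SecTan.
Context {R : realType}.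
Implicit Types t : R.

Definition sec t := (cos t)^-1.

Lemma is_derive_sec t : cos t != 0 -> is_derive t (1 : R) sec (sec t * tan t).
Proof.
move=> ct; apply: (is_derive_eq (is_deriveV ct (is_derive_cos t))).
by rewrite /sec /tan scaleNr scalerN opprK -exprVn [LHS]/GRing.scale /=; ring.
Qed.

Lemma is_derive_tan' t : cos t != 0 -> is_derive t (1 : R) tan (sec t ^+ 2).
Proof. by move=> ct; apply: (is_derive_eq (is_derive_tan ct)); rewrite /sec exprVn. Qed.

Definition sectan N t := \sum_(l < N.+2) (U N l)%:R * (sec t ^+ (N.+1 - l) * tan t ^+ l).

Lemma is_derive_sectan N t : cos t != 0 ->
  is_derive t (1 : R) (sectan N) (sectan N.+1 t).
Proof.
move=> ct; have D1 := is_derive_sec ct; have D2 := is_derive_tan' ct.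
pose D (l : 'I_N.+2) := (U N l)%:R *
  (sec t ^+ (N.+1 - l) * (l%:R * tan t ^+ l.-1 * sec t ^+ 2) +
   tan t ^+ l * ((N.+1 - l)%:R * sec t ^+ (N.+1 - l).-1 * (sec t * tan t))).
have DT (l : 'I_N.+2) : is_derive t (1 : R)
   ((U N l)%:R \*o (sec ^+ (N.+1 - l) * tan ^+ l)) (D l).
  by apply: is_derive_eq; rewrite /D /GRing.scale /= !exprfctE.
have -> : sectan N = \sum_(l < N.+2) ((U N l)%:R \*o (sec ^+ (N.+1 - l) * tan ^+ l)).
  apply/funext => x; rewrite fct_sumE; apply: eq_bigr => l _.
  by rewrite /= !exprfctE.
apply: (is_derive_eq (is_derive_sum DT)).
pose s := sec t; pose T := tan t.
pose a l : R := (U N l)%:R * (N.+1 - l)%:R * s ^+ (N.+1 - l) * T ^+ l.+1.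
pose b l : R := (U N l)%:R * l%:R * s ^+ (N.+3 - l) * T ^+ l.-1.
have -> : \sum_i D i = \sum_(l < N.+2) (a l + b l).
  apply: eq_bigr => l _; have lt_l := ltn_ord l; rewrite /D /a /b -/s -/T.
  have -> : (N.+3 - l = (N.+1 - l) + 2)%N by lia.
  rewrite exprD exprS.
  case: (N.+1 - l)%N => [|m]; first by rewrite !mul0r; ring.
  by rewrite [m.+1.-1]/= [s ^+ m.+1]exprS [T ^+ l.+1]exprS; ring.
rewrite big_split /= /sectan -/s -/T.
have -> : \sum_(l < N.+2) b l = \sum_(l < N.+3) l.+1%:R * (U N l.+1)%:R * s ^+ (N.+2 - l) * T ^+ l.
  rewrite big_ord_recl {1}/b mulr0 !mul0r add0r.
  rewrite [RHS]big_ord_recr [X in _ = X + _]big_ord_recr /=.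
  rewrite (@U_out N N.+3) ?(@U_out N N.+2) //.
  rewrite !(mulr0, mul0r) !addr0; apply: eq_bigr => l _.
  by rewrite /b /= /bump /= add1n subSS; ring.
have -> : \sum_(l < N.+2) a l = \sum_(l < N.+3) (N.+2 - l)%:R * (if nat_of_ord l is l'.+1 then U N
  l' else 0)%:R * s ^+ (N.+2 - l) * T ^+ l.
  rewrite [RHS]big_ord_recl /= mulr0 !mul0r add0r; apply: eq_bigr => l _.
  by rewrite /a /= /bump /= add1n subSS; ring.
rewrite -big_split; apply: eq_bigr => l _.
by rewrite U_rec natrD !natrM /=; case: (nat_of_ord l) => [|l']; ring.
Qed.

Definition secpoly n : {poly R} := iter n (fun Q : {poly R} => 'X * Q + (1 + 'X^2) * Q^`()) 1.

Lemma coef_secpoly n k : odd (n + k) -> (secpoly n)`_k = 0.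
Proof.
elim: n k => [|n IH] k; first by rewrite add0n coefC; case: k.
rewrite /secpoly iterS -/(secpoly n) addSn => onk.
rewrite mulrDl mul1r !coefD coefXM coefXnM !coef_deriv.
rewrite (IH k.+1) ?addnS // mul0rn add0r.
case: k onk => [|[|k]] onk; rewrite /= ?addr0 //.
  by apply: IH; move: onk; rewrite addn1 addn0 /= negbK.
have onk' : odd (n + k.+1) by move: onk; rewrite !addnS /= negbK.
by rewrite (_ : (k.+2 - 2)%N = k) ?IH ?mul0rn ?addr0 // -addn2 addnK.
Qed.

(** A second form of the n-th derivative of sec + tan, with the two parts kept separate: at 0, for
    odd n, the parity of [secpoly] leaves only [tanpoly]. *)
Definition sectan' n t := sec t * (secpoly n).[tan t] + (tanpoly n).[tan t].

Lemma is_derive_sectan' n t : cos t != 0 ->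
  is_derive t (1 : R) (sectan' n) (sectan' n.+1 t).
Proof.
move=> ct; have D1 := is_derive_sec ct; have D2 := is_derive_tan' ct.
have H (P : {poly R}) : is_derive t (1 : R) (horner P \o tan) (P^`().[tan t] * sec t ^+ 2).
  exact: is_derive1_comp.
have -> : sectan' n = sec * (horner (secpoly n) \o tan) + (horner (tanpoly n) \o tan) by [].
have H1 := H (secpoly n); have H2 := H (tanpoly n).
apply: is_derive_eq; rewrite /sectan' /secpoly /tanpoly !iterS -/(secpoly n) -/(tanpoly n).
rewrite /GRing.scale /= !(hornerD, hornerM, hornerX, hornerXn) -polyC1 hornerC.
have -> : sec t ^+ 2 = 1 + tan t ^+ 2 by rewrite -cos2_tan2 // /sec exprVn.
by ring.
Qed.

Variable K : int -> R.
Hypothesis hK : bernoulli_euler K.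

Lemma bernoulli_euler_coef (g : nat -> R -> R) :
  (forall t, g 0%N t = sec t + tan t) ->
  (forall n t, cos t != 0 -> is_derive t (1 : R) (g n) (g n.+1 t)) ->
  forall n, K n%:Z = g n 0.
Proof.
move=> g0 gD n; move: hK => /nbhs_ballP[r /= r0 Hr].
(* Below pi / 2 the cosine does not vanish, so the formulas for the derivatives apply. *)
pose r' := Num.min r (pi / 2).
have r'0 : 0 < r' by rewrite lt_min r0 divr_gt0 ?pi_gt0.
have cosr t : `|t| < r' -> cos t != 0.
  rewrite lt_min => /andP[_ /ltr_normlP[t1 t2]]; apply: lt0r_neq0; apply: cos_gt0_pihalf.
  by apply/andP; split; lra.
have := @pseries_sum_coef _ (fun m => K m%:Z / m`!%:R) g r' r'0 _ (fun n t tr =>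
  gD n t (cosr t tr)) n.
rewrite mulfVK ?pnatr_eq0 -?lt0n ?fact_gt0 //; apply=> t.
rewrite lt_min => /andP[tr _]; rewrite g0.
have := Hr t; rewrite /ball /= sub0r normrN => /(_ tr).
suff -> : [series K m%:Z * t ^+ m / m`!%:R]_m =
    pseries (fun m => K m%:Z / m`!%:R) t by [].
by rewrite /pseries; congr series; apply/funext => m /=; rewrite mulrAC.
Qed.

Lemma bernoulli_euler_U N : K N%:Z = (U N 0)%:R.
Proof.
rewrite (@bernoulli_euler_coef sectan _ is_derive_sectan) => [|t].
  rewrite /sectan big_ord_recl /= subn0 tan0 /sec cos0 invr1 expr1n !mulr1.
  by rewrite big1 ?addr0 // => i _; rewrite exprS mul0r !mulr0.
by rewrite /sectan !big_ord_recl big_ord0 /= !expr0 !expr1 !mul1r mulr1 addr0.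
Qed.

Lemma bernoulli_euler_tanpoly N : odd N -> K N%:Z = (tanpoly N).[0].
Proof.
move=> oN; rewrite (@bernoulli_euler_coef sectan' _ is_derive_sectan') => [|t].
  rewrite /sectan' tan0 [(secpoly N).[0]]horner_coef0 coef_secpoly ?addn0 //.
  by rewrite mulr0 add0r.
by rewrite /sectan' /= hornerX hornerC mulr1.
Qed.

End SecTan.

(** * Polynomials with real critical points *)

Section CriticalPoints.
Context {R : realType}.
Implicit Types (f : {poly R}) (c : seq R) (x y : R).

(** This numbers the monotone branch of f on which x lies. *)
Definition cle c x := count (fun y => y <= x) c.
Definition clt c x := count (fun y => y < x) c.

Definition ltd (b : bool) x y := if b then x < y else y < x.

Lemma ltd_trans b : transitive (ltd b).
Proof. by case: b => y x z /=; [exact: lt_trans|move=> yx zy; exact: lt_trans zy yx]. Qed.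

Lemma ltd_asym b x y : ltd b x y -> ltd b y x -> False.
Proof. by case: b => /= h1 h2; have := lt_trans h1 h2; rewrite ltxx. Qed.

(** The number of critical points is odd, so f has even degree and tends to plus infinity on both
    sides, as the conventions of [dir] presuppose. *)
Definition critical f c : Prop := [/\ odd (size c), sorted <%R c &
  f^`() = (size c).+1%:R *: \prod_(x <- c) ('X - x%:P)].

Lemma cle_le c x y : x <= y -> (cle c x <= cle c y)%N.
Proof. by move=> xy; apply: sub_count => z zx; apply: le_trans xy. Qed.

Lemma clt_le c x y : x <= y -> (clt c x <= clt c y)%N.
Proof. by move=> xy; apply: sub_count => z /= zx; apply: lt_le_trans xy. Qed.

Lemma clt_le_cle c x : (clt c x <= cle c x)%N.
Proof. by apply: sub_count => z /= /ltW. Qed.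

Lemma cle_le_clt c x y : x < y -> (cle c x <= clt c y)%N.
Proof. by move=> xy; apply: sub_count => z /= zx; apply: le_lt_trans xy. Qed.

Lemma cle_count_clt c x y z : x < z < y -> (cle c x + count_mem z c <= clt c y)%N.
Proof.
move=> /andP[xz zy]; elim: c => //= w c.
rewrite /cle /clt /= => IH; rewrite addnACA leq_add //.
case: eqP => [->|_]; first by rewrite zy leNgt xz.
rewrite addn0; case: (leP w x) => // wx.
by rewrite (le_lt_trans wx) // (lt_trans xz zy).
Qed.

Lemma cleE c x : uniq c -> cle c x = (clt c x + (x \in c))%N.
Proof.
move=> uc; rewrite -(count_uniq_mem x uc) /cle /clt.
by elim: c {uc} => //= w c ->; rewrite addnACA; case: ltgtP.
Qed.

Lemma ltd_cle c x y : (cle c x < cle c y)%N -> x < y.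
Proof. by rewrite ltNge; apply: contraL => yx; rewrite -leqNgt cle_le. Qed.

Lemma sorted_nth_le c i j : sorted <%R c -> (i < size c)%N -> (j < size c)%N ->
  (c`_i <= c`_j) = (i <= j)%N.
Proof. by move=> sc lt_i lt_j; rewrite (lt_sorted_leq_nth 0 sc). Qed.

Lemma sorted_nth_lt c i j : sorted <%R c -> (i < size c)%N -> (j < size c)%N ->
  (c`_i < c`_j) = (i < j)%N.
Proof. by move=> sc lt_i lt_j; rewrite (lt_sorted_ltn_nth 0 sc). Qed.

Lemma cle_nth c j : sorted <%R c -> (j < size c)%N -> cle c c`_j = j.+1.
Proof.
move=> sc lt_j; rewrite /cle -[X in count _ X](cat_take_drop j.+1 c) count_cat.
rewrite (eq_in_count (a2 := predT)); last first.
  move=> y /(nthP 0)[i]; rewrite size_takel // => lt_i.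
  by rewrite nth_take // => <- /=; rewrite sorted_nth_le //; lia.
rewrite count_predT size_takel // (eq_in_count (a2 := pred0)) ?count_pred0 ?addn0 //.
move=> y /(nthP 0)[i]; rewrite size_drop nth_drop => lt_i <-.
by rewrite /= sorted_nth_le -?ltn_subRL //; lia.
Qed.

Lemma clt_nth c j : sorted <%R c -> (j < size c)%N -> clt c c`_j = j.
Proof.
move=> sc lt_j; have := cle_nth sc lt_j; rewrite cleE ?(lt_sorted_uniq sc) //.
by rewrite mem_nth // addn1 => -[].
Qed.

Lemma cle_between c j x : sorted <%R c -> (j <= size c)%N ->
  ((0 < j)%N -> c`_j.-1 <= x) -> ((j < size c)%N -> x < c`_j) -> cle c x = j.
Proof.
move=> sc le_j lo hi; apply/eqP; rewrite eqn_leq; apply/andP; split.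
  move: le_j; rewrite leq_eqVlt => /predU1P[->|lt_j]; first exact: count_size.
  by rewrite -[leqRHS](clt_nth sc lt_j); apply: cle_le_clt; apply: hi.
case: j le_j lo hi => // j lt_j lo _.
by rewrite -(cle_nth sc lt_j); apply: cle_le; apply: lo.
Qed.

Lemma sign_prod_XsubC c x : x \notin c ->
  0 < (-1) ^+ (size c - cle c x)%N * \prod_(y <- c) (x - y).
Proof.
elim: c => [|y c IH]; first by rewrite big_nil expr0 mul1r ltr01.
rewrite inE negb_or big_cons /cle /= => /andP[xy /IH {}IH].
have le_c : (cle c x <= size c)%N by exact: count_size.
case: (ltgtP y x) xy => // yx _ /=.
  by rewrite add1n subSS mulrCA mulr_gt0 // subr_gt0.
by rewrite add0n subSn // exprS mulrACA mulr_gt0 // mulN1r opprB subr_gt0.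
Qed.

Lemma deriv_critical f c x : critical f c ->
  f^`().[x] = (size c).+1%:R * \prod_(y <- c) (x - y).
Proof.
move=> [_ _ ->]; rewrite hornerZ horner_prod; congr (_ * _).
by apply: eq_bigr => y _; rewrite hornerXsubC.
Qed.

Lemma poly_MVT f x y : x < y ->
  exists2 z, x < z < y & f.[y] - f.[x] = f^`().[z] * (y - x).
Proof.
move=> xy; have [z zxy e] := @MVT R (horner f) (horner f^`()) x y xy
  (fun z _ => is_derive_poly f z) (continuous_subspaceT (@continuous_horner R f)).
by exists z => //; move: zxy; rewrite in_itv.
Qed.

(** Equal counts mean that no critical point lies strictly between x and y. As [size c] is odd, the
    sign of f' there is the parity of the branch number. *)
Lemma critical_monotone f c x y : critical f c -> x < y -> cle c x = clt c y ->
  ltd (odd (cle c x)) f.[x] f.[y].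
Proof.
move=> cr xy e; have [z zxy ef] := poly_MVT f xy.
have [oc sc _] := cr.
have zc : z \notin c.
  apply/negP => zc; have := cle_count_clt c zxy.
  by rewrite count_uniq_mem ?(lt_sorted_uniq sc) // zc e; lia.
have ez : cle c z = cle c x.
  apply/eqP; rewrite eqn_leq {1}e; case/andP: zxy => xz zy.
  by rewrite cle_le_clt // cle_le // ltW.
have := sign_prod_XsubC zc; rewrite ez => sg.
have n0 : 0 < (size c).+1%:R :> R by rewrite ltr0n.
have yx0 : 0 < y - x by rewrite subr_gt0.
have le_c : (cle c x <= size c)%N by exact: count_size.
rewrite (deriv_critical z cr) in ef.
move: sg; rewrite -signr_odd oddB // oc; case: odd => /=.
  by rewrite expr0 mul1r => sg; rewrite -subr_gt0 ef !mulr_gt0.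
rewrite expr1 mulN1r oppr_gt0 => sg.
by rewrite -subr_lt0 ef pmulr_llt0 // pmulr_rlt0.
Qed.

Lemma seq_bounded c : exists m, forall y, y \in c -> - m <= y <= m.
Proof.
elim: c => [|z c [m IH]]; first by exists 0.
exists (`|m| + `|z|) => y; have m0 := normr_ge0 m; have z0 := normr_ge0 z.
rewrite inE => /predU1P[->|/IH]; rewrite -!ler_norml.
  by rewrite lerDr.
by move=> h; rewrite (le_trans h) // (le_trans (ler_norm m)) // lerDl.
Qed.

Lemma critical_right f c B : critical f c ->
  exists x, all (fun y => y < x) c /\ B < f.[x].
Proof.
(* To the right of [m] every linear factor of f' is at least 1, so f grows with slope at least 1. *)
move=> cr; have [m' cm'] := seq_bounded c; pose m := m' + 1.
have cm y : y \in c -> y + 1 <= m.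
  by move=> /cm' /andP[_ ?]; rewrite /m lerD2r.
pose x := m + (`|B| + `|f.[m]| + 1).
have mx : m < x by rewrite /x ltrDl; have := normr_ge0 B; have := normr_ge0 f.[m]; lra.
have [z /andP[mz zx] ef] := poly_MVT f mx.
exists x; split; first by apply/allP => y /cm ?; lra.
have : 1 <= f^`().[z].
  rewrite (deriv_critical z cr) mulr_ege1 ?ler1n // big_seq.
  elim/big_ind: _ => // [a b|y /cm ?]; [exact: mulr_ege1|lra].
move=> f1; have : x - m <= f.[x] - f.[m] by rewrite ef ler_peMl // subr_ge0 ltW.
by have := ler_norm B; have := ler_norm (- f.[m]); rewrite normrN /x; lra.
Qed.

Lemma critical_left f c B : critical f c ->
  exists x, all (fun y => x < y) c /\ B < f.[x].
Proof.
move=> cr; have [oc _ _] := cr.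
have [m' cm'] := seq_bounded c; pose m := - m' - 1.
have cm y : y \in c -> m + 1 <= y.
  by move=> /cm' /andP[? _]; rewrite /m subrK.
pose x := m - (`|B| + `|f.[m]| + 1).
have xm : x < m by rewrite /x gtrDl oppr_lt0; have := normr_ge0 B; have := normr_ge0 f.[m]; lra.
have [z /andP[xz zm] ef] := poly_MVT f xm.
exists x; split; first by apply/allP => y /cm ?; lra.
have : f^`().[z] <= -1.
  rewrite (deriv_critical z cr).
  have -> : \prod_(y <- c) (z - y) = - \prod_(y <- c) (y - z).
    transitivity ((-1) ^+ size c * \prod_(y <- c) (y - z)).
      elim: (c) => [|y t IH]; first by rewrite !big_nil mul1r.
      by rewrite !big_cons IH exprS; ring.
    by rewrite -signr_odd oc expr1 mulN1r.
  rewrite mulrN lerN2 mulr_ege1 ?ler1n // big_seq.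
  elim/big_ind: _ => // [a b|y /cm ?]; [exact: mulr_ege1|lra].
move=> f1; have : f.[m] - f.[x] <= - (m - x).
  have mx0 : 0 <= m - x by rewrite subr_ge0 ltW.
  by have := ler_wpM2r mx0 f1; rewrite ef mulN1r.
by have := ler_norm B; have := ler_norm (- f.[m]); rewrite normrN /x; lra.
Qed.

(** The intermediate value theorem on branch j; on an outer branch the missing endpoint is replaced
    by a point so far out that f exceeds w. *)
Lemma critical_ivt f c j w : critical f c -> (j <= size c)%N ->
  ((0 < j)%N -> ltd (odd j) f.[c`_j.-1] w) ->
  ((j < size c)%N -> ltd (odd j) w f.[c`_j]) ->
  exists x, [/\ f.[x] = w & cle c x = j].
Proof.
move=> cr le_j lo hi; have [oc sc _] := cr.
have [a [fa alo aR aB]] : exists a, [/\ ltd (odd j) f.[a] w,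
    (0 < j)%N -> c`_j.-1 <= a, (j < size c)%N -> a < c`_j &
    forall b, all (fun y => y < b) c -> a < b].
  case: (posnP j) lo => [->|j0] lo.
    have [a [/allP ac wa]] := critical_left w cr.
    have a0 : a < c`_0 by apply: ac; rewrite mem_nth // odd_gt0.
    exists a; split => // b /allP bc; apply: lt_trans a0 _.
    by apply: bc; rewrite mem_nth // odd_gt0.
  exists c`_j.-1; split => //; first exact: lo.
    by move=> lt_j; rewrite sorted_nth_lt ?prednK // (leq_ltn_trans (leq_pred j)).
  by move=> b /allP; apply; rewrite mem_nth // prednK.
have [b [fb bhi bL]] : exists b, [/\ ltd (odd j) w f.[b],
    (j < size c)%N -> b <= c`_j & a < b].
  move: le_j; rewrite leq_eqVlt => /predU1P[e|lt_j].
    have [b [bc wb]] := critical_right w cr.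
    by exists b; split => //; [rewrite e oc|rewrite e ltnn|exact: aB].
  by exists c`_j; split => //; [exact: hi|exact: aR].
have : (f - w%:P).[a] * (f - w%:P).[b] < 0.
  rewrite !hornerE; move: fa fb; case: (odd j) => /= fa fb.
    by rewrite nmulr_rlt0 ?subr_gt0 // subr_lt0.
  by rewrite pmulr_rlt0 ?subr_gt0 // subr_lt0.
move=> /(poly_ivtoo (ltW bL))[x]; rewrite in_itv /= => /andP[ax xb].
rewrite /root !hornerE subr_eq0 => /eqP fx; exists x; split => //.
apply: cle_between => // [/alo|/bhi] h; first by rewrite (le_trans h) // ltW.
exact: lt_le_trans xb h.
Qed.

(** No critical point separates neighbours in P, and the last direction is the conventional one
    because [size c] is odd. *)
Lemma dir_critical f c P k : critical f c -> sorted <%R P -> {subset c <= P} ->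
  (k < size P)%N -> dir 0 (map (horner f) P) k.+1 = odd (cle c P`_k).
Proof.
move=> cr sP cP lt_k; have [oc _ _] := cr; rewrite /dir size_map /=.
have [e|lt_k1] := eqVneq k.+1 (size P).
  have -> : cle c P`_k = size c; last by rewrite oc.
  apply/eqP; rewrite -all_count; apply/allP => y /cP yP /=.
  by rewrite -(nth_index 0 yP) sorted_nth_le // ?index_mem // -ltnS e index_mem.
have {}lt_k1 : (k.+1 < size P)%N by rewrite ltn_neqAle lt_k1.
rewrite !(nth_map 0) //.
have e : cle c P`_k = clt c P`_k.+1.
  apply: eq_in_count => y /cP yP; rewrite -(nth_index 0 yP).
  by rewrite sorted_nth_le ?index_mem // sorted_nth_lt ?index_mem // ltnS.
have := critical_monotone cr _ e; rewrite sorted_nth_lt // ltnSn => /(_ isT).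
by case: odd => //= h; apply/negbTE; rewrite -leNgt ltW.
Qed.

Lemma turn_critical f c P k : critical f c -> sorted <%R P -> {subset c <= P} ->
  (k < size P)%N -> turn 0 (map (horner f) P) k = (P`_k \in c).
Proof.
move=> cr sP cP lt_k; have [oc sc _] := cr.
rewrite /turn (dir_critical cr) // cleE ?(lt_sorted_uniq sc) // oddD oddb.
case: k lt_k => [|k] lt_k.
  have -> : clt c P`_0 = 0%N.
    rewrite /clt (eq_in_count (a2 := pred0)) ?count_pred0 // => y /cP yP.
    by rewrite /= -(nth_index 0 yP) sorted_nth_lt // index_mem.
  by rewrite /dir.
rewrite (dir_critical cr) //; last exact: ltnW.
have -> : cle c P`_k = clt c P`_k.+1; last by rewrite addKb.
apply: eq_in_count => y /cP yP; rewrite -(nth_index 0 yP).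
by rewrite sorted_nth_le ?index_mem ?(ltnW lt_k) // sorted_nth_lt ?index_mem // ltnS.
Qed.

Lemma turnsS (W : seq R) k : turns 0%R W k.+1 = (turns 0%R W k + turn 0%R W k)%N.
Proof. by rewrite /turns big_ord_recr. Qed.

Lemma ltd_turns (W : seq R) k : uniq W -> (k.+1 < size W)%N ->
  ltd (odd (turns 0%R W k.+1)) W`_k W`_k.+1.
Proof.
move=> uW lt_k; rewrite odd_turns /dir (ltn_eqF lt_k) /=.
by case: (ltgtP W`_k W`_k.+1) => //= /eqP; rewrite nth_uniq // ?(ltnW lt_k) // ltn_eqF.
Qed.

(** A turn of W goes to the critical point of the same number. By [LB] and [RB] any other entry lies
    beyond the critical value before it and short of the one after it, so it is attained on the
    branch given by the number of turns so far. *)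
Lemma realize_values f c W : critical f c -> uniq W ->
  turns 0%R W (size W) = size c ->
  (forall k, (k < size W)%N -> turn 0%R W k -> W`_k = f.[c`_(turns 0%R W k)]) ->
  exists z : seq R, [/\ size z = size W, sorted <%R z, map (horner f) z = W,
    forall k, (k < size W)%N -> cle c z`_k = turns 0%R W k.+1 &
    forall k, (k < size W)%N -> turn 0%R W k -> z`_k = c`_(turns 0%R W k)].
Proof.
move=> cr uW tW Wc; have [oc sc _] := cr.
have t_le k : (k <= size W)%N -> (turns 0%R W k <= size c)%N.
  rewrite -tW; move: (size W) => m; elim: m => [|m IH]; first by rewrite leqn0 => /eqP->.
  rewrite leq_eqVlt => /predU1P[->//|]; rewrite ltnS => /IH h.
  by rewrite turnsS (leq_trans h) // leq_addr.
have t_lt k : (k < size W)%N -> turn 0%R W k -> (turns 0%R W k < size c)%N.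
  by move=> lt_k tk; have := t_le k.+1 lt_k; rewrite turnsS tk addn1.
have LB k : (k < size W)%N -> ~~ turn 0%R W k -> (0 < turns 0%R W k.+1)%N ->
    ltd (odd (turns 0%R W k.+1)) f.[c`_(turns 0%R W k.+1).-1] W`_k.
  elim: k => [|k IH] lt_k ntk; rewrite turnsS (negbTE ntk) addn0.
    by rewrite /turns big_ord0.
  move=> K0; have lk := ltd_turns uW lt_k.
  have [tk|ntk'] := boolP (turn 0%R W k); last first.
    exact: ltd_trans (IH (ltnW lt_k) ntk' K0) lk.
  by rewrite {2}turnsS tk addn1 /= -Wc // ltnW.
have RB k : (k < size W)%N -> (turns 0%R W k.+1 < size c)%N ->
    ltd (odd (turns 0%R W k.+1)) W`_k f.[c`_(turns 0%R W k.+1)].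
  move=> lt_k; have [m] := ubnP (size W - k)%N.
  elim: m k lt_k => // m IH k lt_k lt_m K_lt.
  have lt_k1 : (k.+1 < size W)%N.
    rewrite ltn_neqAle lt_k andbT; apply: contraTneq K_lt => ->.
    by rewrite tW ltnn.
  have lk := ltd_turns uW lt_k1.
  have [tk|ntk] := boolP (turn 0%R W k.+1); first by rewrite -Wc.
  apply: ltd_trans lk _.
  have e : turns 0%R W k.+2 = turns 0%R W k.+1 by rewrite turnsS (negbTE ntk) addn0.
  rewrite -e; apply: IH => //; last by rewrite e.
  by move: lt_m; rewrite ltnS; apply: leq_trans; rewrite subnS prednK // subn_gt0.
have ex k : exists x, (k < size W)%N -> [/\ f.[x] = W`_k, cle c x = turns 0%R W k.+1 &
    turn 0%R W k -> x = c`_(turns 0%R W k)].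
  have [lt_k|le_k] := ltnP k (size W); last by exists 0.
  have [tk|ntk] := boolP (turn 0%R W k).
    exists c`_(turns 0%R W k) => _; split=> //; first by rewrite Wc.
    by rewrite cle_nth ?t_lt // turnsS tk addn1.
  have [x [fx cx]] := critical_ivt cr (t_le k.+1 lt_k) (LB k lt_k ntk) (RB k lt_k).
  by exists x.
pose z := mkseq (fun k => xget 0 [set x | (k < size W)%N -> [/\ f.[x] = W`_k,
    cle c x = turns 0%R W k.+1 & turn 0%R W k -> x = c`_(turns 0%R W k)]]) (size W).
have zP k : (k < size W)%N -> [/\ f.[z`_k] = W`_k, cle c z`_k = turns 0%R W k.+1 &
    turn 0%R W k -> z`_k = c`_(turns 0%R W k)].
  move=> lt_k; rewrite /z nth_mkseq //.
  by case: xgetP => [x _ /= /(_ lt_k)//|H]; have [x /H] := ex k.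
have sz : size z = size W by rewrite size_mkseq.
exists z; split=> //; last 2 first.
- by move=> k /zP[].
- by move=> k /zP[].
- apply/(sortedP 0) => k; rewrite sz => lt_k.
  have [f1 c1 _] := zP k (ltnW lt_k); have [f2 c2 _] := zP k.+1 lt_k.
  (* Either the branch number increases at the next point, or both points lie on one branch and
     monotonicity of f orders them as their values require. *)
  have [tk|ntk] := boolP (turn 0%R W k.+1).
    by apply: (@ltd_cle c); rewrite c1 c2 [turns 0%R W k.+2]turnsS tk addn1.
  have lk := ltd_turns uW lt_k; rewrite -f1 -f2 in lk.
  have e : cle c z`_k.+1 = cle c z`_k by rewrite c1 c2 [turns 0%R W k.+2]turnsS (negbTE ntk) addn0.
  rewrite ltNge; apply/negP; rewrite le_eqVlt => /predU1P[ez|lt_z].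
    by move: lk; rewrite ez; case: odd => /=; rewrite ltxx.
  have e' : cle c z`_k.+1 = clt c z`_k.
    by apply/eqP; rewrite eqn_leq cle_le_clt // e clt_le_cle.
  have := critical_monotone cr lt_z e'; rewrite c2 turnsS (negbTE ntk) addn0.
  by move/(ltd_asym lk).
- apply: (@eq_from_nth _ 0); rewrite size_map ?sz // => k lt_k.
  by rewrite (nth_map 0) ?sz //; have [] := zP k lt_k.
Qed.

End CriticalPoints.

(** * Existence of polynomials with given critical values *)

Section Primitive.
Context {R : realType} (r : nat).
Implicit Types (c k : nat -> R) (x s : R).

Definition rootprod c : {poly R} := \prod_(j < r) ('X - (c j)%:P).

Definition primcoef i : R := r.+1%:R / i.+1%:R.

(* the primitive of (r + 1) (X - c_0) ... (X - c_(r-1)) vanishing at 0 *)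
Definition critprim c : {poly R} :=
  \sum_(i < r.+1) (primcoef i * (rootprod c)`_i) *: 'X^(i.+1).

Lemma size_rootprod c : size (rootprod c) = r.+1.
Proof. by rewrite /rootprod size_prod_XsubC /index_enum -enumT size_enum_ord. Qed.

Lemma rootprod_root c j : (j < r)%N -> (rootprod c).[c j] = 0.
Proof.
move=> lt_j; rewrite /rootprod (bigD1 (Ordinal lt_j)) //= hornerM hornerXsubC.
by rewrite subrr mul0r.
Qed.

Lemma deriv_critprim c : (critprim c)^`() = r.+1%:R *: rootprod c.
Proof.
apply/polyP => i; rewrite coefZ /critprim raddf_sum coef_sum /=.
have [lt_i|le_i] := ltnP i r.+1; last first.
  rewrite [in RHS]nth_default ?size_rootprod // mulr0 big1 // => j _.
  by rewrite derivZ derivXn coefZ coefMn coefXn gtn_eqF ?mul0rn ?mulr0 // (leq_trans (ltn_ord j)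
    le_i).
rewrite (bigD1 (Ordinal lt_i)) //= derivZ derivXn coefZ coefMn coefXn eqxx.
rewrite big1 ?addr0 => [|j ne]; last first.
  rewrite derivZ derivXn coefZ coefMn coefXn eq_sym.
  by rewrite (_ : (j == i :> nat) = false) ?mul0rn ?mulr0 //; apply: negbTE.
rewrite /primcoef mulrAC; congr (_ * _).
by rewrite -mulr_natr mul1r mulfVK // pnatr_eq0.
Qed.

Lemma horner_critprim c x : (critprim c).[x] =
  \sum_(i < r.+1) primcoef i * (rootprod c)`_i * x ^+ i.+1.
Proof. by rewrite horner_sum; apply: eq_bigr => i _; rewrite hornerZ hornerXn. Qed.

Lemma rootprod_mkseq c : rootprod c = \prod_(x <- mkseq c r) ('X - x%:P).
Proof. by rewrite big_map -[r in iota _ r]subn0 big_mkord. Qed.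

Lemma critical_critprim c : odd r -> (forall j, (j.+1 < r)%N -> c j < c j.+1) ->
  critical (critprim c) (mkseq c r).
Proof.
move=> or cI; split; rewrite ?size_mkseq //.
  by apply/(sortedP 0) => j; rewrite size_mkseq => lt_j; rewrite !nth_mkseq ?cI // ltnW.
by rewrite deriv_critprim rootprod_mkseq.
Qed.

(* the critical points [c + s k], as polynomials in s *)
Definition cpath c k j : {poly R} := (c j)%:P + k j *: 'X.
Definition ppath c k : {poly {poly R}} := \prod_(j < r) ('X - (cpath c k j)%:P).
Definition vpath c k j : {poly R} :=
  \sum_(i < r.+1) (primcoef i)%:P * ((ppath c k)`_i * cpath c k j ^+ i.+1).

Lemma horner_cpath c k j s : (cpath c k j).[s] = c j + k j * s.
Proof. by rewrite /cpath !hornerE. Qed.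

Lemma map_ppath c k s :
  map_poly (horner_eval s) (ppath c k) = rootprod (fun j => c j + k j * s).
Proof.
rewrite rmorph_prod; apply: eq_bigr => j _.
by rewrite rmorphB /= map_polyX map_polyC /= /horner_eval horner_cpath.
Qed.

Lemma coef_ppath c k s i : ((ppath c k)`_i).[s] = (rootprod (fun j => c j + k j * s))`_i.
Proof. by rewrite -map_ppath coef_map. Qed.

Lemma horner_vpath c k j s : (vpath c k j).[s] =
  (critprim (fun j => c j + k j * s)).[c j + k j * s].
Proof.
rewrite horner_critprim horner_sum; apply: eq_bigr => i _.
by rewrite !hornerM hornerC horner_exp horner_cpath coef_ppath mulrA.
Qed.

Lemma deriv_cpath c k j : (cpath c k j)^`() = (k j)%:P.
Proof. by rewrite /cpath derivD derivC derivZ derivX add0r alg_polyC. Qed.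

Lemma size_ppath c k : size (ppath c k) = r.+1.
Proof. by rewrite /ppath size_prod_XsubC /index_enum -enumT size_enum_ord. Qed.

Lemma ppath_root c k j : (j < r)%N -> (ppath c k).[cpath c k j] = 0.
Proof.
move=> lt_j; rewrite /ppath (bigD1 (Ordinal lt_j)) //= hornerM hornerXsubC.
by rewrite subrr mul0r.
Qed.

Let c0E c k : (fun j => c j + k j * 0) = c.
Proof. by apply/funext => j; rewrite mulr0 addr0. Qed.

(* first variation of the product when the roots move with speed k *)
Definition qpath c k : {poly R} := map_poly (horner_eval 0) (cderiv (ppath c k)).

(** Differentiate the vanishing of the product at its moving root. *)
Lemma qpath_root c k j : (j < r)%N ->
  (qpath c k).[c j] = - (rootprod c)^`().[c j] * k j.
Proof.
move=> lt_j.
have hm (Q : {poly {poly R}}) a : Q.[a].[0] = (map_poly (horner_eval 0) Q).[a.[0]].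
  by rewrite -[a.[0]]/(horner_eval 0 a) horner_map.
have := congr1 (fun q : {poly R} => q.[0]) (deriv_horner (ppath c k) (cpath c k j)).
rewrite ppath_root // deriv0 horner0 hornerD hornerM deriv_cpath !hm hornerC.
rewrite horner_cpath mulr0 addr0 -deriv_map map_ppath c0E -/(qpath c k).
by move/esym/eqP; rewrite addr_eq0 mulNr => /eqP.
Qed.

Lemma size_qpath c k : (size (qpath c k) <= r)%N.
Proof.
apply/leq_sizeP => j le_j; rewrite /qpath coef_map coef_cderiv /=.
move: le_j; rewrite leq_eqVlt => /predU1P[<-|lt_j]; last first.
  by rewrite nth_default ?size_ppath // deriv0 raddf0.
have : ppath c k \is monic by rewrite /ppath monic_prod_XsubC.
by rewrite monicE lead_coefE size_ppath => /eqP ->; rewrite -polyC1 derivC raddf0.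
Qed.

(** The displacement of the critical point contributes nothing, as f' vanishes there. What remains
    is the variation of the polynomial, which is the primitive [H - H.[0]]. *)
Lemma deriv_vpath0 c k j (H : {poly R}) : (j < r)%N -> (size H <= r.+1)%N ->
  r.+1%:R *: qpath c k = H^`() -> (vpath c k j)^`().[0] = H.[c j] - H.[0].
Proof.
move=> lt_j sH eH; rewrite /vpath raddf_sum horner_sum /=.
have nz i : i.+1%:R != 0 :> R by rewrite pnatr_eq0.
have E (i : 'I_r.+1) : (((primcoef i)%:P * ((ppath c k)`_i * cpath c k j ^+ i.+1))^`()).[0] =
    H`_i.+1 * c j ^+ i.+1 + r.+1%:R * k j * ((rootprod c)`_i * c j ^+ i).
  have := congr1 (fun q : {poly R} => q`_i) eH.
  rewrite coefZ coef_deriv /qpath coef_map coef_cderiv /= /horner_eval => eHi.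
  rewrite derivM derivC mul0r add0r. rewrite derivM deriv_exp deriv_cpath.
  rewrite !(horner_cpath, coef_ppath, hornerM, hornerD, hornerC, hornerMn, horner_exp) c0E.
  rewrite mulr0 addr0 mulrDr mulrA /= -[H`_i.+1](mulfK (nz i)) mulr_natr -eHi /primcoef.
  rewrite -(mulr_natr (k j * _)); move: (nz i).
  move: (c j ^+ i.+1) (c j ^+ i) ((rootprod c)`_i) (_.[0]) (i.+1%:R) (r.+1%:R) => u v w x a b a0.
  by field.
rewrite (eq_bigr _ (fun i _ => E i)) big_split /= -mulr_sumr.
have -> : \sum_(i < r.+1) (rootprod c)`_i * c j ^+ i = (rootprod c).[c j].
  by rewrite (horner_coef_wide _ (eq_leq (size_rootprod c))).
rewrite rootprod_root // mulr0 addr0 (horner_coef_wide (n := r.+2) _ (leqW sH)).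
rewrite [in RHS]big_ord_recl /= expr0 mulr1 horner_coef0 addrAC subrr add0r.
by apply: eq_bigr.
Qed.

Lemma deriv_rootprod_neq0 c j : (forall i, (i < r)%N -> i != j -> c i != c j) ->
  (j < r)%N -> (rootprod c)^`().[c j] != 0.
Proof.
move=> cI lt_j; rewrite /rootprod (bigD1 (Ordinal lt_j)) //= derivM derivXsubC mul1r.
rewrite hornerD hornerM hornerXsubC subrr mul0r addr0 horner_prod; apply/prodf_neq0 => i ne.
by rewrite hornerXsubC subr_eq0 eq_sym; apply: cI.
Qed.

Lemma interpolation c (v : nat -> R) : (forall i j, (i < r)%N -> (j < r)%N -> i != j ->
  c i != c j) ->
  exists2 G : {poly R}, (size G <= r)%N & forall j, (j < r)%N -> G.[c j] = v j.
Proof.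
move=> cI; pose L (j : 'I_r) := \prod_(i < r | i != j) ('X - (c i)%:P).
have L0 j : (L j).[c j] != 0.
  rewrite horner_prod; apply/prodf_neq0 => i ne; rewrite hornerXsubC subr_eq0 eq_sym.
  by apply: cI.
have Li (i j : 'I_r) : i != j -> (L i).[c j] = 0.
  move=> ne; rewrite /L (bigD1 j) ?(eq_sym j) //= hornerM hornerXsubC subrr mul0r.
  by [].
have sL j : (size (L j) <= r)%N.
  have : L j * ('X - (c j)%:P) = rootprod c.
    by rewrite /rootprod [RHS](bigD1 j) //= mulrC.
  move=> /(congr1 (fun q : {poly R} => size q)); rewrite size_rootprod size_Mmonic ?monicXsubC //.
    by rewrite size_XsubC addn2 /= => -[->].
  by apply: contraNneq (L0 j) => ->; rewrite horner0.
exists (\sum_(j < r) (v j / (L j).[c j]) *: L j).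
  apply: (leq_trans (size_sum _ _ _)); apply/bigmax_leqP => j _.
  exact: leq_trans (size_scale_leq _ _) (sL j).
move=> j lt_j; pose o := Ordinal lt_j.
rewrite horner_sum (bigD1 o) //= hornerZ mulfVK ?(L0 o) // big1 ?addr0 // => i ne.
by rewrite hornerZ (Li i o) ?mulr0.
Qed.

(** The differential of the map from critical points with fixed sum to differences of critical
    values is onto: choose H with the desired values at the [c j] and read the speeds off H'. *)
Lemma exists_speed c (e : nat -> R) :
  (forall i j, (i < r)%N -> (j < r)%N -> i != j -> c i != c j) ->
  exists2 k : nat -> R, \sum_(j < r) k j = 0 & forall j, (j.+1 < r)%N ->
    (vpath c k j.+1)^`().[0] - (vpath c k j)^`().[0] = e j.
Proof.
move=> cI; have [r0|r_gt0] := posnP r.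
  by exists (fun=> 0); [rewrite big1|rewrite r0].
have [G sG Gv] := interpolation (fun j => \sum_(i < j) e i) cI.
have B0 j : (j < r)%N -> (rootprod c)^`().[c j] != 0.
  by move=> lt_j; apply: deriv_rootprod_neq0 => // i lt_i ne; apply: cI.
(* A multiple of [rootprod] does not change H at the [c j]; this one makes the speeds sum to 0. *)
pose a : R := - (r%:R^-1 * \sum_(j < r) G^`().[c j] / (rootprod c)^`().[c j]).
pose H := G + a *: rootprod c.
pose k j := - (r.+1%:R^-1 * (H^`().[c j] / (rootprod c)^`().[c j])).
have sH : (size H <= r.+1)%N.
  rewrite (leq_trans (size_polyD _ _)) // geq_max (leq_trans sG) //=.
  by rewrite (leq_trans (size_scale_leq _ _)) // size_rootprod.
have Hv j : (j < r)%N -> H.[c j] = \sum_(i < j) e i.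
  by move=> lt_j; rewrite hornerD hornerZ rootprod_root // mulr0 addr0 Gv.
have r1 : r.+1%:R != 0 :> R by rewrite pnatr_eq0.
(* Both sides have degree below r and agree at the r points [c j]. *)
have Q : r.+1%:R *: qpath c k = H^`().
  apply/eqP; rewrite -subr_eq0; apply/eqP.
  apply: (@roots_geq_poly_eq0 _ _ (mkseq c r)).
  - apply/allP => x /mapP[j]; rewrite mem_iota /= add0n => lt_j ->.
    rewrite /root hornerD hornerN hornerZ qpath_root // /k.
    by rewrite subr_eq0; apply/eqP; field; rewrite B0 // addrC natr1 r1.
  - rewrite map_inj_in_uniq ?iota_uniq // => i j; rewrite !mem_iota /= !add0n => lt_i lt_j.
    by move=> eij; apply/eqP; apply: contraTT isT => ne; have := cI _ _ lt_i lt_j ne;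
      rewrite eij eqxx.
  - rewrite size_mkseq (leq_trans (size_polyD _ _)) // geq_max size_polyN.
    rewrite (leq_trans (size_scale_leq _ _)) ?size_qpath //=.
    by have [->|H0] := eqVneq H 0; [rewrite deriv0 size_poly0|rewrite -ltnS (leq_trans
      (lt_size_deriv H0))].
exists k.
  rewrite sumrN -mulr_sumr.
  have -> : \sum_(j < r) H^`().[c j] / (rootprod c)^`().[c j] =
     \sum_(j < r) G^`().[c j] / (rootprod c)^`().[c j] + a *+ r.
    rewrite -[r in a *+ r]card_ord -sumr_const -big_split /=; apply: eq_bigr => j _.
    by rewrite /H derivD derivZ hornerD hornerZ mulrDl mulfK ?B0.
  rewrite /a mulNrn -mulrnAl -[_^-1 *+ _]mulr_natr mulVf ?mul1r ?subrr ?mulr0 ?oppr0 //.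
  by rewrite pnatr_eq0 -lt0n.
move=> j lt_j; have lt_j' := ltnW lt_j.
rewrite !(deriv_vpath0 _ sH Q) // !Hv // big_ord_recr /=; ring.
Qed.

End Primitive.

(** * Gaps between critical points and gaps between critical values *)

Section Gaps.
Context {R : realType} (m : nat).
Local Notation r := m.+1.
Implicit Types (g h : 'rV[R]_m) (s x y z : R).

Definition gapsum g j : R := \sum_(i < m | (i < j)%N) g 0 i.

(* the points with sum 0 and successive gaps g *)
Definition gappt g j : R := gapsum g j - r%:R^-1 * \sum_(i < r) gapsum g i.

Lemma gapsumS g (j : 'I_m) : gapsum g j.+1 = gapsum g j + g 0 j.
Proof.
rewrite /gapsum (bigD1 j) //= addrC; congr (_ + _); apply: eq_bigl => i.
by rewrite ltnS [in RHS]ltn_neqAle andbC.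
Qed.

Lemma gapptS g (j : 'I_m) : gappt g j.+1 = gappt g j + g 0 j.
Proof. by rewrite /gappt gapsumS addrAC. Qed.

Lemma gappt_lin g h s j : gappt (g + s *: h) j = gappt g j + gappt h j * s.
Proof.
have E i : gapsum (g + s *: h) i = gapsum g i + gapsum h i * s.
  rewrite /gapsum mulr_suml -big_split /=; apply: eq_bigr => k _.
  by rewrite !mxE mulrC.
rewrite /gappt E; under eq_bigr do rewrite E.
rewrite big_split /= -mulr_suml; ring.
Qed.

Lemma gappt_row (k : nat -> R) j : \sum_(i < r) k i = 0 -> (j < r)%N ->
  gappt (\row_i (k i.+1 - k i)) j = k j.
Proof.
move=> k0 lt_j.
have E i : (i < r)%N -> gapsum (\row_i (k i.+1 - k i)) i = k i - k 0%N.
  elim: i => [|i IH] lt_i; first by rewrite /gapsum big_pred0 ?subrr.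
  by rewrite (gapsumS _ (Ordinal (lt_i : (i < m)%N))) IH 1?ltnW // mxE /=; ring.
rewrite /gappt E // (eq_bigr (fun i : 'I_r => k i - k 0%N)) => [|i _]; last exact: E.
rewrite sumrB k0 sumr_const card_ord sub0r mulrN opprK -[k 0%N *+ _]mulr_natl.
by rewrite mulKf ?subrK // pnatr_eq0.
Qed.

Lemma gappt_sum g : \sum_(i < r) gappt g i = 0.
Proof.
rewrite /gappt sumrB sumr_const card_ord -mulrnAl -[_^-1 *+ _]mulr_natr mulVf ?mul1r ?subrr //.
Qed.

(** For an odd number of critical points f rises from the first to the second, so the sign makes
    these differences positive. *)
Definition gapval g j : R :=
  (-1) ^+ j * ((critprim r (gappt g)).[gappt g j.+1] - (critprim r (gappt g)).[gappt g j]).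

Lemma gappt_le g i j : (forall k, 0 < g 0 k) -> (i <= j < r)%N -> gappt g i <= gappt g j.
Proof.
move=> g0 /andP[]; elim: j => [|j IH]; first by rewrite leqn0 => /eqP->.
rewrite leq_eqVlt => /predU1P[->//|le_i] lt_j.
by rewrite (gapptS g (Ordinal (lt_j : (j < m)%N))) ler_wpDr ?(ltW (g0 _)) // IH // ltnW.
Qed.

Section PositiveGaps.
Variables (g : 'rV[R]_m).
Hypotheses (or : odd r) (g0 : forall k, 0 < g 0 k).
Local Notation f := (critprim r (gappt g)).
Local Notation c := (mkseq (gappt g) r).

Lemma critical_gappt : critical f c.
Proof.
apply: critical_critprim => // j lt_j.
by rewrite (gapptS g (Ordinal (lt_j : (j < m)%N))) ltrDl.
Qed.

Lemma cle_gappt (j : 'I_m) x : gappt g j <= x < gappt g j.+1 -> cle c x = j.+1.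
Proof.
move=> /andP[jx xj]; have [_ sc _] := critical_gappt; have lt_j := ltn_ord j.
apply: cle_between => // [|_|lt_j1]; first by rewrite size_mkseq ltnW.
  by rewrite nth_mkseq // ltnW.
by rewrite nth_mkseq.
Qed.

Lemma clt_gappt (j : 'I_m) x : gappt g j < x <= gappt g j.+1 -> clt c x = j.+1.
Proof.
move=> /andP[jx xj]; have [_ sc _] := critical_gappt; have lt_j := ltn_ord j.
have lt_j1 : (j.+1 < size c)%N by rewrite size_mkseq ltnS.
apply/eqP; rewrite eqn_leq; apply/andP; split.
  rewrite -[leqRHS](clt_nth sc lt_j1) clt_le //.
  by move: lt_j1; rewrite size_mkseq => lt_j1; rewrite nth_mkseq.
by rewrite -(@cle_gappt j (gappt g j)) ?cle_le_clt // lexx gapptS ltrDl g0.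
Qed.

Lemma ltd_gappt (j : 'I_m) x y : gappt g j <= x -> x < y -> y <= gappt g j.+1 ->
  ltd (odd j.+1) f.[x] f.[y].
Proof.
move=> jx xy yj.
have e : cle c x = j.+1 by apply: cle_gappt; rewrite jx (lt_le_trans xy).
rewrite -e; apply: (critical_monotone critical_gappt xy).
by rewrite e (@clt_gappt j) // yj (le_lt_trans jx xy).
Qed.

Lemma gapval_norm (j : 'I_m) : gapval g j = `|f.[gappt g j.+1] - f.[gappt g j]|.
Proof.
have ltj : gappt g j < gappt g j.+1 by rewrite gapptS ltrDl.
have := ltd_gappt (lexx _) ltj (lexx _); rewrite /gapval -signr_odd /=.
case: odd => /= h; first by rewrite expr1 mulN1r ler0_norm // subr_le0 ltW.
by rewrite expr0 mul1r ger0_norm // subr_ge0 ltW.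
Qed.

Lemma gapval_gt0 (j : 'I_m) : 0 < gapval g j.
Proof.
have ltj : gappt g j < gappt g j.+1 by rewrite gapptS ltrDl.
rewrite gapval_norm normr_gt0 subr_eq0; have := ltd_gappt (lexx _) ltj (lexx _).
by case: odd => /= h; rewrite ?(lt_eqF h) ?(gt_eqF h).
Qed.

Lemma norm_deriv_critprim z :
  `|f^`().[z]| = r.+1%:R * \prod_(i < r) `|z - gappt g i|.
Proof.
rewrite deriv_critprim hornerZ normrM normr_nat horner_prod normr_prod.
by congr (_ * _); apply: eq_bigr => i _; rewrite hornerXsubC.
Qed.

(** On the middle third of the interval every critical point is at least [g 0 j / 3] away, which
    bounds f' from below; the outer thirds only increase the difference, by monotonicity. *)
Lemma gapval_lower (j : 'I_m) : (g 0 j / 3) ^+ r.+1 <= gapval g j.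
Proof.
have gj := g0 j; have S := gapptS g j.
pose x := gappt g j + g 0 j / 3; pose y := gappt g j + g 0 j / 3 *+ 2.
have [jx xy yj] : [/\ gappt g j < x, x < y & y < gappt g j.+1].
  by rewrite S /x /y; split; lra.
have [z /andP[xz zy] e] := poly_MVT f xy.
have d1 := ltd_gappt (lexx _) jx (ltW (lt_trans xy yj)).
have d2 := ltd_gappt (ltW jx) xy (ltW yj).
have d3 := ltd_gappt (ltW (lt_trans jx xy)) yj (lexx _).
rewrite gapval_norm; apply: (@le_trans _ _ `|f.[y] - f.[x]|); last first.
  move: d1 d2 d3; case: odd => /= d1 d2 d3.
    by rewrite !ger0_norm; lra.
  by rewrite !ler0_norm; lra.
rewrite e normrM norm_deriv_critprim [y - x](_ : _ = g 0 j / 3); last by rewrite /x /y; ring.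
have g3 : 0 <= g 0 j / 3 by lra.
rewrite [X in _ <= _ * X]ger0_norm // exprSr ler_wpM2r //.
rewrite -[leLHS]mul1r; apply: ler_pM; rewrite ?exprn_ge0 ?ler1n //.
rewrite -[r in _ ^+ r]card_ord -prodr_const; apply: ler_prod => i _.
rewrite g3 /=; have [le_ij|lt_ji] := leqP i j.
  have := gappt_le g0 (i := i) (j := j); rewrite le_ij ltnS (ltnW (ltn_ord j)) => /(_ isT) h.
  by rewrite ger0_norm; move: xz; rewrite /x; lra.
have := gappt_le g0 (i := j.+1) (j := i); rewrite lt_ji ltn_ord => /(_ isT) h.
by rewrite ler0_norm; move: zy; rewrite /y; lra.
Qed.

(** No factor of f' exceeds the total length, which is at most [M *+ m]. *)
Lemma gapval_upper (j : 'I_m) M : (forall k, g 0 k <= M) ->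
  gapval g j <= r.+1%:R * (M *+ m) ^+ r * g 0 j.
Proof.
move=> gM; have gj := g0 j; have S := gapptS g j.
have ltj : gappt g j < gappt g j.+1 by rewrite S ltrDl.
have [z /andP[jz zj] e] := poly_MVT f ltj.
rewrite gapval_norm e normrM norm_deriv_critprim S addrC addKr (ger0_norm (ltW gj)).
rewrite ler_wpM2r ?(ltW gj) // ler_wpM2l ?ler0n //.
rewrite -[r in _ ^+ r]card_ord -prodr_const; apply: ler_prod => i _.
rewrite normr_ge0 /=.
have top : gappt g m - gappt g 0 <= M *+ m.
  have -> : gappt g m - gappt g 0 = \sum_(k < m) g 0 k.
    rewrite /gappt opprD addrACA subrr addr0 /gapsum [X in _ - X]big_pred0 // subr0.
    by apply: eq_bigl => k; rewrite ltn_ord.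
  by rewrite -[X in M *+ X]card_ord -sumr_const; apply: ler_sum.
have l1 := gappt_le g0 (i := 0%N) (j := i) (ltn_ord i).
have l2 : gappt g i <= gappt g m by apply: gappt_le => //; rewrite -ltnS ltn_ord /=.
have l3 : gappt g 0 <= gappt g j by apply: gappt_le => //=; rewrite ltnS ltnW.
have l4 : gappt g j.+1 <= gappt g m by apply: gappt_le => //; rewrite ltn_ord /=.
by rewrite ler_norml; apply/andP; split; lra.
Qed.

End PositiveGaps.
End Gaps.

Section Continuity.
Context {R : realType} {T : topologicalType}.
Implicit Types f g : T -> R.

Lemma continuous_sumr (I : Type) (s : seq I) (P : pred I) (F : I -> T -> R) :
  (forall i, continuous (F i)) -> continuous (fun x => \sum_(i <- s | P i) F i x).
Proof.
move=> cF; elim: s => [|i s IH].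
  rewrite (_ : (fun x => _) = cst 0); first by move=> x; exact: cvg_cst.
  by apply/funext => x; rewrite big_nil.
rewrite (_ : (fun x => _) = fun x => if P i then F i x + \sum_(j <- s | P j) F j x
   else \sum_(j <- s | P j) F j x).
  by case: (P i) => // x; apply: cvgD; [exact: cF|exact: IH].
by apply/funext => x; rewrite big_cons.
Qed.

Lemma continuous_addr f g : continuous f -> continuous g -> continuous (fun x => f x + g x).
Proof. by move=> cf cg x; apply: cvgD; [exact: cf|exact: cg]. Qed.

Lemma continuous_subr f g : continuous f -> continuous g -> continuous (fun x => f x - g x).
Proof. by move=> cf cg x; apply: cvgB; [exact: cf|exact: cg]. Qed.

Lemma continuous_mulr f g : continuous f -> continuous g -> continuous (fun x => f x * g x).
Proof. by move=> cf cg x; apply: cvgM; [exact: cf|exact: cg]. Qed.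

Lemma continuous_exprn f n : continuous f -> continuous (fun x => f x ^+ n).
Proof.
move=> cf; elim: n => [|n IH].
  by rewrite (_ : (fun x => _) = cst 1) // => x; exact: cvg_cst.
rewrite (_ : (fun x => _) = fun x => f x * f x ^+ n); first exact: continuous_mulr.
by apply/funext => x; rewrite exprS.
Qed.

Lemma continuous_cstr (a : R) : continuous (fun _ : T => a).
Proof. by move=> x; exact: cvg_cst. Qed.

Lemma continuous_rootprod r (c : T -> nat -> R) : (forall j, continuous (c ^~ j)) ->
  forall i, continuous (fun x => (rootprod r (c x))`_i).
Proof.
move=> cc; elim: r => [|r IH] i.
  rewrite (_ : (fun x => _) = cst ((1 : {poly R})`_i)); first exact: continuous_cstr.
  by apply/funext => x; rewrite /rootprod big_ord0.
rewrite (_ : (fun x => _) = fun x => (if i == 0%N then 0 else (rootprod r (c x))`_i.-1)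
    - (rootprod r (c x))`_i * c x r).
  apply: continuous_subr; last by apply: continuous_mulr.
  by case: eqP => _; [exact: continuous_cstr|exact: IH].
by apply/funext => x; rewrite /rootprod big_ord_recr /= mulrBr coefB coefMX coefMC.
Qed.

Lemma continuous_critprim r (c : T -> nat -> R) (z : T -> R) :
  (forall j, continuous (c ^~ j)) -> continuous z ->
  continuous (fun x => (critprim r (c x)).[z x]).
Proof.
move=> cc cz.
rewrite (_ : (fun x => _) = fun x =>
  \sum_(i < r.+1) primcoef r i * (rootprod r (c x))`_i * z x ^+ i.+1).
  apply: continuous_sumr => i; apply: continuous_mulr; last exact: continuous_exprn.
  by apply: continuous_mulr; [exact: continuous_cstr|exact: continuous_rootprod].
by apply/funext => x; rewrite horner_critprim.
Qed.

End Continuity.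

Section Existence.
Context {R : realType} (m : nat).
Local Notation r := m.+1.
Hypothesis or : odd r.
Variable d : nat -> R.
Hypothesis d0 : forall j, (j < m)%N -> 0 < d j.

Lemma continuous_gapsum j : continuous (fun g : 'rV[R]_m => gapsum g j).
Proof. by apply: continuous_sumr => i; exact: coord_continuous. Qed.

Lemma continuous_gappt j : continuous (fun g : 'rV[R]_m => gappt g j).
Proof.
apply: continuous_subr; first exact: continuous_gapsum.
apply: continuous_mulr; first exact: continuous_cstr.
by apply: continuous_sumr => i; exact: continuous_gapsum.
Qed.

Lemma continuous_gapval j : continuous (fun g : 'rV[R]_m => gapval g j).
Proof.
apply: continuous_mulr; first exact: continuous_cstr.
by apply: continuous_subr; apply: continuous_critprim => *; exact: continuous_gappt.
Qed.

(* At a stationary point [gapval g j = d j] for all [j]. *)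
Definition energy (g : 'rV[R]_m) : R := \sum_(j < m) (gapval g j + d j ^+ 2 / gapval g j).

Definition box (a b : R) : set 'rV[R]_m := [set g | forall i, a <= g 0 i <= b].

Lemma energy_min a b : 0 < a <= b ->
  exists2 g, box a b g & forall h, box a b h -> energy g <= energy h.
Proof.
move=> /andP[a0 ab].
have cb : compact (box a b).
  rewrite (_ : box a b = [set v : 'rV[R]_m | forall i, `[a, b]%classic (v ord0 i)]).
    by apply: (@rV_compact R m (fun=> `[a, b]%classic)) => i; exact: segment_compact.
  by apply/seteqP; split => g /= H i; have := H i; rewrite in_itv.
have b0 : box a b !=set0 by exists (const_mx a) => i; rewrite mxE lexx.
have ce : {within box a b, continuous energy}.
  apply: continuous_in_subspaceT => g /set_mem gb.
  have g0 i : 0 < g 0 i by have /andP[h _] := gb i; apply: lt_le_trans h.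
  have nz j : gapval g (j : 'I_m) != 0 by rewrite gt_eqF // gapval_gt0.
  rewrite /energy (_ : (fun g => _) = \sum_(j < m) (fun g => gapval g j + d j ^+ 2 / gapval g j)).
    elim/big_ind: _ => [|u v cu cv|j _]. exact: cst_continuous.
      exact: continuousD.
    have cj := @continuous_gapval j g.
    have cVj : (fun h : 'rV[R]_m => (gapval h j)^-1) @ g --> (gapval g j)^-1.
      exact: (cvgV (nz j) cj).
    have cc := @continuous_cstr R 'rV[R]_m (d j ^+ 2) g.
    exact: (cvgD cj (cvgM cc cVj)).
  by apply/funext => h; rewrite fct_sumE.
have [g gb H] := EVT_min_rV b0 cb ce.
by exists g; [exact: set_mem|move=> h hb; apply: H; exact: mem_set].
Qed.

Lemma energy_ge (g : 'rV[R]_m) (j : 'I_m) : (forall i, 0 < g 0 i) ->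
  gapval g j <= energy g /\ d j ^+ 2 / gapval g j <= energy g.
Proof.
move=> g0; have p i : 0 < gapval g (i : 'I_m) by apply: gapval_gt0.
have q (i : 'I_m) : 0 <= d i ^+ 2 / gapval g i by rewrite divr_ge0 ?sqr_ge0 // ltW.
rewrite /energy (bigD1 j) //=.
have : 0 <= \sum_(i < m | i != j) (gapval g i + d i ^+ 2 / gapval g i).
  by apply: sumr_ge0 => i _; rewrite addr_ge0 // ltW.
by move=> h; have := q j; have := ltW (p j); split; lra.
Qed.

Lemma exists_small (e : 'I_m -> R) : (forall j, 0 < e j) ->
  exists2 a : R, 0 < a <= 1 & forall j, a < e j.
Proof.
move=> e0; suff [a a01 H] : exists2 a : R, 0 < a <= 1 & forall j, j \in enum 'I_m -> a < e j.
  by exists a => // j; apply: H; rewrite mem_enum.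
elim: (enum 'I_m) => [|i s [a /andP[a0 a1] IH]]; first by exists 1; rewrite ?ltr01 ?lexx.
exists (Num.min a (e i / 2)).
  by rewrite lt_min a0 divr_gt0 //= ge_min a1.
move=> j; rewrite inE => /predU1P[->|/IH]; last by rewrite gt_min => ->.
by rewrite gt_min orbC ltr_pdivrMr // ltr_pMr // ltr1n.
Qed.

(* The energy blows up when a gap tends to 0 or to infinity. *)
Lemma energy_box : exists a b, [/\ 0 < a <= b,
  box a b (const_mx 1) &
  forall g, box a b g -> energy g <= energy (const_mx 1) -> forall i, a < g 0 i < b].
Proof.
set E := energy (const_mx 1).
have one0 i : 0 < (const_mx 1 : 'rV[R]_m) 0 i by rewrite mxE.
have E0 : 0 <= E.
  apply: sumr_ge0 => j _; have p := gapval_gt0 or one0 j.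
  by rewrite addr_ge0 ?divr_ge0 ?sqr_ge0 // ltW.
(* By [gapval_lower] a gap equal to [b] forces a value gap of at least [b / 3 = 1 + E]. By
   [gapval_upper] a gap [a < d i ^+ 2 / C] forces [d i ^+ 2 / gapval g i > E]. Both contradict
   energy at most [E]. *)
pose b := 3 * (1 + E).
pose C := r.+1%:R * (b *+ m) ^+ r * E + 1.
have b0 : 0 <= b *+ m by rewrite mulrn_wge0 // /b; lra.
have C0 : 0 < C by rewrite /C ltr_pwDr // !mulr_ge0 ?exprn_ge0.
have [a /andP[a0 a1] aC] := @exists_small (fun j => d j ^+ 2 / C) (fun j =>
  divr_gt0 (exprn_gt0 2 (d0 (ltn_ord j))) C0).
exists a, b; split.
- by rewrite a0 (le_trans a1) // /b; lra.
- by move=> i; rewrite mxE a1 /b; lra.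
move=> g gb gE i; have /andP[ai bi] := gb i.
have g0 k : 0 < g 0 k by have /andP[h _] := gb k; apply: lt_le_trans h.
have gM k : g 0 k <= b by have /andP[] := gb k.
have p := gapval_gt0 or g0 i.
have [h1 h2] := energy_ge i g0.
rewrite !lt_neqAle ai bi !andbT; apply/andP; split; apply/eqP => e.
  have up := gapval_upper or g0 i gM; rewrite -e in up.
  have : d i ^+ 2 <= E * gapval g i by rewrite -ler_pdivrMr // (le_trans h2).
  have := aC i; rewrite ltr_pdivlMr // /C => h3 h4.
  have := ler_wpM2l E0 up; set X := r.+1%:R * _ in h3 *.
  by move=> h5; lra.
have lo := gapval_lower or g0 i; rewrite e in lo.
have : b / 3 <= (b / 3) ^+ r.+1 by rewrite -[leLHS]expr1 ler_weXn2l // /b; lra.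
by move: (le_trans h1 gE); rewrite /b; lra.
Qed.

Lemma gappt_inj (g : 'rV[R]_m) i j : (forall k, 0 < g 0 k) ->
  (i < r)%N -> (j < r)%N -> i != j -> gappt g i != gappt g j.
Proof.
move=> g0 lt_i lt_j ne; have [_ sc _] := critical_gappt or g0.
have := nth_uniq 0 (s := mkseq (gappt g) r) (i := i) (j := j).
rewrite size_mkseq !nth_mkseq // => ->//; exact: lt_sorted_uniq.
Qed.

Lemma critprim_ext (c c' : nat -> R) : (forall j, (j < r)%N -> c j = c' j) ->
  critprim r c = critprim r c'.
Proof.
move=> cc; rewrite /critprim /rootprod.
by rewrite (eq_bigr (fun j : 'I_r => 'X - (c' j)%:P)) // => j _; rewrite cc.
Qed.

Lemma near_segment (u v a b : R) : a < u < b ->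
  \forall s \near (0 : R), a <= u + s * v <= b.
Proof.
move=> /andP[au ub].
have c1 : (u + s * v) @[s --> (0 : R)] --> u + 0 * v.
  by apply: cvgD; [exact: cvg_cst|apply: cvgM; [exact: cvg_id|exact: cvg_cst]].
rewrite mul0r addr0 in c1; near=> s.
have h1 : a < u + s * v by near: s; exact: (cvgr_gt _ c1).
have h2 : u + s * v < b by near: s; exact: (cvgr_lt _ c1).
by rewrite !ltW.
Unshelve. all: by end_near. Qed.

(** Here [w j] is the derivative of x + d_j^2 / x at [x = gapval g j]. If the critical points move
    so that each [gapval] changes at rate [- w j], the energy changes at rate minus the sum of the
    squares of the [w j], which must be 0 at an interior minimum. *)
Lemma energy_stationary (g : 'rV[R]_m) a b : 0 < a ->
  (forall i, a < g 0 i < b) -> (forall h, box a b h -> energy g <= energy h) ->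
  forall j, (j < m)%N -> gapval g j = d j.
Proof.
move=> a0 gab gmin.
have g0 k : 0 < g 0 k by have /andP[h _] := gab k; apply: lt_trans h.
pose w j := 1 - d j ^+ 2 / gapval g j ^+ 2.
have [k k0 kw] := exists_speed (fun j => - ((-1) ^+ j * w j)) (fun i j => @gappt_inj g i j g0).
pose h : 'rV[R]_m := \row_i (k i.+1 - k i).
pose D j : {poly R} := (-1) ^+ j *: (vpath r (gappt g) k j.+1 - vpath r (gappt g) k j).
have gh s j : (j < r)%N -> gappt (g + s *: h) j = gappt g j + k j * s.
  by move=> lt_j; rewrite gappt_lin gappt_row.
have DE s j : (j < m)%N -> gapval (g + s *: h) j = (D j).[s].
  move=> lt_j; rewrite /D hornerZ hornerD hornerN !horner_vpath /gapval.
  by rewrite !gh // 1?ltnW // (critprim_ext (gh s)).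
have Dd j : (j < m)%N -> (D j)^`().[0] = - w j.
  move=> lt_j; rewrite /D derivZ derivB hornerZ hornerD hornerN kw // mulrN.
  by rewrite mulrA -expr2 sqrr_sign mul1r.
have D0 j : (j < m)%N -> (D j).[0] = gapval g j by move=> lt_j; rewrite -DE // scale0r addr0.
have : \forall s \near (0 : R), box a b (g + s *: h).
  have H (i : 'I_m) : \forall s \near (0 : R), a <= (g + s *: h) 0 i <= b.
    have := near_segment (h 0 i) (gab i); apply: filterS => s.
    by rewrite !mxE.
  exact: (filter_forall (nbhs_filter (0 : R)) H).
move=> /nbhs_ballP[e /= e0 He].
have inb s : s \in `](-e), e[ -> box a b (g + s *: h).
  rewrite in_itv /= => /andP[s1 s2]; apply: He; rewrite /ball /= sub0r normrN.
  by rewrite ltr_norml s1.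
have pos s j : s \in `](-e), e[ -> (j < m)%N -> 0 < (D j).[s].
  move=> se lt_j; rewrite -DE //; apply: (@gapval_gt0 _ _ _ or _ (Ordinal lt_j)) => i.
  by have /andP[/(lt_le_trans a0)] := inb s se i.
pose phi s := \sum_(j < m) ((D j).[s] + d j ^+ 2 * ((D j).[s])^-1).
have phiE s : phi s = energy (g + s *: h).
  by rewrite /phi /energy; apply: eq_bigr => j _; rewrite !DE.
have phiD s : s \in `](-e), e[ -> is_derive s (1 : R) phi
    (\sum_(j < m) ((D j)^`().[s] + d j ^+ 2 * (- (D j).[s] ^- 2 * (D j)^`().[s]))).
  move=> se; rewrite (_ : phi = \sum_(j < m) (horner (D j) + (d j ^+ 2 \*o (fun s =>
    ((D j).[s])^-1)))); last first.
    by apply/funext => t; rewrite fct_sumE.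
  apply: is_derive_sum => j; apply: is_deriveD.
  have nz : (D j).[s] != 0 by rewrite gt_eqF // pos.
  have dV := @is_deriveV _ (horner (D j)) s _ 1 nz (is_derive_poly (D j) s).
  exact: (is_deriveZ _ dV).
have zero_in : 0 \in `](-e), e[ by rewrite in_itv /= oppr_lt0 e0.
have dphi : is_derive 0 (1 : R) phi 0.
  apply: (@derive1_at_min _ phi (- e) e) => //; first by rewrite ge0_cp // ltW.
    by move=> t te; have [] := phiD t te.
  by move=> t te; rewrite !phiE scale0r addr0; apply: gmin; apply: inb.
have := @derive_val _ _ _ _ _ _ _ dphi; rewrite (@derive_val _ _ _ _ _ _ _ (phiD 0 zero_in)).
rewrite (eq_bigr (fun j : 'I_m => - w j ^+ 2)) => [|j _]; last first.
  by rewrite Dd // D0 // /w; ring.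
rewrite sumrN => /eqP; rewrite oppr_eq0 psumr_eq0 => [/allP H j lt_j|j _]; last exact: sqr_ge0.
have := H (Ordinal lt_j) (mem_index_enum _); rewrite sqrf_eq0 /= subr_eq0 => /eqP e1.
have gj := @gapval_gt0 _ _ _ or g0 (Ordinal lt_j); rewrite /= in gj.
have : gapval g j ^+ 2 = d j ^+ 2.
  by move: e1 => /(congr1 ( *%R^~ (gapval g j ^+ 2))); rewrite mul1r mulfVK // sqrf_eq0 gt_eqF.
by move/eqP; rewrite eqrXn2 ?(ltW gj) ?(ltW (d0 lt_j)) // => /eqP.
Qed.

Lemma exists_gapval :
  exists g : 'rV[R]_m, (forall i, 0 < g 0 i) /\ forall j, (j < m)%N -> gapval g j = d j.
Proof.
have [a [b [/andP[a0 ab] b1 H]]] := energy_box.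
have [g gb gmin] := @energy_min a b ltac:(by rewrite a0).
have gab := H g gb (gmin _ b1).
exists g; split; first by move=> i; have /andP[/(lt_trans a0)] := gab i.
exact: energy_stationary gab gmin.
Qed.

End Existence.

Section CriticalValues.
Context {R : realType}.

Lemma exists_critical_values r (v : nat -> R) : odd r ->
  (forall j, (j.+1 < r)%N -> ltd (odd j.+1) (v j) (v j.+1)) ->
  exists (f : {poly R}) (c : seq R), [/\ critical f c, size c = r,
    \sum_(x <- c) x = 0 &
    forall j, (j < r)%N -> f.[c`_j] - f.[c`_0] = v j - v 0%N].
Proof.
case: r => // m or vI; pose d j := `|v j.+1 - v j|.
have d0 j : (j < m)%N -> 0 < d j.
  move=> lt_j; rewrite normr_gt0 subr_eq0; have := vI j lt_j.
  by case: odd => /= h; rewrite ?(lt_eqF h) ?(gt_eqF h).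
have [g [g0 gd]] := exists_gapval or d0.
exists (critprim m.+1 (gappt g)), (mkseq (gappt g) m.+1); split.
- exact: critical_gappt.
- by rewrite size_mkseq.
- by rewrite -[RHS](gappt_sum g) -(big_mkord xpredT (gappt g)) /index_iota subn0 big_map.
elim=> [|j IH] lt_j; first by rewrite !subrr.
have lt_j' : (j < m)%N by [].
have := IH (ltnW lt_j); rewrite !nth_mkseq ?(ltnW lt_j) //.
have := gd j lt_j'; rewrite /gapval -signr_odd /d.
have := vI j lt_j; rewrite /=; case: odd => /= h.
  rewrite expr1 mulN1r ler0_norm; last by rewrite subr_le0 ltW.
  by move=> e1 e2; lra.
rewrite expr0 mul1r ger0_norm; last by rewrite subr_ge0 ltW.
by move=> e1 e2; lra.
Qed.

End CriticalValues.

(** * Components and locally constant functions *)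

Section LocallyConstant.
Context {T : topologicalType}.
Implicit Types (A B : set T).

Definition locally_constant {Y : Type} A (g : T -> Y) :=
  forall x, A x -> \forall y \near x, A y -> g y = g x.

Lemma connected_constant (Y : Type) A (g : T -> Y) x y :
  connected A -> locally_constant A g -> A x -> A y -> g x = g y.
Proof.
move=> cA lg Ax Ay.
have E : A `&` [set z | g z = g x] = A;
  last by have [_ /= ->] : (A `&` [set z | g z = g x]) y by rewrite E.
apply: cA; first by exists x.
- exists (interior [set z | A z -> g z = g x]); first exact: open_interior.
  apply/seteqP; split=> z [Az gz]; split=> //; last exact: (interior_subset gz).
  by have := lg z Az; apply: filterS => t gt At; rewrite gt.
- exists (~` interior [set z | A z -> g z <> g x]).
    by apply: open_closedC; exact: open_interior.
  apply/seteqP; split=> z [Az gz]; split=> //.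
    by move/interior_subset => /(_ Az).
  apply: contrapT => ngz; apply: gz.
  by have := lg z Az; apply: filterS => t gt At; rewrite gt.
Qed.

(** Membership in a relatively open and closed subset is a locally constant proposition. *)
Lemma constant_connected A :
  (forall (g : T -> Prop) x y, locally_constant A g -> A x -> A y -> g x = g y) ->
  connected A.
Proof.
move=> H B [x Bx] [C oC BC] [D cD BD].
have lB : locally_constant A B.
  move=> z Az; have [Bz|nBz] := pselect (B z).
    have Cz : nbhs z C by apply: open_nbhs_nbhs; split=> //; rewrite BC in Bz; case: Bz.
    apply: filterS Cz => t Ct At; rewrite propeqE; split=> // _.
    by rewrite BC.
  have Dz : nbhs z (~` D).
    apply: open_nbhs_nbhs; split; first exact: closed_openC.
    by move=> Dz; apply: nBz; rewrite BD.
  apply: filterS Dz => t Dt At; rewrite propeqE; split=> // Bt.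
  by case: Dt; rewrite BD in Bt; case: Bt.
have Ax : A x by rewrite BC in Bx; case: Bx.
apply/seteqP; split=> [y|y Ay]; first by rewrite BC => -[].
by rewrite -(H _ _ _ lB Ax Ay).
Qed.

Section Counting.
Context {Y : choiceType} (A : set T) (t : T -> Y) (s : seq Y).
Hypotheses (us : uniq s) (lt : locally_constant A t).
Hypothesis ts : forall x, A x -> t x \in s.
Hypothesis st : forall y, y \in s -> exists2 x, A x & t x = y.

Definition level y := A `&` [set x | t x = y].

Lemma component_level x : A x -> connected_component A x `<=` level (t x).
Proof.
move=> Ax y cy; split; first exact: connected_component_sub cy.
apply: (connected_constant (@component_connected _ A x)) => [z cz||] //.
  have := lt (connected_component_sub cz); apply: filterS => z' H cz'.
  by apply: H; exact: connected_component_sub cz'.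
by apply: connected_component_refl.
Qed.

Lemma ncomponents_levels : (forall y, connected (level y)) -> ncomponents A = size s.
Proof.
move=> cl.
have E x : A x -> connected_component A x = level (t x).
  move=> Ax; apply/seteqP; split; first exact: component_level.
  by apply: connected_component_max => //; apply: subIsetl.
have CE : components A = level @` [set` s].
  apply/seteqP; split=> [_ [x Ax <-]|_ [y /= ys <-]].
    by exists (t x); [exact: ts|rewrite E].
  by have [x Ax tx] := st ys; exists x => //; rewrite E // tx.
rewrite /ncomponents CE fset_set_image //.
rewrite card_in_imfset /=; last first.
  move=> y z; rewrite !in_fset_set // !inE => ys zs e.
  have [x Ax tx] := st ys; have [_ /= tz] : level z x by rewrite -e.
  by rewrite -tx tz.
rewrite -[in RHS](undup_id us) -card_fseq; congr #|` _|%fset.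
by apply/fsetP => y; rewrite in_fset_set // mem_setE inE.
Qed.

(** Each component lies in one level and each [y] in [s] has a nonempty level. With no more
    components than elements of [s], no two components share a level. *)
Lemma levels_connected : (0 < ncomponents A)%N -> (ncomponents A <= size s)%N ->
  forall y, connected (level y).
Proof.
move=> n0 ns y.
(* An infinite set of components would have been counted as 0. *)
have [fC|iC] := pselect (finite_set (components A)); last first.
  move: n0; rewrite /ncomponents; have -> : fset_set (components A) = fset0 by rewrite /fset_set;
    case: pselect.
  by rewrite cardfs0.
pose cs : seq (set T) := fset_set (components A).
have csP C : C \in cs -> components A C.
  by rewrite /cs in_fset_set // inE.
pose f C := xget y [set z | exists2 x, A x /\ C = connected_component A x & z = t x].
have fE x : A x -> f (connected_component A x) = t x.
  move=> Ax; rewrite /f; case: xgetP => [_ _ [x' [Ax' e] ->]|/(_ (t x))]; last first.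
    by case; exists x.
  have : connected_component A x x' by rewrite e; exact: connected_component_refl.
  by move=> /component_level -/(_ Ax)[].
have uf : uniq (map f cs).
  apply: (leq_size_uniq us) => [z zs|]; last by rewrite size_map.
  have [x Ax <-] := st zs; rewrite -(fE x Ax) map_f // /cs in_fset_set // inE.
  by exists x.
have [[x lx]|none] := pselect (level y !=set0); last first.
  rewrite (_ : level y = set0); first exact: connected0.
  by rewrite -subset0 => x lx; apply: none; exists x.
have [Ax tx] := lx.
rewrite (_ : level y = connected_component A x); first exact: component_connected.
apply/seteqP; split=> [z [Az tz]|z cz]; last by rewrite -tx; exact: component_level.
have Cx u : A u -> connected_component A u \in cs.
  by move=> Au; rewrite /cs in_fset_set // inE; exists u.
have inj : {in cs &, injective f}.
  move=> C D Cc Dc e; apply/eqP; apply: contraT => ne.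
  have /(nthP set0)[i lt_i eC] := Cc; have /(nthP set0)[j lt_j eD] := Dc.
  have := nth_uniq y (s := map f cs) (i := i) (j := j).
  rewrite size_map !(nth_map set0) // eC eD e eqxx => /(_ lt_i lt_j uf)/esym/eqP ij.
  by move: ne; rewrite -eC -eD ij eqxx.
have e : connected_component A x = connected_component A z.
  by apply: inj; rewrite ?Cx // !fE // tz.
by rewrite e; exact: connected_component_refl.
Qed.

End Counting.
End LocallyConstant.

Lemma eq_from_filter (A : eqType) (p : pred A) (s1 s2 : seq A) :
  map p s1 = map p s2 -> seq.filter p s1 = seq.filter p s2 ->
  seq.filter (predC p) s1 = seq.filter (predC p) s2 -> s1 = s2.
Proof.
elim: s1 s2 => [|x s1 IH] [|y s2] //= [exy em].
by rewrite -exy; case: (p x) => /= [[-> e1] e2|e1 [-> e2]]; rewrite (IH s2).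
Qed.

Lemma nth_filter_count (A : eqType) (x0 : A) (p : pred A) (s : seq A) k :
  (k < size s)%N -> p (nth x0 s k) ->
  nth x0 (seq.filter p s) (count p (take k s)) = nth x0 s k.
Proof.
elim: s k => // x s IH [|k] /=; first by move=> _ ->.
by rewrite ltnS => lt_k pk; case: (p x) => /=; rewrite ?add0n ?add1n /= IH.
Qed.

(** Inverse to splitting a sequence by a predicate: [true] in the mask takes the next entry of the
    first sequence. *)
Fixpoint shuffle (A : Type) (m : seq bool) (s1 s2 : seq A) : seq A :=
  match m, s1, s2 with
  | true :: m', x :: s1', _ => x :: shuffle m' s1' s2
  | false :: m', _, y :: s2' => y :: shuffle m' s1 s2'
  | _, _, _ => [::]
  end.

Lemma shuffleP (A : eqType) (p : pred A) (m : seq bool) (s1 s2 : seq A) :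
  all p s1 -> all (predC p) s2 -> size s1 = count id m -> size s2 = count negb m ->
  [/\ map p (shuffle m s1 s2) = m, seq.filter p (shuffle m s1 s2) = s1 &
      seq.filter (predC p) (shuffle m s1 s2) = s2].
Proof.
elim: m s1 s2 => [|b m IH] s1 s2; first by move=> _ _ /size0nil -> /size0nil ->.
case: b => /=.
  case: s1 => // x s1 /andP[px a1] a2; rewrite add0n => -[e1] e2.
  by have [h1 h2 h3] := IH s1 s2 a1 a2 e1 e2; rewrite /= px h1 h2 h3.
case: s2 => [|y s2]; first by case: (s1).
move=> a1 /= /andP[py a2]; rewrite add0n => e1 [e2].
have [h1 h2 h3] := IH s1 s2 a1 a2 e1 e2.
by case: s1 a1 e1 h1 h2 h3 => [|x s1] a1 e1 h1 h2 h3; rewrite /= (negbTE py) /= h1 h2 h3.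
Qed.

(** * Rank patterns and sorting permutations *)

Section Ranks.
Context {R : realType}.
Implicit Types (W Q Y : seq R) (i j k : nat).

(** The standardisation of W: for distinct entries, the permutation with the same relative order. *)
Definition rk W : seq nat := [seq count (fun u => u < v) W | v <- W].

Lemma size_rk W : size (rk W) = size W.
Proof. by rewrite size_map. Qed.

Lemma rk_lt W i j : (i < size W)%N -> (j < size W)%N ->
  (nth 0%N (rk W) i < nth 0%N (rk W) j)%N = (W`_i < W`_j).
Proof.
move=> lt_i lt_j; rewrite !(nth_map 0) //.
have H x y : x \in W -> x < y -> (clt W x < clt W y)%N.
  move=> xW xy; apply: (@leq_trans (cle W x)); last exact: cle_le_clt.
  rewrite /cle /clt; elim: W xW {lt_i lt_j} => // w W IH; rewrite inE /=.
  case/predU1P => [<-|/IH h].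
    by rewrite ltxx lexx add0n add1n ltnS; apply: sub_count => z /ltW.
  by case: ltgtP => _; rewrite ?ltnS ?add1n ?add0n // ltnW.
have Wi : W`_i \in W by rewrite mem_nth.
have Wj : W`_j \in W by rewrite mem_nth.
case: (ltgtP W`_i W`_j) => [/(H _ _ Wi)//|/(H _ _ Wj)|->]; last by rewrite ltnn.
by rewrite /clt ltnNge => /negbTE h; apply/negbTE; rewrite -leqNgt ltnW // ltnNge h.
Qed.

Lemma rk_perm W : uniq W -> perm_eq (rk W) (iota 0 (size W)).
Proof.
move=> uW; have ur : uniq (rk W).
  apply/(uniqP 0%N) => i j; rewrite !inE size_rk => lt_i lt_j e.
  have := rk_lt lt_i lt_j; have := rk_lt lt_j lt_i; rewrite e ltnn => h1 h2.
  by apply/eqP; rewrite -(nth_uniq 0 lt_i lt_j uW) eq_le !leNgt -h1 -h2.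
have sub : {subset rk W <= iota 0 (size W)}.
  move=> x /mapP[v vW ->]; rewrite mem_iota /= add0n.
  rewrite -(count_predC (fun u => u < v) W) -addn1 leq_add2l.
  by rewrite -has_count; apply/hasP; exists v => //=; rewrite ltxx.
apply: uniq_perm => //; first exact: iota_uniq.
have [|_ e] := uniq_min_size ur sub; first by rewrite size_iota size_rk.
exact: e.
Qed.

Lemma dir_rk W k : (k <= size W)%N -> dir 0%N (rk W) k = dir (0 : R) W k.
Proof.
move=> le_k; rewrite /dir size_rk; case: eqP => // k0; case: eqP => // kW.
by rewrite -rk_lt //; lia.
Qed.

Lemma turn_rk W k : (k < size W)%N -> turn 0%N (rk W) k = turn (0 : R) W k.
Proof. by move=> lt_k; rewrite /turn !dir_rk // ltnW. Qed.

Lemma peaks_rk W : peaks 0%N (rk W) = peaks (0 : R) W.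
Proof.
rewrite /peaks size_rk; apply: eq_bigr => i _.
by rewrite /peak !dir_rk // ltnW.
Qed.

Lemma rk_map_mono (h : R -> R) W : {homo h : x y / x < y} -> rk (map h W) = rk W.
Proof.
move=> hh; rewrite /rk -map_comp; apply: eq_map => v /=.
rewrite count_map; apply: eq_count => u /=.
case: (ltgtP u v) => [/hh//|/hh vu|->]; last by rewrite ltxx.
by apply/negbTE; rewrite -leNgt ltW.
Qed.

Lemma eq_rk W W' : size W = size W' ->
  (forall i j, (i < size W)%N -> (j < size W)%N -> (W`_i < W`_j) = (W'`_i < W'`_j)) ->
  rk W = rk W'.
Proof.
move=> sW H; apply: (@eq_from_nth _ 0%N); rewrite ?size_rk // => k lt_k.
rewrite !(nth_map 0) -?sW //.
rewrite -[in LHS](mkseq_nth 0 W) -[in RHS](mkseq_nth 0 W') !count_map -sW.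
apply: eq_in_count => i; rewrite mem_iota /= => lt_i.
by rewrite !nth_mkseq //; apply: H.
Qed.

Lemma rk_natr (s : seq nat) : perm_eq s (iota 0 (size s)) ->
  rk [seq (x%:R : R) | x <- s] = s.
Proof.
move=> ps; rewrite /rk -map_comp -[RHS]map_id; apply/eq_in_map => v vs /=.
rewrite count_map (eq_count (a2 := fun u => (u < v)%N)); last by move=> u /=; rewrite ltr_nat.
rewrite (permP ps); have : (v <= size s)%N.
  by move: vs; rewrite (perm_mem ps) mem_iota => /andP[_ /ltnW].
move: (size s) => m le_v; rewrite -(subnKC le_v) iotaD count_cat.
rewrite (eq_in_count (a2 := predT)) ?count_predT ?size_iota; last first.
  by move=> u; rewrite mem_iota.
rewrite (eq_in_count (a2 := pred0)) ?count_pred0 ?addn0 //.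
by move=> u; rewrite mem_iota /= add0n => /andP[vu _]; rewrite ltnNge vu.
Qed.

Definition labs Q : seq nat := sort (relpre (nth 0 Q) <=%R) (iota 0 (size Q)).

Lemma labs_perm Q : perm_eq (labs Q) (iota 0 (size Q)).
Proof. by rewrite perm_sort. Qed.

Lemma map_labs Q : map (nth 0 Q) (labs Q) = sort <=%R Q.
Proof. by rewrite -sort_map -[in RHS](mkseq_nth 0 Q). Qed.

Lemma map_labs_perm Q : perm_eq (map (nth 0 Q) (labs Q)) Q.
Proof. by rewrite map_labs perm_sort. Qed.

Lemma map_labs_sorted Q : uniq Q -> sorted <%R (map (nth 0 Q) (labs Q)).
Proof.
by move=> uQ; rewrite lt_sorted_uniq_le (perm_uniq (map_labs_perm Q)) uQ map_labs sort_le_sorted.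
Qed.

Lemma labs_unique Q s : uniq Q -> perm_eq s (iota 0 (size Q)) ->
  sorted <%R (map (nth 0 Q) s) -> labs Q = s.
Proof.
move=> uQ ps sQ.
have e : map (nth 0 Q) (labs Q) = map (nth 0 Q) s.
  rewrite map_labs; apply/esym; apply: lt_sorted_eq => //.
    by rewrite -map_labs map_labs_sorted.
  apply: perm_mem; rewrite perm_sym perm_sort perm_sym.
  by rewrite -[X in perm_eq _ X](mkseq_nth 0 Q); apply: perm_map.
have in_iota t k : perm_eq t (iota 0 (size Q)) -> (k < size t)%N -> (nth 0%N t k < size Q)%N.
  move=> pt lt_k; have : nth 0%N t k \in t by rewrite mem_nth.
  by rewrite (perm_mem pt) mem_iota.
have sz : size (labs Q) = size s by rewrite (perm_size (labs_perm Q)) (perm_size ps).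
apply: (@eq_from_nth _ 0%N) => // k lt_k; have lt_k' : (k < size s)%N by rewrite -sz.
apply/eqP; rewrite -(nth_uniq 0 _ _ uQ) ?in_iota // ?labs_perm //.
by rewrite -(nth_map 0%N 0 (nth 0 Q)) // e (nth_map 0%N).
Qed.

Lemma labs_lt Q k : (k < size Q)%N -> (nth 0%N (labs Q) k < size Q)%N.
Proof.
move=> lt_k; have : nth 0%N (labs Q) k \in labs Q by rewrite mem_nth ?size_sort ?size_iota.
by rewrite (perm_mem (labs_perm Q)) mem_iota.
Qed.

Lemma size_labs Q : size (labs Q) = size Q.
Proof. by rewrite size_sort size_iota. Qed.

Lemma eq_labs Q Q' : size Q = size Q' -> uniq Q -> uniq Q' ->
  (forall i j, (i < size Q)%N -> (j < size Q)%N -> Q`_i < Q`_j -> Q'`_i < Q'`_j) ->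
  labs Q = labs Q'.
Proof.
move=> sQ uQ uQ' H; apply/esym/labs_unique => //.
  by rewrite -sQ labs_perm.
apply/(sortedP 0) => k; rewrite size_map size_labs => lt_k.
have lt_k' := ltnW lt_k.
rewrite !(nth_map 0%N) ?size_labs //; apply: H; rewrite ?labs_lt //.
have /(sortedP 0) /(_ k) := map_labs_sorted uQ.
by rewrite size_map size_labs !(nth_map 0%N) ?size_labs //; apply.
Qed.

(** Piecewise linear: each new leftmost point prolongs the map to the left along the line through it
    and its neighbour. *)
Lemma increasing_extension (X Y : nat -> R) (s : seq nat) :
  sorted (relpre X <%R) s -> sorted (relpre Y <%R) s ->
  exists2 h : R -> R, {homo h : x y / x < y} & {in s, forall i, h (X i) = Y i}.
Proof.
elim: s => [|i [|j s] IH] sX sY; first by exists id.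
  exists (fun t => t + (Y i - X i)) => [x y|k]; first by rewrite ltrD2r.
  by rewrite inE => /eqP ->; rewrite addrC subrK.
move: sX sY => /= /andP[Xij sX] /andP[Yij sY].
have [h hh hs] := IH sX sY.
pose a := (Y j - Y i) / (X j - X i).
have a0 : 0 < a by rewrite divr_gt0 // subr_gt0.
have hj : h (X j) = Y j by rewrite hs // mem_head.
exists (fun t => if t < X j then Y j + (t - X j) * a else h t).
  move=> x y xy; case: (ltP y (X j)) => [yj|jy].
    by rewrite (lt_trans xy yj) ltrD2l ltr_pM2r // ltrD2r.
  case: (ltP x (X j)) => [xj|_]; last exact: hh.
  apply: (@lt_le_trans _ _ (Y j)).
    by rewrite -[ltRHS]addr0 ltrD2l nmulr_rlt0 // subr_lt0.
  by rewrite -hj; move: jy; rewrite le_eqVlt => /predU1P[->//|/hh/ltW].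
move=> k; rewrite inE => /predU1P[->|ks].
  rewrite Xij -[X i - X j]opprB mulNr /a mulrCA divff ?mulr1; last by rewrite gt_eqF // subr_gt0.
  by rewrite opprB addrC subrK.
have jk : X j <= X k.
  move: ks; rewrite inE => /predU1P[->//|ks].
  have /allP := order_path_min (leT := relpre X <%R) (fun x y z =>
    @lt_trans _ _ (X x) (X y) (X z)) sX.
  by move=> /(_ k ks)/ltW.
by rewrite ltNge jk /= hs.
Qed.

End Ranks.

(** * The type of a morsification *)

Section Morsifications.
Context {R : realType} (n : nat).
Hypothesis on : odd n.-1.
Local Notation r := n.-1.
Implicit Types (v : 'rV[R]_(n - 2)) (c : seq R).

Let nS : r.+1 = n.
Proof. by case: (n) on. Qed.

Lemma critical_inj (f : {poly R}) c c' : critical f c -> critical f c' -> c = c'.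
Proof.
move=> [_ sc e] [_ sc' e']; apply: lt_sorted_eq => // x.
have n0 m : m.+1%:R != 0 :> R by rewrite pnatr_eq0.
by rewrite -!root_prod_XsubC -(rootZ _ _ (n0 (size c))) -e e' rootZ.
Qed.

(** Distinct critical values force distinct critical points, so the list can be sorted strictly. *)
Lemma very_nice_MP l (fb : 'rV[R]_(n - 2) * 'rV[R]_l) :
  very_nice_M R n l fb <-> exists c, [/\ critical (Ppoly fb.1) c, size c = r &
    uniq (map (horner (Ppoly fb.1)) (c ++ [seq fb.2 0 j | j <- enum 'I_l]))].
Proof.
split=> [[c [dc uc]]|[c [[oc sc dc] szc uc]]]; last first.
  have szc' : size c == r by apply/eqP.
  exists (Tuple szc'); split; first by rewrite /= dc szc nS.
  by move: uc; rewrite map_cat -map_comp.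
exists (sort <=%R c); split.
- split; first by rewrite size_sort size_tuple.
    rewrite lt_sorted_uniq_le sort_uniq sort_le_sorted andbT.
    by apply: (@map_uniq _ _ (horner (Ppoly fb.1))); move: uc; rewrite cat_uniq => /andP[].
  rewrite dc size_sort size_tuple nS; congr (_ *: _).
  by apply: perm_big; rewrite perm_sym perm_sort.
- by rewrite size_sort size_tuple.
rewrite map_cat -map_comp; move: uc; congr is_true; apply: perm_uniq.
by rewrite perm_cat2r perm_map // perm_sym perm_sort.
Qed.

Lemma horner_Ppoly v x : (Ppoly v).[x] = x ^+ n + \sum_(i < n - 2) v 0 i * x ^+ (n - 2 - i).
Proof.
rewrite /Ppoly hornerD hornerXn horner_sum; congr (_ + _).
by apply: eq_bigr => i _; rewrite hornerZ hornerXn.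
Qed.

Lemma horner_deriv_Ppoly v x : (Ppoly v)^`().[x] =
  ('X^n)^`().[x] + \sum_(i < n - 2) v 0 i * ('X^(n - 2 - i))^`().[x].
Proof.
rewrite /Ppoly derivD hornerD raddf_sum horner_sum; congr (_ + _).
by apply: eq_bigr => i _; rewrite /= derivZ hornerZ.
Qed.

Lemma continuous_deriv_Ppoly x : continuous (fun v => (Ppoly v)^`().[x]).
Proof.
rewrite (_ : (fun v => _) = fun v : 'rV[R]_(n - 2) => ('X^n)^`().[x] +
   \sum_(i < n - 2) v 0 i * ('X^(n - 2 - i))^`().[x]); last first.
  by apply/funext => v; rewrite horner_deriv_Ppoly.
apply: continuous_addr; first exact: continuous_cstr.
apply: continuous_sumr => i.
by apply: continuous_mulr; [exact: coord_continuous|exact: continuous_cstr].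
Qed.

Lemma continuous_horner_Ppoly :
  continuous (fun p : 'rV[R]_(n - 2) * R => (Ppoly p.1).[p.2]).
Proof.
have c2 : continuous (fun p : 'rV[R]_(n - 2) * R => p.2) by move=> p; exact: cvg_snd.
rewrite (_ : (fun p => _) = fun p : 'rV[R]_(n - 2) * R => p.2 ^+ n +
   \sum_(i < n - 2) p.1 0 i * p.2 ^+ (n - 2 - i)); last first.
  by apply/funext => p; rewrite horner_Ppoly.
apply: continuous_addr; first exact: continuous_exprn.
apply: continuous_sumr => i.
apply: continuous_mulr; last exact: continuous_exprn.
move=> p; apply: (@cvg_comp _ _ _ fst (fun v : 'rV[R]_(n - 2) => v 0 i) _ _ _ cvg_fst).
exact: coord_continuous.
Qed.

Lemma sign_deriv_critical (f : {poly R}) c x : critical f c -> x \notin c ->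
  (0 < f^`().[x]) = odd (cle c x).
Proof.
move=> cr xc; have [oc _ _] := cr; rewrite (deriv_critical _ cr) pmulr_rgt0 ?ltr0n //.
have := sign_prod_XsubC xc.
have le_c : (cle c x <= size c)%N by exact: count_size.
rewrite -signr_odd oddB // oc; case: odd => /=; first by rewrite expr0 mul1r.
by rewrite expr1 mulN1r oppr_gt0 => h; apply/negbTE; rewrite -leNgt ltW.
Qed.

Lemma deriv_critical_neq0 (f : {poly R}) c x : critical f c -> x \notin c -> f^`().[x] != 0.
Proof.
move=> [_ _ e] xc; rewrite e hornerZ mulf_neq0 ?pnatr_eq0 //.
by rewrite -rootE root_prod_XsubC.
Qed.

(* The parity of the number of critical points to the left of a test point is
   the sign of the derivative there; it pins down each critical point of a
   nearby polynomial. *)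
Lemma critical_near v0 c0 (e : R) : critical (Ppoly v0) c0 -> 0 < e ->
  \forall v \near v0, forall c, critical (Ppoly v) c -> size c = size c0 ->
    forall j, (j < size c0)%N -> `|c`_j - c0`_j| < e.
Proof.
move=> cr0 e0; have [oc0 sc0 _] := cr0.
pose m := size c0.
have [d /andP[d0 de] dgap] : exists2 d, 0 < d < e &
    forall j, (j.+1 < m)%N -> c0`_j + d < c0`_j.+1 - d.
  pose gap j := if (j.+1 < m)%N then Num.min e ((c0`_j.+1 - c0`_j) / 2) else e.
  have gap0 (j : 'I_m) : 0 < gap j.
    rewrite /gap; case: ifP => // lt_j.
    by rewrite lt_min e0 divr_gt0 // subr_gt0 sorted_nth_lt // ltnW.
  have [a /andP[a0 a1] aH] := exists_small gap0.
  exists (Num.min a (e / 2)).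
    by rewrite lt_min a0 divr_gt0 //= gt_min orbC ltr_pdivrMr // ltr_pMr // ltr1n.
  move=> j lt_j; have := aH (Ordinal (ltnW lt_j)); rewrite /gap /= lt_j lt_min => /andP[_ h].
  by have : Num.min a (e / 2) <= a by [rewrite ge_min lexx]; lra.
pose xm j := c0`_j - d; pose xp j := c0`_j + d.
have tP j : (j < m)%N -> [/\ xm j \notin c0, cle c0 (xm j) = j,
  xp j \notin c0 & cle c0 (xp j) = j.+1].
  move=> lt_j; have up : (j.+1 < m)%N -> xp j < c0`_j.+1.
    by move=> /dgap; rewrite /xp; lra.
  have lo : (0 < j)%N -> c0`_j.-1 <= xm j.
    case: j lt_j {up} => // j lt_j _; have := dgap j lt_j; rewrite /xm /=; lra.
  have e1 : cle c0 (xm j) = j.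
    by apply: cle_between => //; [exact: ltnW|rewrite /xm => _; lra].
  have e2 : cle c0 (xp j) = j.+1.
    by apply: cle_between => //; rewrite /xp /= => _; lra.
  have e3 : clt c0 (xm j) = j.
    apply/eqP; rewrite eqn_leq; have := clt_le_cle c0 (xm j); rewrite e1 => -> /=.
    case: j lt_j lo {up e1 e2} => // j lt_j _.
    rewrite -[leqLHS](cle_nth sc0 (ltnW lt_j)); apply: cle_le_clt.
    by have := dgap j lt_j; rewrite /xm; lra.
  have e4 : clt c0 (xp j) = j.+1.
    apply/eqP; rewrite eqn_leq; have := clt_le_cle c0 (xp j); rewrite e2 => -> /=.
    by rewrite -[leqLHS](cle_nth sc0 lt_j); apply: cle_le_clt; rewrite /xp; lra.
  split=> //; apply/negP => h.
    by have := cleE (xm j) (lt_sorted_uniq sc0); rewrite h e1 e3; lia.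
  by have := cleE (xp j) (lt_sorted_uniq sc0); rewrite h e2 e4; lia.
have same x : x \notin c0 -> \forall v \near v0, forall c, critical (Ppoly v) c ->
    odd (cle c x) = odd (cle c0 x) /\ x \notin c.
  move=> xc0; have nz := deriv_critical_neq0 cr0 xc0.
  have cv := @continuous_deriv_Ppoly x v0.
  have : \forall v \near v0, 0 < (Ppoly v)^`().[x] * (Ppoly v0)^`().[x].
    have c2 := @continuous_mulr _ _ _ _ (@continuous_deriv_Ppoly x) (@continuous_cstr _ _ ((Ppoly
      v0)^`().[x])) v0.
    by apply: (cvgr_gt _ c2); rewrite -expr2 exprn_even_gt0.
  apply: filterS => v pos c cr.
  have xc : x \notin c.
    apply: contraTN pos => xc; have [_ _ ->] := cr.
    have /rootP e1 : root (\prod_(y <- c) ('X - y%:P)) x by rewrite root_prod_XsubC.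
    by rewrite hornerZ e1 mulr0 mul0r ltxx.
  split=> //; rewrite -(sign_deriv_critical cr xc) -(sign_deriv_critical cr0 xc0).
  have nz' := deriv_critical_neq0 cr xc.
  by case: (ltgtP 0 (Ppoly v0)^`().[x]) pos nz => // h pos _;
    rewrite ?(pmulr_lgt0 _ h) ?(nmulr_lgt0 _ h) in pos *; rewrite ?pos // ltNge ltW.
have : \forall v \near v0, forall j : 'I_m, forall c, critical (Ppoly v) c ->
    odd (cle c (xm j)) = odd j /\ odd (cle c (xp j)) = ~~ odd j.
  apply: (filter_forall (nbhs_filter v0)) => j.
  have [h1 h2 h3 h4] := tP j (ltn_ord j).
  apply: filterS2 (same _ h1) (same _ h3) => v H1 H2 c cr.
  by have [-> _] := H1 c cr; have [-> _] := H2 c cr; rewrite h2 h4.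
apply: filterS => v H c cr sz; have [oc sc _] := cr.
(* The parity changes between the test points around each old critical point, so a new one lies
   there. There are as many new ones as such intervals, so each interval holds exactly one; [low]
   and [high] count from the two sides. *)
have step j : (j < m)%N -> (cle c (xm j) < cle c (xp j))%N.
  move=> lt_j; have [h1 h2] := H (Ordinal lt_j) c cr; rewrite /= in h1 h2.
  rewrite ltn_neqAle cle_le ?andbT; last by rewrite /xm /xp; lra.
  by apply/eqP => e1; move: h2; rewrite -e1 h1; case: odd.
have gap j : (j.+1 < m)%N -> (cle c (xp j) <= cle c (xm j.+1))%N.
  by move=> /dgap h; apply: cle_le; rewrite /xp /xm ltW.
have low j : (j < m)%N -> (j < cle c (xp j))%N.
  elim: j => [|j IH] lt_j; first exact: leq_ltn_trans (step 0%N lt_j).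
  apply: leq_ltn_trans (step _ lt_j); apply: leq_trans (gap _ lt_j).
  exact: IH (ltnW lt_j).
have high k : forall j, (j < m)%N -> (m - j <= k)%N -> (cle c (xm j) <= j)%N.
  elim: k => [|k IH] j lt_j le_k; first by move: le_k; lia.
  rewrite -ltnS; apply: leq_trans (step j lt_j) _.
  have [lt_j1|] := ltnP j.+1 m; first by rewrite (leq_trans (gap _ lt_j1)) // IH //; lia.
  rewrite leq_eqVlt ltnNge lt_j orbF => /eqP <-.
  by rewrite /m -sz; apply: count_size.
move=> j lt_j; have lt_j' : (j < size c)%N by rewrite sz.
have b1 : xm j < c`_j.
  by apply: (@ltd_cle _ c); rewrite cle_nth // ltnS; apply: (high (m - j)%N).
have b2 : c`_j <= xp j.
  rewrite leNgt; apply/negP => /(cle_le_clt c); rewrite clt_nth //.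
  by rewrite leqNgt low.
by move: b1 b2; rewrite /xm /xp ltr_norml => b1 b2; apply/andP; split; lra.
Qed.

End Morsifications.

Section Types.
Context {R : realType} (n : nat).
Hypothesis on : odd n.-1.
Local Notation r := n.-1.
Implicit Types (v : 'rV[R]_(n - 2)) (c : seq R).

Definition crit v : seq R := xget [::] [set c | critical (Ppoly v) c].

Lemma critE v c : critical (Ppoly v) c -> crit v = c.
Proof.
move=> cr; rewrite /crit; case: xgetP => [c' -> cr'|/(_ c)//].
exact: critical_inj cr' cr.
Qed.

Section Boundary.
Context {l : nat}.
Local Notation config := ('rV[R]_(n - 2) * 'rV[R]_l)%type.
Local Notation M := (r + l)%N.
Implicit Type fb : config.
Local Notation V := (very_nice_M R n l).

(* The labels 0, ..., r - 1 denote the critical points in increasing order, the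
   labels r, r + 1, ... the boundary points. *)
Definition pts fb : seq R := crit fb.1 ++ [seq fb.2 0 j | j <- enum 'I_l].
Definition lab fb : seq nat := labs (pts fb).
Definition vals fb : seq R := [seq (Ppoly fb.1).[(pts fb)`_i] | i <- lab fb].
Definition bdlab fb : seq nat := [seq i <- lab fb | (r <= i)%N].
Definition tau fb : seq nat * seq nat := (rk (vals fb), bdlab fb).

Definition nice fb := [/\ critical (Ppoly fb.1) (crit fb.1), size (crit fb.1) = r &
  uniq (map (horner (Ppoly fb.1)) (pts fb))].

Lemma niceP fb : V fb <-> nice fb.
Proof.
rewrite (very_nice_MP on); split=> [[c [cr sc uc]]|[cr sc uc]].
  by have e := critE cr; rewrite /nice /pts e.
by exists (crit fb.1).
Qed.

Lemma size_pts fb : nice fb -> size (pts fb) = M.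
Proof. by move=> [_ sc _]; rewrite size_cat size_map size_enum_ord sc. Qed.

Lemma uniq_pts fb : nice fb -> uniq (pts fb).
Proof. by move=> [_ _]; apply: map_uniq. Qed.

Lemma size_lab fb : nice fb -> size (lab fb) = M.
Proof. by move=> nf; rewrite size_labs size_pts. Qed.

Lemma lab_perm fb : nice fb -> perm_eq (lab fb) (iota 0 M).
Proof. by move=> nf; rewrite -(size_pts nf) labs_perm. Qed.

Lemma size_vals fb : nice fb -> size (vals fb) = M.
Proof. by move=> nf; rewrite size_map size_lab. Qed.

Lemma valsE fb : vals fb = map (horner (Ppoly fb.1)) (map (nth 0 (pts fb)) (lab fb)).
Proof. by rewrite -map_comp. Qed.

Lemma uniq_vals fb : nice fb -> uniq (vals fb).
Proof.
by move=> [_ _ uf]; rewrite valsE (perm_uniq (perm_map _ (map_labs_perm _))).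
Qed.

Lemma pts_crit fb i : nice fb -> (i < M)%N -> ((pts fb)`_i \in crit fb.1) = (i < r)%N.
Proof.
move=> nf lt_i; have [_ sc _] := nf; have := uniq_pts nf.
rewrite /pts cat_uniq => /and3P[_ /hasPn H _]; rewrite nth_cat sc.
case: ltnP => le_i; first by rewrite mem_nth // sc.
apply/negbTE/H/mem_nth; rewrite size_map size_enum_ord.
by rewrite ltn_subLR.
Qed.

Lemma lab_lt fb k : nice fb -> (k < M)%N -> (nth 0%N (lab fb) k < M)%N.
Proof. by move=> nf; rewrite -(size_pts nf) => /labs_lt. Qed.

Lemma crit_sub fb : nice fb -> {subset crit fb.1 <= map (nth 0 (pts fb)) (lab fb)}.
Proof.
by move=> nf x xc; rewrite (perm_mem (map_labs_perm _)) mem_cat xc.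
Qed.

Lemma turn_vals fb k : nice fb -> (k < M)%N ->
  turn (0 : R) (vals fb) k = (nth 0%N (lab fb) k < r)%N.
Proof.
move=> nf lt_k; have [cr sc _] := nf.
rewrite valsE (turn_critical cr) ?size_map ?size_lab //.
- by rewrite (nth_map 0%N) ?size_lab // pts_crit // lab_lt.
- by apply: map_labs_sorted; apply: uniq_pts.
- exact: crit_sub.
Qed.

Lemma filter_lab fb : nice fb -> [seq i <- lab fb | (i < r)%N] = iota 0 r.
Proof.
move=> nf; have [cr sc _] := nf; have [_ srt _] := cr.
have up := uniq_pts nf.
have e : map (nth 0 (pts fb)) [seq i <- lab fb | (i < r)%N] = map (nth 0 (pts fb)) (iota 0 r).
  have -> : map (nth 0 (pts fb)) (iota 0 r) = crit fb.1.
    rewrite -[RHS](mkseq_nth 0) sc; apply/eq_in_map => i; rewrite mem_iota /= => lt_i.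
    by rewrite /pts nth_cat sc lt_i.
  apply: lt_sorted_eq => //.
    have -> : map (nth 0 (pts fb)) [seq i <- lab fb | (i < r)%N] =
        [seq x <- map (nth 0 (pts fb)) (lab fb) | x \in crit fb.1].
      rewrite filter_map; congr map; apply: eq_in_filter => i.
      by rewrite (perm_mem (lab_perm nf)) mem_iota /= => lt_i; rewrite pts_crit.
    by apply: sorted_filter; [exact: lt_trans|exact: map_labs_sorted].
  move=> x; apply/mapP/idP => [[i]|xc].
    rewrite mem_filter => /andP[lt_i]; rewrite (perm_mem (lab_perm nf)) mem_iota /= => iM ->.
    by rewrite pts_crit.
  have := crit_sub nf xc => /mapP[i iL ex]; exists i => //.
  rewrite mem_filter iL andbT -(pts_crit nf) -?ex //.
  by move: iL; rewrite (perm_mem (lab_perm nf)) mem_iota.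
have szf : size [seq i <- lab fb | (i < r)%N] = r.
  by have := congr1 size e; rewrite !size_map size_iota.
apply: (@eq_from_nth _ 0%N); rewrite ?size_iota // szf => k lt_k.
have lt_f : (nth 0%N [seq i <- lab fb | (i < r)%N] k < r)%N.
  have : nth 0%N [seq i <- lab fb | (i < r)%N] k \in [seq i <- lab fb | (i < r)%N].
    by rewrite mem_nth // szf.
  by rewrite mem_filter => /andP[].
apply/eqP; rewrite -(nth_uniq 0 _ _ up) ?size_pts ?nth_iota //; try lia.
have := congr1 (nth 0 ^~ k) e; rewrite !(nth_map 0%N) ?szf ?size_iota // nth_iota //.
by move=> ->.
Qed.

Lemma turns_vals fb k : nice fb -> (k <= M)%N ->
  turns (0 : R) (vals fb) k = count (fun i => i < r)%N (take k (lab fb)).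
Proof.
move=> nf; elim: k => [|k IH] lt_k; first by rewrite take0 /turns big_ord0.
rewrite turnsS IH ?(ltnW lt_k) // turn_vals // (take_nth 0%N) ?size_lab //.
by rewrite -cats1 count_cat /= addn0.
Qed.

(** The turns of the pattern are the places of the critical points, whose labels appear in
    increasing order; [bdlab] supplies the other labels. *)
Lemma tau_lab fb fb' : nice fb -> nice fb' -> tau fb = tau fb' -> lab fb = lab fb'.
Proof.
move=> nf nf' [er eb]; apply: (@eq_from_filter _ (fun i => i < r)%N).
- apply: (@eq_from_nth _ false); rewrite !size_map ?size_lab // => k lt_k.
  rewrite !(nth_map 0%N) ?size_lab // -!turn_vals //.
  by rewrite -!turn_rk ?size_vals // er.
- by rewrite !filter_lab.
- have E (fb0 : config) : [seq x <- lab fb0 | predC (fun i => i < r)%N x] = bdlab fb0.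
    by apply: eq_filter => i /=; rewrite -leqNgt.
  by rewrite !E.
Qed.

Lemma tau_lt fb fb' i j : nice fb -> nice fb' -> rk (vals fb) = rk (vals fb') ->
  (i < M)%N -> (j < M)%N -> ((vals fb)`_i < (vals fb)`_j) = ((vals fb')`_i < (vals fb')`_j).
Proof. by move=> nf nf' e lt_i lt_j; rewrite -!rk_lt ?size_vals // e. Qed.

(** Implications in one direction suffice because all points and all values of [fb] are distinct. *)
Lemma eq_tau fb fb' : nice fb -> nice fb' ->
  (forall i j, (i < M)%N -> (j < M)%N -> (pts fb)`_i < (pts fb)`_j ->
    (pts fb')`_i < (pts fb')`_j) ->
  (forall i j, (i < M)%N -> (j < M)%N ->
    (Ppoly fb.1).[(pts fb)`_i] < (Ppoly fb.1).[(pts fb)`_j] ->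
    (Ppoly fb'.1).[(pts fb')`_i] < (Ppoly fb'.1).[(pts fb')`_j]) ->
  tau fb = tau fb'.
Proof.
move=> nf nf' HQ HY.
have el : lab fb = lab fb'.
  by apply: eq_labs; rewrite ?size_pts ?uniq_pts //; apply: uniq_pts.
rewrite /tau /bdlab el; congr (_, _); apply: eq_rk; rewrite ?size_vals // => i j lt_i lt_j.
have lt k : (k < M)%N -> (nth 0%N (lab fb') k < M)%N by exact: lab_lt.
rewrite /vals el !(nth_map 0%N) ?size_lab //.
apply/idP/idP; first by apply: HY; apply: lt.
apply: contraTT; rewrite -!leNgt le_eqVlt => /predU1P[e|h].
  have [_ _ uf] := nf; move/eqP: e.
  rewrite -!(nth_map 0 0 (horner (Ppoly fb.1))) ?size_pts ?lt //.
  rewrite nth_uniq ?size_map ?size_pts ?lt // => /eqP ->.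
  by rewrite lexx.
by apply: ltW; apply: HY; rewrite ?lt.
Qed.

(** [realize_values] places all points at once; the boundary point with label [r + j] is the one at
    the place of this label in [s]. *)
Lemma realize_type v c (W : seq R) (s : seq nat) :
  critical (Ppoly v) c -> size c = r -> size W = M -> uniq W -> perm_eq s (iota 0 M) ->
  (forall k, (k < M)%N -> turn (0 : R) W k = (nth 0%N s k < r)%N) ->
  [seq i <- s | (i < r)%N] = iota 0 r ->
  (forall k, (k < M)%N -> turn (0 : R) W k -> W`_k = (Ppoly v).[c`_(turns (0 : R) W k)]) ->
  exists b : 'rV[R]_l, [/\ nice (v, b), lab (v, b) = s & vals (v, b) = W].
Proof.
move=> cr sc sW uW ps tW fs Wc.
have szs : size s = M by rewrite (perm_size ps) size_iota.
have us : uniq s by rewrite (perm_uniq ps) iota_uniq.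
have tcount k : (k <= M)%N -> turns (0 : R) W k = count (fun i => i < r)%N (take k s).
  elim: k => [|k IH] lt_k; first by rewrite take0 /turns big_ord0.
  rewrite turnsS IH ?(ltnW lt_k) // tW // (take_nth 0%N) ?szs //.
  by rewrite -cats1 count_cat /= addn0.
have tM : turns (0 : R) W (size W) = size c.
  by rewrite sW tcount // -szs take_size -size_filter fs size_iota sc.
have [|z [sz srt fz zc zt]] := realize_values cr uW tM.
  by move=> k; rewrite sW; apply: Wc.
have index_s i : (i < M)%N -> (index i s < M)%N /\ nth 0%N s (index i s) = i.
  move=> lt_i; have iS : i \in s by rewrite (perm_mem ps) mem_iota.
  by rewrite -{1}szs index_mem iS nth_index.
pose b : 'rV[R]_l := \row_j z`_(index (r + j)%N s).
have ec : crit v = c by exact: critE.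
(* A critical label i sits at the turn of number i, because [s] lists the critical labels in
   increasing order. *)
have Q i : (i < M)%N -> (pts (v, b))`_i = z`_(index i s).
  move=> lt_i; rewrite /pts /= ec nth_cat sc; case: ltnP => ri.
    have [lt_k ek] := index_s i lt_i.
    have tk : turn (0 : R) W (index i s) by rewrite tW // ek.
    rewrite zt ?sW // tcount ?(ltnW lt_k) //; congr nth.
    have lt_c : (count (fun i => i < r)%N (take (index i s) s) < r)%N.
      rewrite -[X in (_ < X)%N](size_iota 0 r) -fs size_filter.
      rewrite -[X in (_ < count _ X)%N](cat_take_drop (index i s) s) count_cat.
      rewrite -[X in (X < _)%N]addn0 ltn_add2l -has_count (drop_nth 0%N) ?szs //.
      by rewrite ek /= ri.
    have := @nth_filter_count _ 0%N (fun i => i < r)%N s (index i s).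
    by rewrite szs ek fs => /(_ lt_k ri); rewrite nth_iota.
  have lt_j : (i - r < l)%N by rewrite ltn_subLR.
  rewrite (nth_map (Ordinal lt_j)) ?size_enum_ord // /b mxE nth_enum_ord //.
  by rewrite subnKC.
have szQ : size (pts (v, b)) = M by rewrite /pts /= ec size_cat size_map size_enum_ord sc.
have mapQ : map (nth 0 (pts (v, b))) s = z.
  apply: (@eq_from_nth _ 0); rewrite size_map szs ?sz ?sW // => k lt_k.
  rewrite (nth_map 0%N) ?szs // Q ?index_uniq ?szs //.
  have : nth 0%N s k \in s by rewrite mem_nth // szs.
  by rewrite (perm_mem ps) mem_iota.
have pQ : perm_eq z (pts (v, b)).
  rewrite -mapQ -[X in perm_eq _ X](mkseq_nth 0) szQ; exact: perm_map.
have uf : uniq (map (horner (Ppoly v)) (pts (v, b))).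
  by rewrite -(perm_uniq (perm_map _ pQ)) fz.
have lb : lab (v, b) = s.
  apply: labs_unique; [exact: map_uniq uf|by rewrite szQ|by rewrite mapQ].
exists b; split=> //; first by split; rewrite /= ?ec.
by rewrite valsE lb mapQ.
Qed.

End Boundary.
End Types.

Lemma near_fst (T U : topologicalType) (x : T * U) (P : T -> Prop) :
  (\forall v \near x.1, P v) -> \forall p \near x, P p.1.
Proof. by case: x => x y H; apply: (cvg_fst H). Qed.

Lemma near_snd (T U : topologicalType) (x : T * U) (P : U -> Prop) :
  (\forall v \near x.2, P v) -> \forall p \near x, P p.2.
Proof. by case: x => x y H; apply: (cvg_snd H). Qed.

Lemma near_dist (R : realType) (x e : R) : 0 < e -> \forall y \near x, `|y - x| < e.
Proof.
move=> e0; apply/nbhs_ballP; exists e => //= y; rewrite /ball /= distrC.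
by [].
Qed.

(** * Local constancy of the type *)

Section LocalConstancy.
Context {R : realType} (n : nat) (l : nat).
Hypothesis on : odd n.-1.
Local Notation r := n.-1.
Local Notation config := ('rV[R]_(n - 2) * 'rV[R]_l)%type.
Local Notation M := (r + l)%N.
Implicit Types (fb : config) (c : seq R).

Definition real_critical (v : 'rV[R]_(n - 2)) := critical (Ppoly v) (crit v) /\ size (crit v) = r.

Lemma near_pts fb0 (e : R) : nice fb0 -> 0 < e -> \forall fb \near fb0,
  real_critical fb.1 -> forall i : 'I_M, `|(pts fb)`_i - (pts fb0)`_i| < e.
Proof.
move=> nf e0; have [cr sc _] := nf.
have n1 : \forall fb \near fb0, forall c, critical (Ppoly fb.1) c -> size c = size (crit fb0.1) ->
    forall j, (j < size (crit fb0.1))%N -> `|c`_j - (crit fb0.1)`_j| < e.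
  by apply: (near_fst (P := fun v => forall c, critical (Ppoly v) c -> _)); exact: critical_near.
have n2 : \forall fb \near fb0, forall j : 'I_l, `|(fb.2 : 'rV[R]_l) 0 j - fb0.2 0 j| < e.
  apply: (near_snd (P := fun b : 'rV[R]_l => forall j : 'I_l, `|b 0 j - fb0.2 0 j| < e)).
  apply: (filter_forall (nbhs_filter fb0.2)) => j.
  exact: (@coord_continuous R 1 l 0 j fb0.2 _ (near_dist (fb0.2 0 j) e0)).
apply: filterS2 n1 n2 => fb h1 h2 [crv szv] i.
rewrite /pts !nth_cat szv sc; case: ltnP => le_i.
  by apply: h1; rewrite // ?szv ?sc.
have lt_j : (i - r < l)%N by rewrite ltn_subLR.
by rewrite (nth_map (Ordinal lt_j) 0) ?size_enum_ord // (nth_map (Ordinal lt_j) 0) ?size_enum_ord.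
Qed.

Lemma near_vals fb0 (e : R) : nice fb0 -> 0 < e -> forall i : 'I_M, \forall fb \near fb0,
  real_critical fb.1 -> `|(Ppoly fb.1).[(pts fb)`_i] - (Ppoly fb0.1).[(pts fb0)`_i]| < e.
Proof.
move=> nf e0 i.
have := @continuous_horner_Ppoly R n (fb0.1, (pts fb0)`_i) _ (near_dist _ e0).
move=> [[A B] /= [nA nB] AB]; have /nbhs_ballP[d /= d0 dB] := nB.
have n1 := near_fst (P := A) nA; have n2 := near_pts nf d0.
apply: filterS2 n1 n2 => fb Av H rc.
apply: (AB (fb.1, (pts fb)`_i)); split => //=.
by apply: dB; rewrite /ball /= distrC; apply: H.
Qed.

(** Points and values move little, so strict inequalities persist. That [fb] is nice is a
    conclusion, which later allows the polynomial to vary over fixed boundary points. *)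
Lemma near_tau fb0 : nice fb0 -> \forall fb \near fb0,
  real_critical fb.1 -> nice fb /\ tau fb = tau fb0.
Proof.
move=> nf; have szp fb : real_critical fb.1 -> size (pts fb) = M.
  by move=> [_ sc]; rewrite size_cat size_map size_enum_ord sc.
have n1 : \forall fb \near fb0, forall i j : 'I_M, real_critical fb.1 ->
    (pts fb0)`_i < (pts fb0)`_j -> (pts fb)`_i < (pts fb)`_j.
  apply: (filter_forall (nbhs_filter fb0)) => i; apply: (filter_forall (nbhs_filter fb0)) => j.
  case: (ltP (pts fb0)`_i (pts fb0)`_j) => [lt_ij|_]; last exact: filterE.
  have e0 : 0 < ((pts fb0)`_j - (pts fb0)`_i) / 2 by rewrite divr_gt0 // subr_gt0.
  have := near_pts nf e0; apply: filterS => fb H rc _.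
  by have := H rc i; have := H rc j; rewrite !ltr_norml => /andP[? ?] /andP[? ?]; lra.
have n2 : \forall fb \near fb0, forall i j : 'I_M, real_critical fb.1 ->
    (Ppoly fb0.1).[(pts fb0)`_i] < (Ppoly fb0.1).[(pts fb0)`_j] ->
    (Ppoly fb.1).[(pts fb)`_i] < (Ppoly fb.1).[(pts fb)`_j].
  apply: (filter_forall (nbhs_filter fb0)) => i; apply: (filter_forall (nbhs_filter fb0)) => j.
  case: (ltP (Ppoly fb0.1).[(pts fb0)`_i] (Ppoly fb0.1).[(pts fb0)`_j]) => [lt_ij|_];
    last exact: filterE.
  have e0 : 0 < ((Ppoly fb0.1).[(pts fb0)`_j] - (Ppoly fb0.1).[(pts fb0)`_i]) / 2.
    by rewrite divr_gt0 // subr_gt0.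
  have m1 := near_vals nf e0 i; have m2 := near_vals nf e0 j.
  apply: filterS2 m1 m2 => fb H1 H2 rc _.
  by have := H1 rc; have := H2 rc; rewrite !ltr_norml => /andP[? ?] /andP[? ?]; lra.
apply: filterS2 n1 n2 => fb h1 h2 rc; have [cr sc] := rc.
have szf : size (pts fb) = M by exact: szp.
have [_ _ uf0] := nf.
have nfb : nice fb.
  split=> //; apply/(uniqP 0) => i j; rewrite !inE size_map szf => lt_i lt_j.
  rewrite !(nth_map 0) ?szf // => e; apply/eqP;
    rewrite -(nth_uniq 0 _ _ uf0) ?size_map ?size_pts //.
  rewrite !(nth_map 0) ?size_pts //; apply/negPn/negP; rewrite neq_lt => /orP[] lt.
    by have := h2 (Ordinal lt_i) (Ordinal lt_j) rc lt; rewrite /= e ltxx.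
  by have := h2 (Ordinal lt_j) (Ordinal lt_i) rc lt; rewrite /= e ltxx.
split=> //; apply/esym/eq_tau => // i j lt_i lt_j.
  exact: (h1 (Ordinal lt_i) (Ordinal lt_j) rc).
exact: (h2 (Ordinal lt_i) (Ordinal lt_j) rc).
Qed.

Lemma nice_real_critical fb : nice fb -> real_critical fb.1.
Proof. by case. Qed.

Lemma locally_constant_tau : locally_constant (very_nice_M R n l) (@tau R n l).
Proof.
move=> fb0 /(niceP on) nf; have := near_tau nf; apply: filterS => fb H /(niceP on) nfb.
by have [] := H (nice_real_critical nfb).
Qed.

End LocalConstancy.

Section Turns.
Context {R : realType}.
Implicit Types (W : seq R).

Lemma leq_turns W k m : (k <= m)%N -> (turns 0%R W k <= turns 0%R W m)%N.
Proof.
elim: m => [|m IH]; first by rewrite leqn0 => /eqP ->.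
rewrite leq_eqVlt => /predU1P[->//|]; rewrite ltnS => /IH le_k.
by rewrite turnsS (leq_trans le_k) ?leq_addr.
Qed.

Lemma turns_attained W m j : (j < turns 0%R W m)%N ->
  exists k, [/\ (k < m)%N, turns 0%R W k = j & turn 0%R W k].
Proof.
elim: m => [|m IH]; first by rewrite /turns big_ord0.
rewrite turnsS; have [/IH[k [lt_k ek tk]] _|le_j lt_j] := ltnP j (turns 0%R W m).
  by exists k; split=> //; apply: ltnW.
exists m; split=> //; last by case: turn lt_j => //; rewrite addn0 ltnNge le_j.
by apply/eqP; rewrite eqn_leq le_j -ltnS (leq_trans lt_j) // -addn1 leq_add2l leq_b1.
Qed.

Lemma turns_inj W k k' : turn 0%R W k -> turn 0%R W k' -> turns 0%R W k = turns 0%R W k' -> k = k'.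
Proof.
wlog lt_k : k k' / (k < k')%N => [H|] tk tk' e.
  by case: (ltngtP k k') => // lt_k; [apply: H|apply/esym/H].
by have := leq_turns W lt_k; rewrite turnsS tk e addn1 ltnn.
Qed.

(** There is no turn strictly between i and k, so W is monotone from i to k. *)
Lemma ltd_turns_between W i k : uniq W -> (i < k)%N -> (k < size W)%N ->
  turns 0%R W i.+1 = turns 0%R W k -> ltd (odd (turns 0%R W k)) W`_i W`_k.
Proof.
move=> uW; elim: k => // k IH; rewrite ltnS leq_eqVlt => /predU1P[->|lt_i] lt_k e.
  exact: ltd_turns.
have e1 : turns 0%R W i.+1 = turns 0%R W k.
  by apply/eqP; rewrite eqn_leq leq_turns // e leq_turns.
rewrite -e e1; apply: ltd_trans (IH lt_i (ltnW lt_k) e1) _.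
by rewrite -e1 e; apply: ltd_turns.
Qed.

Lemma count_turns W m : turns 0%R W m = count id [seq turn 0%R W k | k <- iota 0 m].
Proof.
elim: m => [|m IH]; first by rewrite /turns big_ord0.
by rewrite turnsS IH -addn1 iotaD map_cat count_cat /= addn0 add0n.
Qed.

End Turns.

(** The factor in f' makes f monic, and the zero sum of the critical points removes the term of
    degree [k.+1]. *)
Lemma critical_expand (R : realType) (f : {poly R}) c k : critical f c -> size c = k.+1 ->
  \sum_(x <- c) x = 0 -> f - f.[0]%:P = 'X^(k.+2) + \sum_(i < k) f`_(k - i) *: 'X^(k - i).
Proof.
move=> [_ _ df] sc c0.
have cf i : f`_i.+1 *+ i.+1 = k.+2%:R * (\prod_(x <- c) ('X - x%:P))`_i.
  by rewrite -coef_deriv df coefZ sc.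
have inj i (a b : R) : a *+ i.+1 = b *+ i.+1 -> a = b.
  exact: pmulrnI.
have fk2 : f`_k.+2 = 1.
  apply: (@inj k.+1); rewrite cf -sc.
  have := monic_prod_XsubC c predT id; rewrite monicE /lead_coef size_prod_XsubC /=.
  by move=> /eqP ->; rewrite mulr1.
have fk1 : f`_k.+1 = 0.
  apply: (@inj k); rewrite mul0rn cf.
  have -> : k = (size c).-1 by rewrite sc.
  by rewrite coefPn_prod_XsubC ?sc // c0 oppr0 mulr0.
have sf : (size f <= k.+3)%N.
  apply/leq_sizeP => -[|i] //; rewrite ltnS => le_k.
  by apply: (@inj i); rewrite mul0rn cf nth_default ?mulr0 // size_prod_XsubC sc.
have {1}-> : f = \sum_(i < k.+3) f`_i *: 'X^i.
  rewrite -poly_def; apply/polyP => i; rewrite coef_poly; case: ltnP => // le_i.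
  by rewrite nth_default // (leq_trans sf).
rewrite 2!big_ord_recr /= big_ord_recl /= fk1 fk2 scale0r scale1r addr0 expr0 -mul_polyC mulr1.
have H (a b d : {poly R}) : a + b + d - a = d + b by ring.
rewrite horner_coef0 H; congr (_ + _).
rewrite (reindex_inj rev_ord_inj) /=; apply: eq_bigr => i _.
by rewrite /bump /= add1n subnSK.
Qed.

(** * The possible types and their realisation *)

Section Realization.
Context {R : realType} (n : nat).
Hypothesis on : odd n.-1.
Local Notation r := n.-1.

Lemma Ppoly_critical (f : {poly R}) c : critical f c -> size c = r -> \sum_(x <- c) x = 0 ->
  exists v : 'rV[R]_(n - 2), Ppoly v = f - f.[0]%:P.
Proof.
move=> cr sc c0.
have nS : n = (n - 2).+2 by case: (n) on => [|[|m]] //; rewrite !subSS subn0.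
exists (\row_i f`_(n - 2 - i)); rewrite (critical_expand (k := n - 2) cr) ?sc ?c0 //;
  last by rewrite {1}nS.
by rewrite /Ppoly {1}nS; congr (_ + _); apply: eq_bigr => i _; rewrite mxE.
Qed.

(** One turn per critical point, hence [r./2] peaks by [turns_peaks], r being odd. *)
Definition types l : seq (seq nat * seq nat) :=
  [seq (w, s) | w <- [seq w <- permutations (iota 0 (r + l)) | peaks 0%N w == r./2],
                s <- permutations (iota r l)].

Lemma types_uniq l : uniq (types l).
Proof.
apply: allpairs_uniq; rewrite ?filter_uniq ?permutations_uniq //.
by move=> [w s] [w' s'] _ _ /=.
Qed.

Lemma size_types l : size (types l) = (l`! * U (r + l) l)%N.
Proof.
rewrite size_allpairs size_permutations ?iota_uniq // size_iota size_filter.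
have e : r = (r./2).*2.+1 by rewrite -{1}(odd_double_half r) on.
rewrite count_permutations_peaks; last by rewrite e addSn.
by rewrite -e leq_addr addKn mulnC.
Qed.

Lemma mem_types l w s : ((w, s) \in types l) =
  [&& perm_eq w (iota 0 (r + l)), peaks 0%N w == r./2 & perm_eq s (iota r l)].
Proof.
apply/allpairsP/idP => [[[w' s']] /= [+ + [-> ->]]|/and3P[pw kw ps]].
  by rewrite mem_filter !mem_permutations => /andP[-> ->] ->.
by exists (w, s); rewrite mem_filter !mem_permutations kw pw ps.
Qed.

Lemma tau_types l (fb : 'rV[R]_(n - 2) * 'rV[R]_l) : nice fb -> tau fb \in types l.
Proof.
move=> nf; rewrite mem_types -(size_vals nf) rk_perm ?uniq_vals //=; apply/andP; split.
  rewrite peaks_rk; have := turns_peaks (0 : R) (s := vals fb); rewrite size_vals //.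
  rewrite turns_vals // -[X in take X _](size_lab nf) take_size -size_filter filter_lab //.
  rewrite size_iota => er; apply/eqP; have : (0 < r + l)%N by rewrite addn_gt0 odd_gt0.
  by move/er; move: (peaks _ _) => q; lia.
have h := perm_filterC (fun i => i < r)%N (lab fb).
have E : [seq x <- lab fb | predC (fun i => i < r)%N x] = bdlab fb.
  by apply: eq_filter => i /=; rewrite -leqNgt.
by rewrite -(perm_cat2l (iota 0 r)) -iotaD -{1}(filter_lab on nf) -E h; apply: lab_perm.
Qed.

(** The entries of [w], read as real numbers, are the values up to a shift. Those at the turns
    alternate, so they are critical values of some polynomial. *)
Lemma exists_type l w s : (w, s) \in types l ->
  exists fb : 'rV[R]_(n - 2) * 'rV[R]_l, nice fb /\ tau fb = (w, s).
Proof.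
rewrite mem_types => /and3P[pw /eqP kw ps].
pose W0 : seq R := [seq x%:R | x <- w].
have sw : size w = (r + l)%N by rewrite (perm_size pw) size_iota.
have rW : rk W0 = w by rewrite rk_natr // sw.
have sW : size W0 = (r + l)%N by rewrite size_map.
have uW : uniq W0.
  rewrite map_inj_uniq ?(perm_uniq pw) ?iota_uniq // => x y /eqP.
  by rewrite eqr_nat => /eqP.
have e : r = (r./2).*2.+1 by rewrite -{1}(odd_double_half r) on.
have tW : turns 0%R W0 (r + l) = r.
  by rewrite -sW turns_peaks ?sW; [rewrite -peaks_rk rW kw|rewrite e].
have [|pos posP] := @choice nat nat (fun j k => (j < r)%N ->
    [/\ (k < r + l)%N, turns 0%R W0 k = j & turn 0%R W0 k]).
  move=> j.
  have [lt_j|_] := ltnP j r; last by exists 0%N.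
  have := @turns_attained R W0 (r + l) j; rewrite tW => /(_ lt_j) [k h].
  by exists k.
have posK k : (k < r + l)%N -> turn 0%R W0 k -> (turns 0%R W0 k < r)%N /\ pos (turns 0%R W0 k) = k.
  move=> lt_k tk; have lt_t : (turns 0%R W0 k < r)%N.
    by have := leq_turns W0 lt_k; rewrite turnsS tk addn1 tW.
  by split=> //; have [_ et tt] := posP _ lt_t; apply: turns_inj et.
have [|f [c [cr sc c0 fv]]] := @exists_critical_values R r (fun j => W0`_(pos j)) on.
  move=> j lt_j; have [lt0 e0 t0] := posP j (ltnW lt_j); have [lt1 e1 t1] := posP _ lt_j.
  have lt_p : (pos j < pos j.+1)%N.
    by rewrite ltnNge; apply/negP => /(leq_turns W0); rewrite e0 e1 ltnn.
  have := ltd_turns_between uW lt_p; rewrite sW turnsS e0 t0 e1 addn1.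
  exact.
have [v ev] := Ppoly_critical cr sc c0.
have crv : critical (Ppoly v) c.
  by have [oc src df] := cr; split=> //; rewrite ev derivB derivC subr0.
(* Members of the family vanish at 0, so their critical values can agree with the turning values
   only up to this constant. *)
pose a := (Ppoly v).[c`_0] - W0`_(pos 0%N).
pose W := map (+%R a) W0.
have mono : {homo +%R a : x y / x < y} by move=> x y; rewrite ltrD2l.
have rkW : rk W = w by rewrite rk_map_mono.
have tE k : (k < r + l)%N -> turn 0%R W k = turn 0%R W0 k.
  by move=> lt_k; rewrite -!turn_rk ?size_map ?sw // rkW rW.
have tsE k : (k <= r + l)%N -> turns 0%R W k = turns 0%R W0 k.
  by move=> le_k; apply: eq_bigr => i _; rewrite tE // (leq_trans (ltn_ord i)).
pose m := [seq turn 0%R W k | k <- iota 0 (r + l)].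
have cm : count id m = r by rewrite -count_turns tsE.
have cm' : count negb m = l.
  have := count_predC id m; rewrite cm size_map size_iota => /eqP.
  by rewrite eqn_add2l => /eqP.
(* Critical labels go to the turns and the labels [s] to the remaining places. *)
have [||||ms fs fs'] := @shuffleP _ (fun i => i < r)%N m (iota 0 r) s.
- by apply/allP => i; rewrite mem_iota.
- by apply/allP => i; rewrite (perm_mem ps) mem_iota /= -leqNgt => /andP[].
- by rewrite size_iota cm.
- by rewrite (perm_size ps) size_iota cm'.
set S := shuffle m (iota 0 r) s in ms fs fs'.
have sS : size S = (r + l)%N by rewrite -(size_map (fun i => i < r)%N) ms size_map size_iota.
have pS : perm_eq S (iota 0 (r + l)).
  by rewrite -(perm_filterC (fun i => i < r)%N S) fs fs' iotaD perm_cat2l.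
have [||||||b [nb lb vb]] := @realize_type R n l v c W S crv sc.
- by rewrite size_map.
- by rewrite map_inj_uniq //; exact: addrI.
- exact: pS.
- move=> k lt_k; rewrite -(nth_map 0%N false (fun i => i < r)%N) ?sS // ms.
  by rewrite (nth_map 0%N) ?size_iota // nth_iota.
- exact: fs.
- move=> k lt_k; rewrite tE // tsE ?(ltnW lt_k) // => tk; have [lt_t ep] := posK k lt_k tk.
  rewrite (nth_map 0) ?sW // /a; have := fv _ lt_t; rewrite ep ev !hornerD !hornerN !hornerC => h.
  by rewrite -[LHS](addrC W0`_k); move: h; move: (f.[c`_0]) (f.[c`_(turns 0%R W0 k)]) => x y h; lra.
exists (v, b); split=> //; rewrite /tau vb rkW; congr (_, _).
by rewrite /bdlab lb -fs'; apply: eq_filter => i /=; rewrite -leqNgt.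
Qed.

End Realization.

(** * Connectedness of the set of morsifications of a given type *)

Section Inverse.
Context {R : realType}.
Implicit Types (f : {poly R}) (c : seq R).

Lemma critical_cle_inj f c x y : critical f c -> x \notin c -> y \notin c ->
  cle c x = cle c y -> f.[x] = f.[y] -> x = y.
Proof.
move=> cr; have [_ sc _] := cr; have uc := lt_sorted_uniq sc.
wlog lt_xy : x y / x < y => [H|] xc yc e ef.
  by case: (ltgtP x y) => // lt; [apply: H|apply/esym/H].
have := critical_monotone cr lt_xy; rewrite ef e (cleE y uc) (negbTE yc) addn0 => /(_ erefl).
by case: odd; rewrite /ltd ltxx.
Qed.

(* Continuity of the inverse branches of [f]. *)
Lemma critical_inverse_near f c x0 (e : R) : critical f c -> x0 \notin c -> 0 < e ->
  exists2 d, 0 < d & forall x, x \notin c -> cle c x = cle c x0 ->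
    `|f.[x] - f.[x0]| < d -> `|x - x0| < e.
Proof.
move=> cr x0c e0; have [_ sc _] := cr; have uc := lt_sorted_uniq sc.
have clN x : x \notin c -> clt c x = cle c x by move=> xc; rewrite (cleE x uc) (negbTE xc) addn0.
pose q := cle c x0.
have sgn b (x y : R) : ltd b x y = (0 < (-1) ^+ (~~ b) * (y - x)).
  by case: b; rewrite /ltd /= ?expr0 ?expr1 ?mul1r ?mulN1r ?oppr_gt0 ?subr_gt0 ?subr_lt0.
pose s : R := (-1) ^+ (~~ odd q).
have ss z : `|s * z| = `|z| by rewrite /s normrM normr_sign mul1r.
have mono x y : x < y -> cle c x = q -> clt c y = q -> 0 < s * (f.[y] - f.[x]).
  by move=> xy e1 e2; rewrite /s -sgn -{1}e1; apply: critical_monotone; rewrite ?e1 ?e2.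
have [d1 d10 H1] : exists2 d, 0 < d & forall x, x \notin c -> cle c x = q ->
    `|f.[x] - f.[x0]| < d -> x < x0 + e.
  have lt_x0 : x0 < x0 + e by rewrite ltrDl.
  (* If no critical point separates [x0] from [x0 + e], the value at [x0 + e] gives the bound;
     otherwise the whole branch lies to the left of [x0 + e]. *)
  have [e1|ne] := eqVneq (clt c (x0 + e)) q.
    exists (s * (f.[x0 + e] - f.[x0])); first exact: mono.
    move=> x xc cx; rewrite -ss; apply: contraTlt => le_x; rewrite -leNgt.
    apply: le_trans (ler_norm _); rewrite -subr_ge0 -mulrBr opprB addrA subrK.
    move: le_x; rewrite le_eqVlt => /predU1P[->|lt_x]; first by rewrite subrr mulr0.
    apply/ltW/mono; rewrite ?clN //; apply/eqP; rewrite eqn_leq -{1}cx cle_le ?ltW //=.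
    by rewrite -e1 clt_le_cle.
  exists 1 => // x xc cx _; rewrite ltNge; apply: contraNN ne => le_x.
  by rewrite eqn_leq -{1}cx -clN // clt_le // /q cle_le_clt.
have [d2 d20 H2] : exists2 d, 0 < d & forall x, x \notin c -> cle c x = q ->
    `|f.[x] - f.[x0]| < d -> x0 - e < x.
  have lt_x0 : x0 - e < x0 by rewrite gtrBl.
  have [e1|ne] := eqVneq (cle c (x0 - e)) q.
    exists (s * (f.[x0] - f.[x0 - e])); first by apply: mono; rewrite ?clN.
    move=> x xc cx; rewrite distrC -ss; apply: contraTlt => le_x; rewrite -leNgt.
    apply: le_trans (ler_norm _); rewrite -subr_ge0 -mulrBr.
    have -> : f.[x0] - f.[x] - (f.[x0] - f.[x0 - e]) = f.[x0 - e] - f.[x] by ring.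
    move: le_x; rewrite le_eqVlt => /predU1P[->|lt_x]; first by rewrite subrr mulr0.
    apply/ltW/mono => //; apply/eqP; rewrite eqn_leq -{1}e1 clt_le_cle /= -cx.
    exact: cle_le_clt.
  exists 1 => // x xc cx _; rewrite ltNge; apply: contraNN ne => le_x.
  rewrite eqn_leq; apply/andP; split; last by rewrite -cx cle_le.
  by rewrite /q -[leqRHS]clN // cle_le_clt.
exists (Num.min d1 d2); first by rewrite lt_min d10.
move=> x xc cx; rewrite lt_min => /andP[/H1 h1 /H2 h2].
by rewrite ltr_norml ltrBlDl ltrBrDl h1 // h2.
Qed.

End Inverse.

Section Points.
Context {R : realType} (n l : nat).
Hypothesis on : odd n.-1.
Local Notation r := n.-1.
Local Notation M := (r + l)%N.
Local Notation config := ('rV[R]_(n - 2) * 'rV[R]_l)%type.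
Implicit Types fb : config.

Lemma index_lab fb i : nice fb -> (i < M)%N ->
  (index i (lab fb) < M)%N /\ nth 0%N (lab fb) (index i (lab fb)) = i.
Proof.
move=> nf lt_i; have iL : i \in lab fb by rewrite (perm_mem (lab_perm nf)) mem_iota.
by rewrite -{1}(size_lab nf) index_mem nth_index.
Qed.

Lemma pts_le fb i j : nice fb -> (i < M)%N -> (j < M)%N ->
  ((pts fb)`_i <= (pts fb)`_j) = (index i (lab fb) <= index j (lab fb))%N.
Proof.
move=> nf lt_i lt_j; have [li ei] := index_lab nf lt_i; have [lj ej] := index_lab nf lt_j.
have := @sorted_nth_le R _ (index i (lab fb)) (index j (lab fb)) (map_labs_sorted (uniq_pts nf)).
rewrite size_map -/(lab fb) (size_lab nf) !(nth_map 0%N) ?size_lab // ei ej.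
by move=> ->.
Qed.

Lemma cle_pts fb i : nice fb -> (i < M)%N -> cle (crit fb.1) (pts fb)`_i =
  count (fun j => index j (lab fb) <= index i (lab fb))%N (iota 0 r).
Proof.
move=> nf lt_i; have [_ sc _] := nf.
rewrite /cle -{1}[crit fb.1](mkseq_nth 0) sc count_map; apply: eq_in_count => j.
rewrite mem_iota /= add0n => lt_j; rewrite -pts_le ?(leq_trans lt_j) ?leq_addr //.
by have -> : (pts fb)`_j = (crit fb.1)`_j by rewrite /pts nth_cat sc lt_j.
Qed.

Lemma pts_bd fb (j : 'I_l) : nice fb -> (pts fb)`_(r + j) = fb.2 0 j.
Proof.
move=> [_ sc _]; rewrite /pts nth_cat sc ltnNge leq_addr /= addKn.
by rewrite (nth_map j) ?size_enum_ord // nth_ord_enum.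
Qed.

Lemma vals_index fb i : nice fb -> (i < M)%N ->
  (Ppoly fb.1).[(pts fb)`_i] = (vals fb)`_(index i (lab fb)).
Proof.
move=> nf lt_i; have [li ei] := index_lab nf lt_i.
by rewrite (nth_map 0%N) ?size_lab // ei.
Qed.

Lemma lab_turns fb k : nice fb -> (k < M)%N -> (nth 0%N (lab fb) k < r)%N ->
  turns 0%R (vals fb) k = nth 0%N (lab fb) k.
Proof.
move=> nf lt_k lt_r; rewrite turns_vals ?(ltnW lt_k) //.
have := @nth_filter_count _ 0%N (fun i => i < r)%N (lab fb) k.
rewrite size_lab // filter_lab // => /(_ lt_k lt_r); rewrite nth_iota //.
rewrite -[X in (_ < X)%N](size_iota 0 r) -(filter_lab on nf) size_filter.
rewrite -[X in (_ < count _ X)%N](cat_take_drop k (lab fb)) count_cat.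
rewrite -[X in (X < _)%N]addn0 ltn_add2l -has_count (drop_nth 0%N) ?size_lab //.
by rewrite /= lt_r.
Qed.

Lemma vals_turn fb k : nice fb -> (k < M)%N -> turn 0%R (vals fb) k ->
  (vals fb)`_k = (Ppoly fb.1).[(crit fb.1)`_(turns 0%R (vals fb) k)].
Proof.
move=> nf lt_k; rewrite turn_vals // => lt_r; rewrite lab_turns //.
have [_ sc _] := nf.
by rewrite (nth_map 0%N) ?size_lab // /pts nth_cat sc lt_r.
Qed.

Lemma bd_crit fb (j : 'I_l) : nice fb -> fb.2 0 j \notin crit fb.1.
Proof.
by move=> nf; rewrite -pts_bd // pts_crit ?ltn_add2l // -leqNgt leq_addr.
Qed.

(** A boundary point is determined by its branch and its value. *)
Lemma nice_eq (v : 'rV[R]_(n - 2)) (b b' : 'rV[R]_l) : nice (v, b) -> nice (v, b') ->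
  lab (v, b) = lab (v, b') -> vals (v, b) = vals (v, b') -> b = b'.
Proof.
move=> nf nf' el ev; apply/rowP => j; have [cr _ _] := nf.
have lt_j : (r + j < M)%N by rewrite ltn_add2l.
apply: (critical_cle_inj cr); rewrite ?(bd_crit j nf) ?(bd_crit j nf') //.
  by have := cle_pts nf lt_j; have := cle_pts nf' lt_j; rewrite !pts_bd //= el => -> ->.
by have := vals_index nf lt_j; have := vals_index nf' lt_j; rewrite !pts_bd //= el ev => -> ->.
Qed.

End Points.

Section Interpolation.
Context {R : realType}.
Implicit Types (W : seq R) (x : R).

Definition interp W0 W1 x : seq R :=
  [seq (1 - x) * W0`_k + x * W1`_k | k <- iota 0 (size W0)].

Lemma nth_interp W0 W1 x k : (k < size W0)%N ->
  (interp W0 W1 x)`_k = (1 - x) * W0`_k + x * W1`_k.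
Proof. by move=> lt_k; rewrite (nth_map 0%N) ?size_iota // nth_iota. Qed.

Lemma size_interp W0 W1 x : size (interp W0 W1 x) = size W0.
Proof. by rewrite size_map size_iota. Qed.

Lemma interp0 W0 W1 : interp W0 W1 0 = W0.
Proof.
apply: (@eq_from_nth _ 0); rewrite size_interp // => k lt_k.
by rewrite nth_interp // subr0 mul1r mul0r addr0.
Qed.

Lemma interp1 W0 W1 : size W0 = size W1 -> interp W0 W1 1 = W1.
Proof.
move=> e; apply: (@eq_from_nth _ 0); rewrite size_interp // => k lt_k.
by rewrite nth_interp // subrr mul0r add0r mul1r.
Qed.

Lemma rk_interp W0 W1 x : size W0 = size W1 -> rk W0 = rk W1 -> 0 <= x <= 1 ->
  rk (interp W0 W1 x) = rk W0.
Proof.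
move=> sW e /andP[x0 x1]; apply: eq_rk; rewrite size_interp // => i j lt_i lt_j.
have e1 : (W0`_i < W0`_j) = (W1`_i < W1`_j) by rewrite -!rk_lt -?sW // e.
have e2 : (W0`_j < W0`_i) = (W1`_j < W1`_i) by rewrite -!rk_lt -?sW // e.
rewrite !nth_interp //; have [h|h] := ltP W0`_i W0`_j.
  have h1 : W1`_i < W1`_j by rewrite -e1.
  have [->|xn0] := eqVneq x 0; first by rewrite subr0 !mul1r !mul0r !addr0.
  rewrite ler_ltD //; first by rewrite ler_wpM2l ?subr_ge0 // ltW.
  by rewrite ltr_pM2l // lt_neqAle eq_sym xn0.
have h1 : W1`_j <= W1`_i by rewrite leNgt -e1 -leNgt.
by apply/negbTE; rewrite -leNgt lerD // ler_wpM2l // subr_ge0.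
Qed.

Lemma near_interp W0 W1 k x0 (d : R) : 0 < d -> (k < size W0)%N -> \forall x \near x0,
  `|(interp W0 W1 x)`_k - (interp W0 W1 x0)`_k| < d.
Proof.
move=> d0 lt_k; pose e := d / (`|W1`_k - W0`_k| + 1).
have p0 : 0 < `|W1`_k - W0`_k| + 1 by rewrite ltr_pwDr.
have e0 : 0 < e by rewrite divr_gt0.
have := near_dist x0 e0; apply: filterS => x; rewrite /e ltr_pdivlMr // => lt_x.
rewrite !nth_interp //; apply: le_lt_trans lt_x.
have -> : (1 - x) * W0`_k + x * W1`_k - ((1 - x0) * W0`_k + x0 * W1`_k) =
  (x - x0) * (W1`_k - W0`_k) by ring.
by rewrite normrM ler_wpM2l // lerDl.
Qed.

End Interpolation.

Section Fibres.
Context {R : realType} (n l : nat).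
Hypothesis on : odd n.-1.
Local Notation r := n.-1.
Local Notation M := (r + l)%N.
Local Notation config := ('rV[R]_(n - 2) * 'rV[R]_l)%type.
Local Notation S := (level (very_nice_M R n l) (@tau R n l)).
Implicit Types (fb : config) (v : 'rV[R]_(n - 2)) (b : 'rV[R]_l).

Lemma levelP t fb : S t fb <-> nice fb /\ tau fb = t.
Proof. by split=> [[/(niceP on)]|[/(niceP on)]]. Qed.

(** Along the segment between the two value sequences the pattern is constant. The values at the
    turns are fixed, being critical values of the same polynomial, so every sequence on the way is
    realised over v; the boundary points follow continuously through the inverse branches. *)
Lemma fibre_constant t (g : config -> Prop) v b0 b1 : locally_constant (S t) g ->
  S t (v, b0) -> S t (v, b1) -> g (v, b0) = g (v, b1).
Proof.
move=> lg S0 S1; have [n0 t0] := (levelP t (v, b0)).1 S0; have [n1 t1] := (levelP t (v, b1)).1 S1.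
have et : tau (v, b0) = tau (v, b1) by rewrite t0.
have el := tau_lab on n0 n1 et.
set W0 := vals (v, b0); set W1 := vals (v, b1).
have sW0 : size W0 = M by exact: size_vals.
have sW1 : size W1 = M by exact: size_vals.
have sW : size W0 = size W1 by rewrite sW0.
have eW : rk W0 = rk W1 by case: et.
have [cr sc _] := n0.
have path (x : R) : 0 <= x <= 1 -> exists b, [/\ nice (v, b), lab (v, b) = lab (v, b0) & vals (v,
  b) = interp W0 W1 x].
  move=> x01; have rkx := rk_interp sW eW x01.
  have tE k : (k < M)%N -> turn 0%R (interp W0 W1 x) k = turn 0%R W0 k.
    by move=> lt_k; rewrite -!turn_rk ?size_interp ?sW0 // rkx.
  have tsE k : (k <= M)%N -> turns 0%R (interp W0 W1 x) k = turns 0%R W0 k.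
    by move=> le_k; apply: eq_bigr => i _; rewrite tE // (leq_trans (ltn_ord i)).
  apply: (realize_type cr sc); rewrite ?size_interp ?sW0 //.
  - have := uniq_vals n0; rewrite -/W0 => u0; have := rk_perm u0 => pr.
    have : uniq (rk (interp W0 W1 x)) by rewrite rkx (perm_uniq pr) iota_uniq.
    exact: map_uniq.
  - exact: lab_perm.
  - by move=> k lt_k; rewrite tE // turn_vals.
  - exact: filter_lab.
  - move=> k lt_k; rewrite tE // tsE ?(ltnW lt_k) // => tk.
    rewrite nth_interp ?sW0 // (vals_turn on n0) //.
    have tk1 : turn 0%R W1 k by rewrite -turn_rk ?sW1 // -eW turn_rk ?sW0.
    rewrite (vals_turn on n1 lt_k tk1) /=.
    have -> : turns 0%R (vals (v, b1)) k = turns 0%R (vals (v, b0)) k.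
      by rewrite !turns_vals ?(ltnW lt_k) // el.
    by rewrite -mulrDl subrK mul1r.
have [|B BP] := @choice R 'rV[R]_l (fun x b => 0 <= x <= 1 ->
    [/\ nice (v, b), lab (v, b) = lab (v, b0) & vals (v, b) = interp W0 W1 x]).
  move=> x; have [/path[b bP]|_] := boolP (0 <= x <= 1); first by exists b.
  by exists 0.
have tB (x : R) : 0 <= x <= 1 -> S t (v, B x).
  move=> x01; have [nB lB vB] := BP x x01; apply/levelP; split=> //.
  by rewrite -t0 /tau /bdlab lB vB rk_interp.
have e01 : (0 : R) <= (0 : R) <= 1 by rewrite lexx ler01.
have e11 : (0 : R) <= 1 <= (1 : R) by rewrite lexx ler01.
have B0 : B 0 = b0.
  have [nB lB vB] := BP 0 e01; apply: (nice_eq nB n0); rewrite ?lB // vB.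
  exact: interp0.
have B1 : B 1 = b1.
  have [nB lB vB] := BP 1 e11; apply: (nice_eq nB n1); rewrite ?lB // vB.
  exact: interp1.
have cB (x0 e : R) : 0 <= x0 <= 1 -> 0 < e -> \forall x \near x0, 0 <= x <= 1 ->
    forall j : 'I_l, `|B x 0 j - B x0 0 j| < e.
  move=> x01 e0.
  suff : \forall x \near x0, forall j : 'I_l, 0 <= x <= 1 -> `|B x 0 j - B x0 0 j| < e.
    by apply: filterS => x H x1 j; exact: H.
  apply: (filter_forall (nbhs_filter x0)) => j.
  have [nB lB vB] := BP x0 x01.
  have [d d0 Hd] := critical_inverse_near cr (bd_crit j nB) e0.
  have lt_j : (r + j < M)%N by rewrite ltn_add2l.
  have [lt_k _] := index_lab n0 lt_j.
  have := @near_interp R W0 W1 (index (r + j)%N (lab (v, b0))) x0 d d0; rewrite sW0 => /(_ lt_k).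
  apply: filterS => x near_x x1; have [nx lx vx] := BP x x1.
  apply: (Hd (B x 0 j)); first exact: (bd_crit j nx).
    by have := cle_pts nx lt_j; have := cle_pts nB lt_j; rewrite !pts_bd //= lx lB => -> ->.
  have := vals_index nB lt_j; have := vals_index nx lt_j.
  by rewrite !pts_bd //= vx vB lx lB => -> ->.
pose G (x : R) : Prop := g (v, B x).
have : G 0 = G 1.
  apply: (@connected_constant R^o Prop `[(0 : R), 1]%classic G).
  - exact: segment_connected.
  - move=> x0; rewrite /= in_itv /= => x01.
    have [[A C] /= [nA nC] AC] := lg _ (tB _ x01).
    have /nbhs_ballP[e /= e0 eC] := nC.
    have := cB _ _ x01 e0; apply: filterS => x Bx; rewrite /= in_itv /= => x1.
    apply: (AC (v, B x)) (tB _ x1); split=> /=; first exact: nbhs_singleton nA.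
    apply: eC; split=> // i j; rewrite /ball /= distrC (ord1 i); exact: Bx.
  - by rewrite /= in_itv.
  - by rewrite /= in_itv.
by rewrite /G B0 B1.
Qed.

Lemma rk_critical_values fb fb' : nice fb -> nice fb' -> tau fb = tau fb' ->
  rk (map (horner (Ppoly fb.1)) (crit fb.1)) = rk (map (horner (Ppoly fb'.1)) (crit fb'.1)).
Proof.
move=> nf nf' et; have [_ sc _] := nf; have [_ sc' _] := nf'.
have el := tau_lab on nf nf' et.
have cE (p : config) i : nice p -> (i < r)%N ->
    (map (horner (Ppoly p.1)) (crit p.1))`_i = (vals p)`_(index i (lab p)).
  move=> np lt_i; have [_ sp _] := np; rewrite -vals_index ?(leq_trans lt_i) ?leq_addr //.
  by rewrite (nth_map 0) ?sp // /pts nth_cat sp lt_i.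
apply: eq_rk; rewrite !size_map sc ?sc' // => i j lt_i lt_j.
rewrite !cE // el; have lt_M k : (k < r)%N -> (k < M)%N by move=> h;
  rewrite (leq_trans h) ?leq_addr.
have [li _] := index_lab nf' (lt_M _ lt_i); have [lj _] := index_lab nf' (lt_M _ lt_j).
by apply: tau_lt => //; case: et.
Qed.

(** An increasing map carries the critical values of one polynomial to those of the other; applied
    to all values it preserves the pattern. *)
Lemma fibre_nonempty t fb v : S t fb -> real_critical v ->
  rk (map (horner (Ppoly v)) (crit v)) = rk (map (horner (Ppoly fb.1)) (crit fb.1)) ->
  exists b, S t (v, b).
Proof.
move=> /levelP[nf <-] [crv sv] e; have [cr sc _] := nf.
pose X j := (Ppoly fb.1).[(crit fb.1)`_j]; pose Y j := (Ppoly v).[(crit v)`_j].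
have XY i j : (i < r)%N -> (j < r)%N -> (X i < X j) = (Y i < Y j).
  move=> lt_i lt_j; rewrite /X /Y -!(nth_map 0 0 (horner _)) ?sc ?sv //.
  by rewrite -!rk_lt ?size_map ?sc ?sv // e.
have uX : uniq (map X (iota 0 r)).
  have := uniq_pts nf; have [_ _] := nf; rewrite map_cat cat_uniq => /andP[+ _] _.
  by rewrite -{1}[crit fb.1](mkseq_nth 0) -map_comp sc.
pose s := sort (relpre X <=%R) (iota 0 r).
have ps : perm_eq s (iota 0 r) by rewrite perm_sort.
have sX : sorted (relpre X <%R) s.
  rewrite -sorted_map lt_sorted_uniq_le (perm_uniq (perm_map X ps)) uX /=.
  by rewrite /s -sort_map sort_le_sorted.
have sY : sorted (relpre Y <%R) s.
  apply/(sortedP 0%N) => k lt_k; have mem_s i : (i < size s)%N -> (nth 0%N s i < r)%N.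
    by move=> lt_i; have := mem_nth 0%N lt_i; rewrite (perm_mem ps) mem_iota.
  by rewrite /= -XY ?mem_s ?(ltnW lt_k) //; move/(sortedP 0%N): sX => /(_ _ lt_k).
have [h hm hX] := increasing_extension sX sY.
pose W := map h (vals fb).
have rkW : rk W = rk (vals fb) by exact: rk_map_mono.
have sW : size W = M by rewrite size_map size_vals.
have tE k : (k < M)%N -> turn 0%R W k = turn 0%R (vals fb) k.
  by move=> lt_k; rewrite -!turn_rk ?sW ?size_vals // rkW.
have tsE k : (k <= M)%N -> turns 0%R W k = turns 0%R (vals fb) k.
  by move=> le_k; apply: eq_bigr => i _; rewrite tE // (leq_trans (ltn_ord i)).
have [|||||b [nb lb vb]] := @realize_type R n l v (crit v) W (lab fb) crv sv sW.
- have : uniq (rk W) by rewrite rkW (perm_uniq (rk_perm (uniq_vals nf))) iota_uniq.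
  exact: map_uniq.
- exact: lab_perm.
- by move=> k lt_k; rewrite tE // turn_vals.
- exact: filter_lab.
- move=> k lt_k; rewrite tE // tsE ?(ltnW lt_k) // => tk.
  rewrite (nth_map 0) ?size_vals // (vals_turn on nf) //; apply: hX.
  by rewrite (perm_mem ps) mem_iota lab_turns // -turn_vals.
by exists b; apply/levelP; split=> //; rewrite /tau /bdlab lb vb rkW.
Qed.

End Fibres.

(** * Connectedness of each type and the count *)

Section Counting.
Context {R : realType} (n : nat).
Hypothesis on : odd n.-1.
Local Notation r := n.-1.
Local Notation S l := (level (very_nice_M R n l) (@tau R n l)).

Lemma types_mem l fb : very_nice_M R n l fb -> tau fb \in types n l.
Proof. by move=> /(niceP on); apply: tau_types. Qed.

Lemma types_realized l t : t \in types n l -> exists2 fb, very_nice_M R n l fb & tau fb = t.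
Proof.
by case: t => w s /(exists_type (R := R) on)[fb [nf tf]]; exists fb => //; apply/(niceP on).
Qed.

(** At l = 0 the given formula reduces to the single term K_(n-1), which supplies this. *)
Hypothesis comp0 : ncomponents (very_nice_M R n 0) = U n.-1 0.

Lemma level0_connected t : connected (S 0 t).
Proof.
apply: (@levels_connected _ _ _ _ (types n 0)).
- exact: types_uniq.
- exact: locally_constant_tau.
- exact: types_realized.
- by rewrite comp0 U_gt0.
- by rewrite comp0 size_types // fact0 mul1n addn0.
Qed.

Lemma nice_critical l (fb : 'rV[R]_(n - 2) * 'rV[R]_l) (b : 'rV[R]_0) :
  nice fb -> nice (fb.1, b).
Proof.
move=> [cr sc]; rewrite map_cat cat_uniq => /andP[u _]; split=> //.
rewrite /pts /= (_ : enum 'I_0 = [::]) ?cats0 //.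
by apply/eqP; rewrite -size_eq0 size_enum_ord.
Qed.

Lemma tau0E (v v' : 'rV[R]_(n - 2)) (b b' : 'rV[R]_0) : nice (v, b) -> nice (v', b') ->
  rk (map (horner (Ppoly v)) (crit v)) = rk (map (horner (Ppoly v')) (crit v')) ->
  tau (v, b) = tau (v', b').
Proof.
have E (p : 'rV[R]_(n - 2) * 'rV[R]_0) : nice p ->
  lab p = iota 0 r /\ vals p = map (horner (Ppoly p.1)) (crit p.1).
  move=> np; have [_ sc _] := np.
  have e0 : pts p = crit p.1.
    rewrite /pts (_ : enum 'I_0 = [::]) ?cats0 //.
    by apply/eqP; rewrite -size_eq0 size_enum_ord.
  have el : lab p = iota 0 r.
    rewrite -(filter_lab on np); apply/esym/all_filterP/allP => i.
    by rewrite (perm_mem (lab_perm np)) mem_iota addn0.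
  by split=> //; rewrite valsE el e0 -[in RHS](mkseq_nth 0 (crit p.1)) sc.
move=> np np' e; have [l1 v1] := E _ np; have [l2 v2] := E _ np'.
by rewrite /tau /bdlab l1 l2 v1 v2 /= e.
Qed.

Lemma level_connected l t : connected (S l t).
Proof.
apply: constant_connected => g [u0 b0] [u1 b1] lg S0 S1.
have [n0 t0] := (levelP on t _).1 S0; have [n1 t1] := (levelP on t _).1 S1.
pose o : 'rV[R]_0 := 0.
pose t' := tau (u0, o).
have no0 : nice (u0, o) := nice_critical o n0.
have no1 : nice (u1, o) := nice_critical o n1.
have E0 : S 0 t' (u0, o) by apply/(levelP on).
have E1 : S 0 t' (u1, o).
  apply/(levelP on); split=> //; apply: tau0E => //.
  by apply: (rk_critical_values on n1 n0); rewrite t1.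
(* As g is constant on fibres, it descends to a function of the polynomial alone. *)
pose h (p : 'rV[R]_(n - 2) * 'rV[R]_0) : Prop := exists b, S l t (p.1, b) /\ g (p.1, b).
have hE v b (o' : 'rV[R]_0) : S l t (v, b) -> h (v, o') = g (v, b).
  move=> Sb; apply/propext; split=> [[b' [Sb' gb']]|gb]; last by exists b.
  by rewrite (fibre_constant on lg Sb Sb').
have lh : locally_constant (S 0 t') h.
  move=> [v o'] Sv; have [nv tv] := (levelP on _ _).1 Sv.
  have [b Sb] : exists b, S l t (v, b).
    apply: (fibre_nonempty on S0); first exact: nice_real_critical nv.
    by apply: (rk_critical_values on nv no0).
  have [nb tb] := (levelP on _ _).1 Sb.
  (* The polynomial moves while the boundary points [b] stay fixed; by [near_tau] the pair remains
     in the level. *)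
  have slice (P : 'rV[R]_(n - 2) * 'rV[R]_l -> Prop) : (\forall q \near (v, b), P q) ->
      \forall p \near (v, o'), P (p.1, b).
    move=> [[A B] /= [nA nB] AB]; apply: filterS (near_fst (x := (v, o')) (P := A) nA) => p Ap.
    by apply: (AB (p.1, b)); split=> //=; exact: nbhs_singleton nB.
  have m1 := slice _ (near_tau on nb); have m2 := slice _ (lg _ Sb).
  apply: filterS2 m1 m2 => -[v' o''] /= H1 H2 /(levelP on)[nv' _].
  have [nb' tb'] := H1 (nice_real_critical nv').
  have Sb' : S l t (v', b) by apply/(levelP on); split=> //; rewrite tb'.
  by rewrite (hE v' b) // (hE v b) //; apply: H2.
by rewrite -(hE _ _ o S0) -(hE _ _ o S1); apply: (connected_constant (@level0_connected t') lh).
Qed.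

Theorem ncomponents_very_nice_M l : ncomponents (very_nice_M R n l) = (l`! * U (n.-1 + l) l)%N.
Proof.
rewrite -size_types //; apply: (@ncomponents_levels _ _ _ _ (types n l)).
- exact: types_uniq.
- exact: locally_constant_tau.
- exact: types_mem.
- exact: types_realized.
- exact: level_connected.
Qed.

End Counting.

Lemma Knl_pos (R : realType) (n l : nat) : (0 < n)%N ->
  Knl R n%:Z l = (ncomponents (very_nice_M R n l))%:Z.
Proof. by case: n => // n _; case: l. Qed.

Theorem corollary5p5 (R : realType) (K : int -> R) (p : nat -> nat -> {poly R})
  (hK : bernoulli_euler K)
  (hdeg : forall k d : nat, (d < k)%N -> size (p k d) = (k - d)%N)
  (hp : forall n l : nat, (n, l) <> (0%N, 0%N) ->
    (Knl R n%:Z l)%:~R =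
      \sum_(1 <= k < l./2 + 2)
        coef p k l n%:Z * K (n%:Z + 2 * (l%:Z - k%:Z) + 1)) :
  (forall (n : int) (l : nat), n <= 0 -> Num.max 1 (- n) < l%:Z ->
    0 = Knl R n l /\
    (Knl R n l)%:~R =
      K (n + 2 * l%:Z - 1)
      + \sum_(2 <= k < l./2 + 2)
          coef p k l n * K (n + 2 * (l%:Z - k%:Z) + 1))
  /\
  (forall l : nat, (1 <= l)%N ->
    ((l - 1)`!)%:Z = Knl R (- l%:Z) l /\
    (Knl R (- l%:Z) l)%:~R =
      K (l%:Z - 1)
      + \sum_(2 <= k < l./2 + 2)
          coef p k l (- l%:Z) * K (l%:Z - 2 * k%:Z + 1)).
Proof.
have KU := bernoulli_euler_U hK.
have Ktan := bernoulli_euler_tanpoly hK.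
apply: (corollary_of_even_counts hdeg hp KU Ktan) => n l en n_gt0; rewrite Knl_pos //; congr Posz.
have on : odd n.-1 by case: n en n_gt0 => //= n; rewrite negbK.
apply: ncomponents_very_nice_M => //.
have : (n, 0%N) <> (0%N, 0%N) by case; lia.
move=> /hp; rewrite Knl_pos // big_nat1 (coef_p10 hdeg hp KU) mul1r.
have -> : n%:Z + 2 * (0%:Z - 1%:Z) + 1 = n.-1%:Z by lia.
by rewrite KU -pmulrn => /eqP; rewrite eqr_nat => /eqP.
Qed.
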